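(* Let $N\ge3$ and $m\ge1$. The formulas $$\bar\Theta^{\mathrm{cl}}(A)=\bar\iota(A),\qquad \bar\Theta^{\mathrm{cl}}(y)=\frac{(-1)^{\frac m2}}{2}\cdot\bar\iota(y),\qquad \bar\Theta^{\mathrm{cl}}(\zeta_k)=(-1)^{m-k}\,\bar\Theta_k\qquad(A\in\mathfrak{so}_N,\ y\in V_N,\ 0\le k\le m-1)$$ define an isomorphism $\bar\Theta^{\mathrm{cl}}:H_m^{\mathrm{cl}}(\mathfrak{so}_N,V_N)\to S(\mathfrak z_{N,m})\simeq\mathbb{C}[\mathrm{S}_{N,m}]$ of Poisson algebras.
   Context: The ground field is $\mathbb{C}$. $V_N=\mathbb{C}^N$ with $(x,y)=x^{T}y$ and standard (orthonormal) basis $x_1,\dots,x_N$; $\mathfrak{so}_N$ is the Lie algebra of skew-symmetric $N\times N$ matrices. The Poisson algebra $H_m^{\mathrm{cl}}(\mathfrak{so}_N,V_N)$ is $S(\mathfrak{so}_N\oplus V_N)[\zeta_0,\ldots,\zeta_{m-1}]$ with $\zeta_i$ Poisson central, $\{A,B\}=[A,B]$, $\{A,x\}=A(x)$ for $A,B\in\mathfrak{so}_N$, $x\in V_N$, and $\{x,y\}=\sum_{j=0}^{m-1}\zeta_j\gamma_{2j+1}(x,y)+\gamma_{2m+1}(x,y)$ for $x,y\in V_N$. Here $\gamma_{2j+1}(x,y)\in S(\mathfrak{so}_N)\simeq\mathbb{C}[\mathfrak{so}_N]$ are defined by $$(x,A(1+\tau^2A^2)^{-1}y)\det(1+\tau^2A^2)^{-1/2}=\sum_{j\ge0}\gamma_{2j+1}(x,y)(A)\tau^{2j},\qquad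 A\in\mathfrak{so}_N$$ ($\det(\cdot)^{-1/2}$ being the power series in $\tau^2$ with constant term $1$), where $S(\mathfrak{so}_N)\simeq\mathbb{C}[\mathfrak{so}_N]$ is the natural identification coming from $\mathfrak{so}_N\simeq\mathfrak{so}_N^*$ (via an invariant form). Realize $\mathfrak g=\mathfrak{so}_{N+2m+1}$ as the Lie algebra of matrices preserving the symmetric form on $\mathbb{C}^{N+2m+1}$ with matrix $J'$, where $J'_{ij}=\delta_{ij}$, $J'_{i,N+k}=J'_{N+k,i}=0$ for $i,j\le N$, $k\le 2m+1$, and $J'_{N+k,N+l}=\delta_{k+l,2m+2}$ for $k,l\le2m+1$. With $E_{ab}$ the matrix units, put $e_m=\sum_{j=1}^mE_{N+j,N+j+1}-\sum_{j=1}^mE_{N+m+j,N+m+j+1}$, a nilpotent element of Jordan type $(1^N,2m+1)$, and let $(e_m,h,f)$ be the $\mathfrak{sl}_2$-triple in $\mathfrak g$ with $h=\mathrm{diag}(0^N,2m,2m-2,\ldots,-2m)$. Identify $\mathfrak g^*$ with $\mathfrak g$ via the Killing form $(\cdot,\cdot)$, and let $\chi\in\mathfrak g^*$ correspond to $e_m$. Let $\mathfrak z_{N,m}$ be the centralizer of $e_m$ in $\mathfrak g$, and let $\mathrm{S}_{N,m}=\chi+(\mathfrak g/[\mathfrak g,f])^*\subset\mathfrak g^*$ be the Slodowy slice, which as an affine subspace of $\mathfrak g$ is $e_m+\mathrm{Ker}(\mathrm{ad} f)$. Via the Killing form, $\mathbb{C}[\mathrm{S}_{N,m}]\simeq\mathbb{C}[\mathrm{Ker}(\mathrm{ad}f)]$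 is identified with the symmetric algebra $S(\mathfrak z_{N,m})$. The algebra $\mathbb{C}[\mathrm{S}_{N,m}]$ carries the Poisson structure inherited from $\mathbb{C}[\mathfrak g^*]=S(\mathfrak g)$ by Hamiltonian reduction: with $\mathfrak m$ the sum of the negative eigenspaces of $\mathrm{ad}\,h$ (all eigenvalues are even) and $\mathcal I$ the ideal of $S(\mathfrak g)$ generated by $\{\xi-\langle\chi,\xi\rangle:\xi\in\mathfrak m\}$, restriction to the slice gives $(S(\mathfrak g)/\mathcal I)^{\mathrm{ad}\,\mathfrak m}\simeq\mathbb{C}[\mathrm{S}_{N,m}]$, and the bracket is induced from $S(\mathfrak g)$. The map $\bar\iota:\mathfrak{so}_N\oplus V_N\oplus\mathbb{C}^m\to\mathfrak z_{N,m}$ is the vector space isomorphism which embeds $\mathfrak{so}_N$ as the top-left $N\times N$ block, embeds $V_N$ by $\bar\iota(x_i)=E_{i,N+2m+1}-E_{N+1,i}$, and sends a basis $\xi_0,\dots,\xi_{m-1}$ of $\mathbb{C}^m$ to powers of $e_m$ by $\xi_{m-j}\mapsto e_m^{2j-1}$, $1\le j\le m$. Define $P_j\in\mathbb{C}[\mathfrak{so}_{N+2m+1}]$ by $\det(I_{N+2m+1}+tX)=\sum_{j=0}^{N+2m+1}P_j(X)t^j$, and $\bar\Theta_i:=P_{2(m-i)}|_{\mathrm{S}_{N,m}}\in\mathbb{C}[\mathrm{S}_{N,m}]\simeq S(\mathfrak z_{N,m})$ for $0\le i\le m-1$.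
   Formalization: The formulas fail for the Killing form itself; here the invariant form (for g and so_N) is r times the Killing form and y maps to s(-1)^{m/2}/2 times iota(y), for all r, s with s^2 r (N+2m-1) = 2(-1)^m (s=1: original formula; r=1: Killing form). *)

(* Defs.v *)
From mathcomp Require Import all_boot all_order all_algebra.
From mathcomp Require Import mpoly complex reals ring zify.

Set Implicit Arguments.
Unset Strict Implicit.
Unset Printing Implicit Defensive.

Import Order.TTheory GRing.Theory Num.Theory.
Local Open Scope ring_scope.

(* Symmetric algebras of finite dimensional spaces are polynomial rings whose
   variables are the vectors of the library's basis [vbasis U]; the elements
   of [U] are the linear polynomials [symv U u]. *)
Section SymmetricAlgebra.
Context (K : fieldType) (vT : vectType K).
Implicit Types (U W : {vspace vT}).

Definition Sym U := {mpoly K[\dim U]}.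

Definition symv U (u : vT) : Sym U :=
  \sum_(i < \dim U) coord (vbasis U) i u *: 'X_i.

(* The biderivation of S(U) taking the values [pi u v] on u, v in U
   ([pi] is meant to be bilinear and alternating). *)
Definition biderivation U (pi : vT -> vT -> Sym U) (f g : Sym U) : Sym U :=
  \sum_(i < \dim U) \sum_(j < \dim U)
     f^`M(i) * g^`M(j) * pi (vbasis U)`_i (vbasis U)`_j.

(* The u in U with B u w = phi w for all w in W. It exists and is unique when
   phi is linear and B is a perfect pairing of U with W, which is the case in
   both uses below: U = W = so_N, and U = Ker (ad e), W = Ker (ad f). *)
Definition riesz (B : vT -> vT -> K) U W (phi : vT -> K) : vT :=
  let gram : 'M_(\dim U, \dim W) :=
    \matrix_(i, j) B (vbasis U)`_i (vbasis W)`_j in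
  let c := (\row_j phi (vbasis W)`_j) *m pinvmx gram in
  \sum_(i < \dim U) c 0 i *: (vbasis U)`_i.

End SymmetricAlgebra.

Section MatrixLie.
Context (K : fieldType) (n : nat).
Implicit Types (X Y : 'M[K]_n).

Definition lie X Y : 'M[K]_n := X *m Y - Y *m X.

Definition ad X : 'End('M[K]_n) := linfun (mulmx X) - linfun (mulmxr X).

Definition lie_preserving (J : 'M[K]_n) : {vspace 'M[K]_n} :=
  lker (linfun (mulmxr J \o trmx) + linfun (mulmx J)).

(* trace of (ad X)(ad Y) on the subalgebra g *)
Definition killing (g : {vspace 'M[K]_n}) X Y : K :=
  \sum_(i < \dim g) coord (vbasis g) i (lie X (lie Y (vbasis g)`_i)).

(* skew-symmetric matrices *)
Definition so : {vspace 'M[K]_n} := lie_preserving 1%:M.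

End MatrixLie.

(* The polynomial det (1 + t X) in t, over any commutative ring. *)
Definition det1X (T : comNzRingType) (n : nat) (X : 'M[T]_n) : {poly T} :=
  \det (1%:M + 'X *: map_mx polyC X).

Section Gamma.
Context (K : fieldType) (T : comAlgType K) (n : nat).

(* generalized binomial coefficient (-1/2 choose k) *)
Definition binom_mhalf (k : nat) : K :=
  (\prod_(i < k) (- 2%:R^-1 - i%:R)) / k`!%:R.

(* Coefficient of s^j in the binomial series of p(s)^(-1/2), for p(0) = 1:
   the terms with k > j do not contribute. *)
Definition invsqrt_coef (p : {poly T}) (j : nat) : T :=
  \sum_(k < j.+1) binom_mhalf k *: ((p - 1) ^+ k)`_j.

(* Coefficient of s^j, s = tau^2, in
   (x, A (1 + s A^2)^-1 y) det (1 + s A^2)^(-1/2),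
   i.e. gamma_{2j+1}(x, y)(A). *)
Definition gamma (j : nat) (x y : 'cV[K]_n) (A : 'M[T]_n) : T :=
  let pair (M : 'M[T]_n) : T := \sum_a \sum_b (x a 0 * y b 0) *: M a b in
  \sum_(k < j.+1) pair ((-1) ^+ k *: A ^+ (2 * k).+1)
                  * invsqrt_coef (det1X (A ^+ 2)) (j - k).

End Gamma.

Section Slodowy.
Context (C : numClosedFieldType) (N m : nat).

(* The size of the matrices of g, with rows and columns
   N+1, .., N+2m+1 numbered from 0 by 'I_(2m+1) through rshift. *)
Local Notation q := (2 * m).+1.
Local Notation n := (N + q)%N.

Definition Jform : 'M[C]_n :=
  block_mx 1%:M 0 0 (\matrix_(k, l) (k + l == 2 * m)%N%:R).

Definition gso : {vspace 'M[C]_n} := lie_preserving Jform.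

Definition em : 'M[C]_n :=
  block_mx 0 0 0 (\matrix_(k, l) ((l == k.+1 :> nat)%:R * (-1) ^+ (m <= k)%N)).

Definition hm : 'M[C]_n :=
  block_mx 0 0 0 (diag_mx (\row_(k < q) ((2 * m)%:R - (2 * k)%:R))).

(* The coefficients are forced by [e, f] = h; see [sl2_triple]. *)
Definition fm : 'M[C]_n :=
  block_mx 0 0 0
    (\matrix_(k, l) ((k == l.+1 :> nat)%:R * (-1) ^+ (m <= l)%N
                     * (l.+1 * (2 * m - l))%:R)).

Lemma lie_block (A B : 'M[C]_q) :
  lie (block_mx 0 0 0 A) (block_mx 0 0 0 B : 'M_n) =
  block_mx 0 0 0 (lie A B).
Proof.
by rewrite /lie !mulmx_block !mul0mx !mulmx0 !addr0 !add0r opp_block_mx add_block_mx !subrr.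
Qed.

Lemma lie_hm_em : lie hm em = 2 *: em.
Proof.
rewrite lie_block scale_block_mx !scaler0; congr block_mx.
apply/matrixP => k l; rewrite /lie mul_diag_mx mul_mx_diag !mxE.
case: eqP => [->|_]; last by rewrite !mul0r !mulr0 ?mul0r subrr.
rewrite !natrM !mul1r -natr1; ring.
Qed.

Lemma lie_hm_fm : lie hm fm = -2 *: fm.
Proof.
rewrite lie_block scale_block_mx !scaler0; congr block_mx.
apply/matrixP => k l; rewrite /lie mul_diag_mx mul_mx_diag !mxE.
case: eqP => [->|_]; last by rewrite !mul0r !mulr0 ?mul0r subrr.
rewrite !natrM !mul1r -natr1; ring.
Qed.

Lemma lie_em_fm : lie em fm = hm.
Proof.
rewrite lie_block; congr block_mx.
apply/matrixP => k l; rewrite !mxE.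
rewrite [X in X - _](_ : _ = (k.+1 * (2 * m - k))%:R *+ (k == l)); last first.
  have [kl|lk] := ltnP k (2 * m).
    rewrite (bigD1 (Ordinal (kl : (k.+1 < (2 * m).+1)%N))) //= !mxE /= eqxx eqSS.
    rewrite big1 ?addr0 => [|j /eqP jk]; last first.
      rewrite !mxE; case: eqP => [jk'|_]; last by rewrite !mul0r.
      by case: jk; apply/val_inj.
    rewrite val_eqE; case: (k =P l) => [->|_]; last by rewrite !mul0r mulr0.
    by rewrite !mul1r mulrA -expr2 sqrr_sign mul1r.
  have -> : (2 * m - k = 0)%N by apply/eqP; rewrite subn_eq0.
  rewrite muln0 mul0rn big1 // => j _; rewrite !mxE.
  by rewrite (ltn_eqF (leq_trans (ltn_ord j) (lk : (2 * m < k.+1)%N))) ?mul0r.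
rewrite [X in _ - X](_ : _ = (k * (2 * m - k).+1)%:R *+ (k == l)); last first.
  case: (posnP k) => [k0|kp].
    rewrite k0 mul0n mul0rn big1 // => j _; rewrite !mxE k0 /=.
    by rewrite !mul0r.
  have k1 : (k.-1 < (2 * m).+1)%N by apply: leq_ltn_trans (leq_pred _) (ltn_ord k).
  rewrite (bigD1 (Ordinal k1)) //= !mxE /= prednK // eqxx.
  rewrite big1 ?addr0 => [|j /eqP jk]; last first.
    rewrite !mxE; case: eqP => [jk'|_]; last by rewrite !mul0r.
    by case: jk; apply/val_inj; rewrite /= jk'.
  rewrite (eq_sym (l : nat)) val_eqE; case: (k =P l) => [kl|_]; last by rewrite !(mul0r, mulr0).
  rewrite !mul1r mulrAC -expr2 sqrr_sign mul1r.
  by congr _%:R; have := ltn_ord k; nia.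
case: (k =P l) => _; rewrite ?mulr0n ?subrr // !mulr1n.
have kl := ltn_ord k; rewrite !natrM -natr1 -[(2 * m - k).+1%:R]natr1 natrB; last by lia.
by rewrite !natrM; ring.
Qed.

Lemma block_gso (B : 'M[C]_q) :
  (forall k l, B k l + B (rev_ord l) (rev_ord k) = 0) -> (block_mx 0 0 0 B : 'M_n) \in gso.
Proof.
move=> H; rewrite /gso memv_ker add_lfunE !lfunE /= /Jform tr_block_mx !trmx0 !mulmx_block.
rewrite !(mul0mx, mulmx0, addr0, add0r) add_block_mx !addr0.
rewrite (_ : _ + _ = 0) ?block_mx_const //.
apply/matrixP => k l; rewrite !mxE.
have rk (i : 'I_(2 * m).+1) (j : 'I_(2 * m).+1) : ((j + i)%N == (2 * m)%N) = (j == rev_ord i).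
  by rewrite -val_eqE /=; have := ltn_ord i; have := ltn_ord j; lia.
rewrite (bigD1 (rev_ord l)) //= !mxE rk eqxx mulr1 big1 ?addr0; last first.
  by move=> j jl; rewrite !mxE rk (negPf jl) mulr0.
rewrite (bigD1 (rev_ord k)) //= !mxE addnC rk eqxx mul1r big1 ?addr0; last first.
  by move=> j jl; rewrite !mxE addnC rk (negPf jl) mul0r.
by have := H (rev_ord l) k; rewrite rev_ordK.
Qed.

Lemma em_gso : em \in gso.
Proof.
apply: block_gso => k l; rewrite !mxE /=.
have kl := ltn_ord k; have ll := ltn_ord l.
rewrite (_ : ((2 * m).+1 - k.+1 == ((2 * m).+1 - l.+1).+1)%N = (l == k.+1 :> nat)); last by apply/eqP/eqP; lia.
case: eqP => [lk|]; last by rewrite !mul0r addr0.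
rewrite !mul1r (_ : (m <= _ - l.+1)%N = ~~ (m <= k)%N); last by lia.
by case: (m <= k)%N; rewrite /= ?addrN ?addNr.
Qed.

Lemma hm_gso : hm \in gso.
Proof.
apply: block_gso => k l; rewrite !mxE /=.
have kl := ltn_ord k; have ll := ltn_ord l.
rewrite (inj_eq rev_ord_inj) (eq_sym l); case: (k =P l) => [->|_]; last by rewrite addr0.
rewrite subSS !mulr1n !natrM natrB; last by lia.
by rewrite natrM; ring.
Qed.

Lemma fm_gso : fm \in gso.
Proof.
apply: block_gso => k l; rewrite !mxE /=.
have kl := ltn_ord k; have ll := ltn_ord l.
rewrite (_ : ((2 * m).+1 - l.+1 == ((2 * m).+1 - k.+1).+1)%N = (k == l.+1 :> nat)); last by apply/eqP/eqP; lia.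
case: eqP => [lk|]; last by rewrite !mul0r addr0.
rewrite !mul1r (_ : (m <= _ - k.+1)%N = ~~ (m <= l)%N); last by lia.
rewrite (_ : _ * (2 * m - (_ - _)) = l.+1 * (2 * m - l))%N; last by nia.
by case: (m <= l)%N; rewrite /= -mulrDl ?addrN ?addNr mul0r.
Qed.

Lemma sl2_triple :
  [/\ em \in gso, hm \in gso & fm \in gso] /\
  [/\ lie hm em = 2 *: em, lie hm fm = -2 *: fm & lie em fm = hm].
Proof.
split; split; [exact: em_gso|exact: hm_gso|exact: fm_gso|..].
- exact: lie_hm_em.
- exact: lie_hm_fm.
- exact: lie_em_fm.
Qed.

Definition zcent : {vspace 'M[C]_n} := (gso :&: lker (ad em))%VS.

Definition kerf : {vspace 'M[C]_n} := (gso :&: lker (ad fm))%VS.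

(* Sum of the negative eigenspaces of ad h on g; since the eigenvalues of h
   are at most 2m in absolute value, those of ad h are at most 4m. *)
Definition mneg : {vspace 'M[C]_n} :=
  (\sum_(1 <= k < (4 * m).+1) (gso :&: passmx.leigenspace (ad hm) (- k%:R)))%VS.

(* The invariant form on g, r times the Killing form. It identifies g^* with
   g, and its restriction to so_N identifies so_N^* with so_N. The images of
   V_N in C[S_{N,m}] have brackets proportional to r, so that r cannot be
   chosen independently of the scalar by which V_N is embedded. *)
Section InvariantForm.
Context (r : C).

Definition form (X Y : 'M[C]_n) : C := r * killing gso X Y.

Definition Sg := Sym gso.

Definition bracket_g : Sg -> Sg -> Sg :=
  biderivation (fun X Y => symv gso (lie X Y)).

Definition chi (X : 'M[C]_n) : C := form em X.

Definition idealI (p : Sg) : Prop :=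
  exists2 l : seq (Sg * 'M[C]_n),
    {in l, forall t, t.2 \in mneg} &
    p = \sum_(t <- l) t.1 * (symv gso t.2 - (chi t.2)%:MP).

Definition invariant_mod_I (p : Sg) : Prop :=
  forall xi, xi \in mneg -> idealI (bracket_g (symv gso xi) p).

(* C[S_{N,m}], a function on the slice e + Ker (ad f) being regarded as a
   function of Y in Ker (ad f), and z in zcent as the function form z Y. *)
Definition Sz := Sym zcent.

Definition slice_linear (phi : 'M[C]_n -> C) : Sz :=
  symv zcent (riesz form zcent kerf phi).

(* The restriction C[g^*] = S(g) -> C[S_{N,m}]: the element X of g, i.e.
   the function form X, is mapped to form X (e + Y). *)
Definition restrict (p : Sg) : Sz :=
  p \mPo [tuple (form (vbasis gso)`_i em)%:MP
                + slice_linear (form (vbasis gso)`_i) | i < \dim gso].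

(* F3 is the value at (F1, F2) of the bracket which restriction to the slice
   transports from (S(g)/I)^{ad m} to C[S_{N,m}]. *)
Definition slice_bracket (F1 F2 F3 : Sz) : Prop :=
  [/\ exists2 f1, invariant_mod_I f1 & restrict f1 = F1,
      exists2 f2, invariant_mod_I f2 & restrict f2 = F2
    & forall f1 f2, invariant_mod_I f1 -> invariant_mod_I f2 ->
        restrict f1 = F1 -> restrict f2 = F2 ->
        restrict (bracket_g f1 f2) = F3].

(* The tautological point X = e + Y of the slice, as a matrix of elements of
   C[S_{N,m}]. *)
Definition slice_point : 'M[Sz]_n :=
  \matrix_(a, b) ((em a b)%:MP + slice_linear (fun Y => Y a b)).

(* Restriction to the slice of the coefficient of t^(2(m-k)) in det (1 + tX) *)
Definition Theta (k : nat) : Sz := (det1X slice_point)`_(2 * (m - k)).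

(* W = so_N + V_N + C^m; the last summand is spanned by the zeta_k. *)
Definition W : vectType C := (subvs_of (so C N) * 'cV[C]_N * 'rV[C]_m)%type.

Definition iotabar (w : W) : 'M[C]_n :=
  let: (A, x, c) := w in
  block_mx (vsval A) (x *m (delta_mx 0 ord_max : 'rV_q))
           (- ((delta_mx ord0 0 : 'cV_q) *m x^T)) 0
  + \sum_(k < m) c 0 k *: em ^+ (2 * (m - k)).-1.

Definition Hcl := Sym {: W}.

Definition Hso (A : subvs_of (so C N)) : Hcl := symv fullv ((A, 0, 0) : W).
Definition HV (x : 'cV[C]_N) : Hcl := symv fullv ((0, x, 0) : W).
Definition Hzeta (k : 'I_m) : Hcl := symv fullv ((0, 0, delta_mx 0 k) : W).

Definition form_so (A B : 'M[C]_N) : C :=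
  form (block_mx A 0 0 0) (block_mx B 0 0 0).

(* The tautological point of so_N as a matrix over C[so_N] = S(so_N). *)
Definition so_point : 'M[Hcl]_N :=
  \matrix_(a, b) Hso (vsproj (so C N)
                       (riesz form_so (so C N) (so C N) (fun A => A a b))).

Definition Hcl_gen (w w' : W) : Hcl :=
  let: (A, x, _) := w in
  let: (B, y, _) := w' in
  Hso (vsproj (so C N) (lie (vsval A) (vsval B)))
  + HV (vsval A *m y - vsval B *m x)
  + \sum_(j < m) Hzeta j * gamma j x y so_point
  + gamma m x y so_point.

Definition bracket_H : Hcl -> Hcl -> Hcl := biderivation Hcl_gen.

End InvariantForm.
End Slodowy.

(* Main.v *)
Require Import Defs.
From HB Require Import structures.
From mathcomp Require Import all_boot all_order all_algebra.
From mathcomp Require Import mpoly complex reals ring zify.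

(* All identities are checked pointwise: a polynomial vanishes if its values do,
   and the points of the slice are the matrices X = e + Y, [f, Y] = 0, i.e. e plus
   a in so_N, a vector v and a combination of odd powers of f.
   Each generator of H_m lifts to a function on g which is invariant modulo I:
   A lifts to itself, zeta_k to a coefficient of det (1 + tX), and x_i to a minor
   of the matrix with columns X^(m+j) e_last, on rows spanning a space which is
   stable under mneg.
   If p is invariant then its gradient u at X satisfies tr ([xi, u] X) = 0 for
   xi in mneg, and modulo mneg such a u is determined by its pairing with Ker (ad f),
   i.e. by the restriction of p. So tr ([u, u'] X) may be computed with any such
   u, u'; for the vectors x of V_N there is an explicit one, built from a, the
   lower right block d of X, and the coefficients of the adjugate of 1 + td. The
   resulting bracket is a sum over the coefficients of det (1 + td) and the
   (x, a^(2i+1) y), which is the generating series of the gamma_(2j+1), because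
   det (1 + tX) = det (1 + ta) det (1 + td) modulo t^(2m+1) and
   det (1 + ta)^2 = det (1 - t^2 a^2).
   Finally, Theta_k is a nonzero multiple of the coordinate e^(2(m-k)-1) plus a
   polynomial in a, v and the coordinates with larger k, so that the map is
   triangular, hence bijective. *)

Set Implicit Arguments.
Unset Strict Implicit.
Unset Printing Implicit Defensive.

Import Order.TTheory GRing.Theory Num.Theory.
Local Open Scope ring_scope.

(** * Polynomial functions and derivations *)

(** The minors only supply an invariant lift of each x_i; their differentials are never computed.
    Such a lift has a gradient which, modulo mneg, is fixed by linear conditions, so any solution of
    these may replace it. [vgrad] is one: its lower left block solves d G - G a = (a matrix with a
    single nonzero row), which is possible because the coefficients of the adjugate of 1 + td obey a
    Horner recursion that stops after 2m + 1 steps. The remaining row is det (lambda + d) at lambda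
    = a, applied to x, and this is where the coefficients of det (1 + td) and the odd powers of a in
    the bracket come from. The constants meet in the single equation 2 kappa cV^2 = 1, where cV is
    the scalar by which V_N is embedded: kappa = r (N + 2m - 1) compares the invariant form with the
    trace form, the 2 counts the two off-diagonal blocks occupied by V_N, and the signs (-1)^m of
    the bracket and of the gamma series cancel. *)

Section PolynomialFunctions.
Context (K : numDomainType).

Lemma poly_vanish (p : {poly K}) : (forall x, p.[x] = 0) -> p = 0.
Proof.
move=> p0; apply/eqP/negPn/negP => pn0.
have := max_poly_roots pn0 (rs := [seq i%:R | i <- iota 0 (size p)]).
rewrite size_map size_iota ltnn => H; suff: false by [].
apply: H; first by apply/allP => _ /mapP[i _ ->]; rewrite /root p0.
by rewrite map_inj_uniq ?iota_uniq // => i j /eqP; rewrite eqr_nat => /eqP.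
Qed.

(** Induction on the number of variables: [muni] views p as a polynomial in the last variable, whose
    coefficients vanish at every point by [poly_vanish] and hence are zero. *)
Lemma mpoly_vanish n (p : {mpoly K[n]}) : (forall v, p.@[v] = 0) -> p = 0.
Proof.
elim: n p => [|n IHn] p p0.
  by rewrite [p]nvar0_mpolyC; have := p0 (fun=> 0); rewrite [p in p.@[_]]nvar0_mpolyC mevalC => ->.
have widenE (i : 'I_n) : widen_ord (leqnSn n) i = lift ord_max i.
  by apply/val_inj; rewrite /= /bump leqNgt ltn_ord.
have muni_p : muni p = 0.
  apply/polyP => k; rewrite coef0; apply: IHn => v.
  suff: map_poly (meval v) (muni p) = 0 by move/(congr1 (fun q : {poly K} => q`_k)); rewrite coef_map coef0.
  apply: poly_vanish => x; rewrite muniE rmorph_sum horner_sum /=.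
  pose w (i : 'I_n.+1) := if unlift ord_max i is Some j then v j else x.
  rewrite -[RHS](p0 w) mevalE; apply: eq_bigr => d _.
  rewrite -!mul_polyC !rmorphM /= map_polyC map_polyXn /= !hornerE.
  rewrite mevalZ
    mevalX big_ord_recr /= mulrA; congr (_ * _ * _).
    by apply: eq_bigr => i _; rewrite mnmE /w widenE liftK.
  by rewrite /w unlift_none.
apply/mpolyP => d; rewrite mcoeff0.
move/(congr1 (fun q : {poly {mpoly K[n]}} => q`_(d ord_max)@_[multinom d (widen_ord (leqnSn n) i) | i < n])): muni_p.
rewrite muniE coef_sum coef0 mcoeff0 => H; rewrite -[RHS]H.
rewrite raddf_sum /= [in LHS](mpolyE p) raddf_sum; apply: eq_bigr => d' _ /=.
rewrite -mul_polyC coefCM coefXn !mcoeffZ mulr_natr mcoeffMn mcoeffZ !mcoeffX -mulrnAr.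
congr (_ * _); rewrite -[_ *+ (d ord_max == _)]mulr_natr -natrM mulnb; congr (nat_of_bool _)%:R.
apply/eqP/andP => [->//|[/eqP e2 /eqP e1]]; apply/mnmP => i.
case: (unliftP ord_max i) => [j|] -> //.
by move/mnmP: e2 => /(_ j); rewrite !mnmE widenE.
Qed.

End PolynomialFunctions.

Section Derivation.
Context (R S : comNzRingType) (phi : {rmorphism R -> S}) (D : {additive R -> S}).
Hypothesis DM : forall a b, D (a * b) = D a * phi b + phi a * D b.

Lemma derivation1 : D 1 = 0.
Proof.
by have /eqP := DM 1 1; rewrite mulr1 rmorph1 mulr1 mul1r -subr_eq0 opprD addNKr oppr_eq0 => /eqP.
Qed.

Lemma derivation_prod (I : eqType) (s : seq I) (a : I -> R) : uniq s ->
  D (\prod_(i <- s) a i) =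
  \sum_(i <- s) D (a i) * \prod_(j <- s | j != i) phi (a j).
Proof.
elim: s => [_|i s IHs /= /andP[nis us]]; first by rewrite !big_nil derivation1.
rewrite !big_cons DM IHs // eqxx /= rmorph_prod; congr (_ * _ + _).
  rewrite [LHS]big_seq [RHS]big_seq_cond; apply: eq_bigl => j.
  by case js: (j \in s) => //=; apply/esym; apply: contraNneq nis => <-.
rewrite big_distrr big_seq [RHS]big_seq; apply: eq_bigr => j js /=.
rewrite big_cons; case: eqP => [ij|_]; last by rewrite mulrCA.
by rewrite ij js in nis.
Qed.

(** Jacobi's formula for a derivation along phi. Hamiltonian fields (phi the identity) and the pair
    of coefficients of degree 0 and 1 of a polynomial are both instances. *)
Lemma derivation_det n (M : 'M[R]_n) :
  D (\det M) = \tr (\adj (map_mx phi M) *m map_mx D M).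
Proof.
rewrite mxtrace_mulC {1}/determinant raddf_sum /=.
(* P i is phi M with its row i replaced by the derivative of that row. *)
pose P i := \matrix_(k, j) (if k == i then D (M i j) else phi (M k j)).
have trE i : (map_mx D M *m \adj (map_mx phi M)) i i = \det (P i).
  rewrite (expand_det_row _ i) mxE; apply: eq_bigr => j _; rewrite !mxE eqxx; congr (_ * _).
  rewrite /cofactor; congr (_ * \det _); apply/matrixP => a b; rewrite !mxE.
  by rewrite eq_sym (negPf (neq_lift _ _)).
rewrite /mxtrace (eq_bigr _ (fun i _ => trE i)) exchange_big /=; apply: eq_bigr => s _.
rewrite -mulr_sumr DM; set sg := GRing.exp (-1) _.
have -> : D sg = 0.
  by rewrite /sg; case: (perm.odd_perm s); rewrite ?expr0 ?expr1 ?raddfN /= derivation1 ?oppr0.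
rewrite mul0r add0r rmorph_sign; congr (_ * _).
rewrite derivation_prod ?index_enum_uniq //; apply: eq_bigr => i _.
rewrite [RHS](bigD1 i) //= mxE eqxx; congr (_ * _).
by apply: eq_bigr => j ji; rewrite mxE (negPf ji).
Qed.

Lemma derivation_det_traceless n (M : 'M[R]_n) (L : 'M[S]_n) :
  \tr L = 0 -> map_mx D M = L *m map_mx phi M -> D (\det M) = 0.
Proof.
move=> trL DMx; rewrite derivation_det DMx mxtrace_mulC -mulmxA mul_mx_adj.
by rewrite mul_mx_scalar mxtraceZ trL mulr0.
Qed.

Lemma derivation_det_comm n (M : 'M[R]_n) (L : 'M[S]_n) :
  map_mx D M = L *m map_mx phi M - map_mx phi M *m L -> D (\det M) = 0.
Proof.
move=> DMx; rewrite derivation_det DMx mulmxBr raddfB /= !mulmxA mxtrace_mulC mulmxA.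
by rewrite mul_mx_adj mul_adj_mx subrr.
Qed.

Lemma derivation_mulmx n p k (A : 'M[R]_(n, p)) (B : 'M[R]_(p, k)) :
  map_mx D (A *m B) = map_mx D A *m map_mx phi B + map_mx phi A *m map_mx D B.
Proof.
apply/matrixP => i j; rewrite !mxE raddf_sum -big_split /=.
by apply: eq_bigr => l _; rewrite DM !mxE.
Qed.

End Derivation.

(** The chain rule: both sides are derivations along phi that kill constants and agree on the
    variables. *)
Lemma derivation_mpoly (K S : comNzRingType) n
    (phi : {rmorphism {mpoly K[n]} -> S}) (D : {additive {mpoly K[n]} -> S}) :
  (forall a b, D (a * b) = D a * phi b + phi a * D b) -> (forall c, D c%:MP = 0) ->
  forall p, D p = \sum_i phi p^`M(i) * D 'X_i.
Proof.
move=> DM DC; pose P (p : {mpoly K[n]}) := D p = \sum_i phi p^`M(i) * D 'X_i.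
have PM p q : P p -> P q -> P (p * q).
  rewrite /P DM => -> ->; rewrite mulr_suml mulr_sumr -big_split /=.
  by apply: eq_bigr => i _; rewrite mderivM rmorphD !rmorphM /=; ring.
have PC c : P c%:MP.
  by rewrite /P DC big1 // => i _; rewrite mderivC rmorph0 mul0r.
have PX i : P 'X_i.
  rewrite /P (bigD1 i) //= big1 => [|j ji]; rewrite mderivX mnm1E.
    have -> : (U_(i) - U_(i) = 0 :> 'X_{1..n})%MM by apply/mnmP => k; rewrite mnmBE mnm0E subnn.
    by rewrite eqxx scale1r mpolyX0 rmorph1 mul1r addr0.
  by rewrite eq_sym (negPf ji) scale0r rmorph0 mul0r.
elim/mpolyind => [|c d p _ _ IHp]; first by rewrite raddf0 big1 // => i _; rewrite !raddf0 mul0r.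
have Pd : P (c *: 'X_[d]).
  rewrite -mul_mpolyC; apply: (PM) => //; rewrite mpolyXE_id; apply: (big_ind P); [by rewrite -mpolyC1 | exact: (PM) | move=> i _].
  by elim: (d i) => [|k IHk]; rewrite ?expr0 -?mpolyC1 // exprS; apply: PM.
rewrite raddfD Pd IHp -big_split; apply: eq_bigr => i _ /=.
by rewrite mderivD rmorphD mulrDl.
Qed.

(** * The polynomial det (1 + tX) *)

Section Det1X.
Context (T : comNzRingType) (n : nat).
Implicit Types X Z : 'M[T]_n.

Lemma horner_det (M : 'M[{poly T}]_n) x : (\det M).[x] = \det (map_mx (horner_eval x) M).
Proof. by rewrite -[LHS]/(horner_eval x _) -det_map_mx. Qed.

Lemma map_det1X (T' : comNzRingType) (f : {rmorphism T -> T'}) X :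
  map_poly f (det1X X) = det1X (map_mx f X).
Proof.
rewrite /det1X -det_map_mx; congr (\det _); apply/matrixP => i j.
by rewrite !mxE rmorphD rmorphM /= map_polyX map_polyC raddfMn /= rmorph1.
Qed.

Lemma coef_det1X_map (T' : comNzRingType) (f : {rmorphism T -> T'}) X k :
  f (det1X X)`_k = (det1X (map_mx f X))`_k.
Proof. by rewrite -map_det1X coef_map. Qed.

Lemma det1X_0 X : (det1X X)`_0 = 1.
Proof.
rewrite -horner_coef0 horner_det -[RHS](det1 T n); congr (\det _).
apply/matrixP => i j; rewrite !mxE /= /horner_eval hornerD hornerM hornerX mul0r addr0.
by rewrite hornerMn hornerE.
Qed.

Lemma size_det_linear (k : nat) (M : 'M[{poly T}]_k) :
  (forall i j, (size (M i j) <= 2)%N) -> (size (\det M) <= k.+1)%N.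
Proof.
move=> sM; apply: leq_trans (size_sum _ _ _) _; apply/bigmax_leqP => s _.
rewrite size_Msign; apply: leq_trans (size_poly_prod_leq _ _) _.
rewrite -[X in (_ - X)%N]/(#|'I_k|) card_ord leq_subLR addnS ltnS.
apply: leq_trans (leq_sum _ (fun i _ => sM i _)) _.
by rewrite sum_nat_const card_ord; lia.
Qed.

Lemma det1XN X : det1X (- X) = det1X X \Po (- 'X).
Proof.
rewrite /det1X -[_ \Po _]/(comp_poly (- 'X) _) -det_map_mx; congr (\det _).
apply/matrixP => i j; rewrite !mxE /= rmorphD rmorphM /= comp_polyX comp_polyC raddfMn /= rmorph1 polyCN.
by rewrite mulrN mulNr.
Qed.

Lemma coef_det1XN X k : (det1X (- X))`_k = (-1) ^+ k * (det1X X)`_k.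
Proof.
rewrite det1XN coef_comp_poly.
under eq_bigr => i _ do rewrite -['X]scale1r -scaleNr exprZn coefZ coefXn.
have [ks|ks] := ltnP k (size (det1X X)).
  rewrite (bigD1 (Ordinal ks)) //= eqxx mulr1 mulrC big1 ?addr0 // => i ik.
  by rewrite -[k == i]/(val (Ordinal ks) == val i) (inj_eq val_inj) eq_sym (negPf ik) !mulr0.
rewrite nth_default // mulr0 big1 // => i _; rewrite gtn_eqF ?mulr0 //.
exact: leq_trans (ltn_ord i) ks.
Qed.

(* 1 - tX is conjugate to the transpose of 1 + tX. *)
Lemma det1X_skew X (J : 'M[T]_n) :
  J *m J = 1%:M -> X^T *m J + J *m X = 0 -> det1X (- X) = det1X X.
Proof.
move=> JJ /eqP; rewrite addrC addr_eq0 => /eqP JX.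
have detJ : \det (map_mx polyC J) * \det (map_mx polyC J) = 1 :> {poly T}.
  by rewrite -det_mulmx -map_mxM JJ map_mx1 det1.
suff H : \det (map_mx polyC J) * det1X (- X) = det1X X * \det (map_mx polyC J).
  by rewrite -[LHS]mul1r -detJ -mulrA H mulrCA detJ mulr1.
rewrite -[det1X X]det_tr -!det_mulmx; congr (\det _).
rewrite mulmxDr mulmx1 [(_ + _)^T]linearD /= trmx1 mulmxDl mul1mx; congr (_ + _).
rewrite [('X *: _)^T]linearZ /= -scalemxAr -scalemxAl; congr (_ *: _).
by rewrite map_mxN mulmxN -map_mxM JX raddfN /= opprK map_mxM map_trmx.
Qed.

Lemma det1X_odd X (J : 'M[T]_n) i : (forall x : T, x *+ 2 = 0 -> x = 0) ->
  J *m J = 1%:M -> X^T *m J + J *m X = 0 -> odd i -> (det1X X)`_i = 0.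
Proof.
move=> two_reg JJ XJ oi; apply: two_reg.
have := coef_det1XN X i; rewrite (det1X_skew JJ XJ) -signr_odd oi expr1 mulN1r => /eqP.
by rewrite -addr_eq0 -mulr2n => /eqP.
Qed.

(** If D moves X by an infinitesimal conjugation, then D, extended coefficientwise to polynomials in
    t, moves 1 + tX by a commutator too and annihilates its determinant. *)
Lemma derivation_det1X_comm (S : comNzRingType)
    (phi : {rmorphism T -> S}) (D : {additive T -> S}) X (L : 'M[S]_n) k :
  (forall a b, D (a * b) = D a * phi b + phi a * D b) ->
  map_mx D X = L *m map_mx phi X - map_mx phi X *m L -> D (det1X X)`_k = 0.
Proof.
move=> DM DX; rewrite -[LHS](@coef_map_id0 _ _ D) ?raddf0 //.
have DpM (a b : {poly T}) : map_poly D (a * b) =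
    map_poly D a * map_poly phi b + map_poly phi a * map_poly D b.
  apply/polyP => i; rewrite coefD !coefM coef_map_id0 ?raddf0 // coefM raddf_sum -big_split /=.
  by apply: eq_bigr => j _; rewrite DM !coef_map_id0 ?raddf0 ?rmorph0.
rewrite /det1X (@derivation_det_comm _ _ (map_poly phi) (map_poly D) DpM n _ (map_mx polyC L)) ?coef0 //.
have phiE : map_mx (map_poly phi) (1%:M + 'X *: map_mx polyC X) = 1%:M + 'X *: map_mx polyC (map_mx phi X).
  by apply/matrixP => i j; rewrite !mxE rmorphD rmorphM /= map_polyX map_polyC raddfMn /= rmorph1.
rewrite phiE mulmxDr mulmxDl mulmx1 mul1mx opprD addrACA subrr add0r.
rewrite -scalemxAr -scalemxAl -scalerBr -!map_mxM -map_mxB -DX.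
apply/matrixP => i j; rewrite !mxE; apply/polyP => l.
rewrite coef_map_id0 ?raddf0 // coefD coefMn coefC !coefXM !coefC raddfD raddfMn /=.
have -> : D (if l == 0%N then 1 else 0) = 0 by case: ifP; rewrite ?raddf0 // (derivation1 DM).
by rewrite mul0rn add0r; case: l => [|[|l]]; rewrite /= ?raddf0.
Qed.

End Det1X.

(** * Determinants under diagonal rescaling by powers of t *)

Section Scaling.
Context (T : idomainType) (n : nat) (sh : 'I_n -> nat).

(** Conjugation by the diagonal matrix of the t^(sh a), whose determinant can be cancelled in a
    domain; the relation is multiplied out to avoid negative powers of t. *)
Lemma det_scaling (M M' : 'M[{poly T}]_n) :
  (forall a b, 'X^(sh a) * M a b = M' a b * 'X^(sh b)) -> \det M = \det M'.
Proof.
move=> MM'; pose L : 'M[{poly T}]_n := diag_mx (\row_a 'X^(sh a)).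
have LM : L *m M = M' *m L.
  by apply/matrixP => a b; rewrite mul_diag_mx mul_mx_diag !mxE MM'.
have /mulfI : \det L != 0.
  by rewrite det_diag; apply/prodf_neq0 => i _; rewrite mxE monic_neq0 ?monicXn.
by apply; rewrite -det_mulmx LM det_mulmx mulrC.
Qed.

Context (K : nat) (shK : forall a, (sh a < K)%N).
Implicit Types E L Z : 'M[T]_n.

Lemma expr_shift E k a b :
  (forall a b, E a b != 0 -> sh b = (sh a).+1) ->
  (E ^+ k) a b != 0 -> sh b = (sh a + k)%N.
Proof.
move=> EP; elim: k b => [|k IHk] b.
  by by rewrite expr0 mxE addn0; have [->|_] := eqVneq a b; rewrite ?eqxx.
rewrite exprSr mxE => H.
have [c /andP[c1 c2]] : exists c, ((E ^+ k) a c != 0) && (E c b != 0).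
  apply/existsP; apply: contraNT H => /existsPn H; rewrite big1 // => c _.
  by apply/eqP; have := H c; rewrite mulf_eq0 negb_and !negbK.
by rewrite (EP _ _ c2) (IHk _ c1) addnS.
Qed.

(** The remainder is uniform in x, so that U can be a polynomial ring and x a power of t; the
    remainder then lies beyond the coefficient of interest. *)
Lemma det_first_order (U : comNzRingType) (A B : 'M[U]_n) :
  exists p : {poly U}, forall x,
    \det (A + x *: B) = \det A + x * \tr (\adj A *m B) + x ^+ 2 * p.[x].
Proof.
pose M := map_mx polyC A + 'X *: map_mx polyC B.
pose p := \det M.
have M0 : map_mx (coefp 0) M = A.
  by apply/matrixP => i j; rewrite !mxE /= coefD coefXM !coefC /= addr0.
have p0 : p`_0 = \det A by rewrite -[p`_0]/(coefp 0 _) -det_map_mx M0.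
have p1 : p`_1 = \tr (\adj A *m B).
  have coef1M (a b : {poly U}) : coefp 1 (a * b) = coefp 1 a * coefp 0 b + coefp 0 a * coefp 1 b.
    by rewrite /= coefM !big_ord_recl big_ord0 /= addr0 addrC.
  rewrite -[p`_1]/(coefp 1 _) (derivation_det coef1M) M0; congr (\tr (_ *m _)).
  by apply/matrixP => i j; rewrite !mxE /= coefD coefXM !coefC /= add0r.
exists (drop_poly 2 p) => x.
have -> : \det (A + x *: B) = p.[x].
  rewrite horner_det; congr (\det _); apply/matrixP => i j.
  by rewrite !mxE /= /horner_eval !hornerE.
rewrite -{1}(poly_take_drop 2 p) hornerD hornerM hornerXn [_ * x ^+ 2]mulrC; congr (_ + _).
rewrite (horner_coef_wide _ (size_take_poly 2 p)) !big_ord_recl big_ord0 /=.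
by rewrite !coef_take_poly /= p0 p1 expr0 expr1 mulr1 addr0 mulrC.
Qed.

(** Rescaling by sh turns 1 + t(E + L + Z) into A + t^r B, where A is 1 + E at t = 0. So Z enters
    the coefficient of t^r only linearly, through the adjugate of 1 + E, which is a finite geometric
    series in - E; only its term of degree r - 1 pairs with the entries of Z that survive in B at t
    = 0. *)
Lemma det1X_hessenberg E L Z r : (0 < r)%N ->
  (forall a b, E a b != 0 -> sh b = (sh a).+1) ->
  (forall a b, L a b != 0 -> (sh b <= sh a)%N) ->
  (forall a b, Z a b != 0 -> (sh b + r.-1 <= sh a)%N) ->
  (det1X (E + L + Z))`_r = (det1X (E + L))`_r + (-1) ^+ r.-1 * \tr (E ^+ r.-1 *m Z).
Proof.
move=> r0 EP LP ZP.
have EX a b : 'X^(sh a) * ('X * (E a b)%:P) = (E a b)%:P * 'X^(sh b).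
  have [->|/EP ->] := eqVneq (E a b) 0; first by rewrite polyC0 !mulr0 mul0r.
  by rewrite exprSr mulrA mulrC.
have X1 a b : 'X^(sh a) * (a == b)%:R = (a == b)%:R * 'X^(sh b) :> {poly T}.
  by have [->|_] := eqVneq a b; rewrite ?mulr0 ?mul0r // mulr1 mul1r.
(* As sh b <= sh a on the entries of L, at least one power of t is left, and L disappears at t =
   0. *)
have [L' [LX L0]] : exists L' : 'M[{poly T}]_n,
    (forall a b, 'X^(sh a) * ('X * (L a b)%:P) = L' a b * 'X^(sh b)) /\
    map_mx (coefp 0) L' = 0.
  exists (\matrix_(a, b) ((L a b)%:P * 'X^((sh a).+1 - sh b))); split=> [a b|].
    rewrite mxE; have [->|/LP lab] := eqVneq (L a b) 0; first by rewrite polyC0 !mulr0 !mul0r.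
    by rewrite -mulrA -exprD subnK ?leqW // exprSr mulrA [RHS]mulrC.
  apply/matrixP => a b; rewrite !mxE /= coefCM coefXn.
  have [->|/LP lab] := eqVneq (L a b) 0; first by rewrite mul0r.
  by rewrite subSn // mulr0.
have [B [BX B0]] : exists B : 'M[{poly T}]_n,
    (forall a b, 'X^(sh a) * ('X * (Z a b)%:P) = 'X^r * B a b * 'X^(sh b)) /\
    forall a b, (B a b)`_0 = Z a b * ((sh a).+1 == sh b + r)%N%:R.
  exists (\matrix_(a, b) ((Z a b)%:P * 'X^((sh a).+1 - (sh b + r)))).
  split=> a b; rewrite mxE; have [->|/ZP lab] := eqVneq (Z a b) 0; try by rewrite !(mulr0, mul0r, polyC0, coef0).
    rewrite !mulrA -exprSr [_ * (Z a b)%:P]mulrC ['X^r * _]mulrC -!mulrA -!exprD.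
    by congr (_ * 'X^_); lia.
  by rewrite coefCM coefXn; congr (_ * _%:R); lia.
have [A [AE A0]] : exists A : 'M[{poly T}]_n,
    (forall a b, A a b = (a == b)%:R + (E a b)%:P + L' a b) /\ map_mx (coefp 0) A = 1%:M + E.
  exists (map_mx polyC (1%:M + E) + L'); split=> [a b|]; first by rewrite !mxE polyCD raddfMn.
  apply/matrixP => a b; move/matrixP: L0 => /(_ a b); rewrite !mxE /= => L0.
  by rewrite coefD L0 addr0 coefC.
have d1 : det1X (E + L) = \det A.
  apply: det_scaling => a b; rewrite AE !mulrDl -LX -EX -X1 !mxE polyCD.
  by rewrite !mulrDr addrA.
have d2 : det1X (E + L + Z) = \det (A + 'X^r *: B).
  apply: det_scaling => a b; rewrite [(A + _) a b]mxE AE [(_ *: B) a b]mxE !mulrDl -BX -LX -EX -X1 !mxE !polyCD.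
  by rewrite !mulrDr !addrA.
have [p pE] := det_first_order A B.
rewrite d2 d1 pE 2!coefD -addrA; congr (_ + _); rewrite -[RHS]addr0; congr (_ + _); last first.
  by rewrite -exprM coefXnM ltn_Pmulr.
rewrite coefXnM ltnn subnn -[_`_0]/(coefp 0 _) -trace_map_mx map_mxM map_mx_adj A0.
(* E raises sh, which stays below K. The larger exponent K + r makes r - 1 one of the indices of the
   geometric series. *)
have EK : E ^+ (K + r) = 0.
  apply/matrixP => a b; rewrite mxE; apply/eqP; apply: contraT => /(expr_shift EP) H.
  by have := shK b; rewrite H; lia.
(* Rescaling removes t from 1 + tE, so det (1 + tE) is constant, and it is 1 at t = 0. *)
have detE : \det (1%:M + E) = 1.
  have H : det1X E = (\det (1%:M + E))%:P.
    rewrite -det_map_mx; apply: det_scaling => a b; rewrite !mxE rmorphD raddfMn /= rmorph1 mulrDl -EX.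
    by rewrite mulrDr -X1.
  by have := det1X_0 E; rewrite H coefC.
have adjE : \adj (1%:M + E) = \sum_(k < K + r) (- E) ^+ k.
  have H : (1%:M + E) *m \sum_(k < K + r) (- E) ^+ k = 1%:M.
    have := subrXX_comm (K + r) (commr_sym (commr1 (- E))).
    rewrite expr1n exprNn EK mulr0 subr0 opprK => H; transitivity (1 : 'M[T]_n) => //.
    rewrite H; congr (_ * _).
    by apply: eq_bigr => k _; rewrite expr1n mul1r.
  by rewrite -[RHS]mul1mx -[in RHS]detE -mul_adj_mx -mulmxA H mulmx1.
rewrite adjE mulmx_suml raddf_sum /=.
have B0' a b : map_mx (coefp 0) B a b = Z a b * ((sh a).+1 == sh b + r)%N%:R.
  by rewrite mxE /= B0.
have EN a b : (- E) a b != 0 -> sh b = (sh a).+1 by rewrite mxE oppr_eq0 => /EP.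
have trE k : k != r.-1 -> \tr ((- E) ^+ k *m map_mx (coefp 0) B) = 0.
  move=> kr; rewrite /mxtrace big1 // => a _; rewrite mxE big1 // => b _.
  rewrite B0'; have [->|/(expr_shift EN) ->] := eqVneq (((- E) ^+ k) a b) 0.
    by rewrite mul0r.
  by case: eqP => [H|_]; [move: kr; lia | rewrite !mulr0].
have rK : (r.-1 < K + r)%N by lia.
rewrite (bigD1 (Ordinal rK)) //= big1 ?addr0; last by move=> k /trE.
rewrite /mxtrace mulr_sumr; apply: eq_bigr => a _; rewrite !mxE mulr_sumr.
apply: eq_bigr => b _; rewrite B0'.
have -> : ((- E) ^+ r.-1) a b = (-1) ^+ r.-1 * (E ^+ r.-1) a b.
  by rewrite [(- E) ^+ _]exprNn -signr_odd -[in RHS]signr_odd; case: odd; rewrite ?expr1 ?expr0 ?mulN1r ?mul1r ?mxE.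
have [->|/(expr_shift EP) ->] := eqVneq ((E ^+ r.-1) a b) 0; first by rewrite !(mulr0, mul0r).
by rewrite (_ : _ == _) ?mulr1 ?mulrA // -addnS prednK.
Qed.

End Scaling.

(** * The generating series of gamma *)

Section InverseSquareRoot.
Context (K : numFieldType) (T : comAlgType K).
Implicit Types (p r : {poly T}).

Lemma binom_mhalfS k :
  k.+1%:R * binom_mhalf K k.+1 = (- 2^-1 - k%:R) * binom_mhalf K k.
Proof.
rewrite /binom_mhalf big_ord_recr /= factS natrM invfM.
have k0 : k.+1%:R != 0 :> K by rewrite pnatr_eq0.
set x := \prod_(i < k) _; set y := (k`!%:R)^-1.
by rewrite mulrCA mulVKf // [x * _]mulrC mulrA.
Qed.

(** The recursion of the coefficients is the differential equation 2 (1 + X) b' + b = 0 modulo X^n.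
    It makes the derivative of b^2 (1 + X) vanish to that order. *)
Lemma binom_mhalf_series n : exists c : {poly K},
  (\poly_(k < n.+1) binom_mhalf K k) ^+ 2 * (1 + 'X) = 1 + 'X^(n.+1) * c.
Proof.
set b := \poly_(k < n.+1) _; pose d := b ^+ 2 * (1 + 'X).
have bE k : (k <= n)%N -> b`_k = binom_mhalf K k by move=> kn; rewrite coef_poly ltnS kn.
have b0 : b`_0 = 1 by rewrite bE // /binom_mhalf big_ord0 fact0 divr1.
have ode k : (k < n)%N -> (b^`() * (1 + 'X) *+ 2 + b)`_k = 0.
  move=> kn; rewrite coefD coefMn mulrDr mulr1 coefD coefMX !coef_deriv.
  have := binom_mhalfS k; rewrite -!bE ?(ltnW kn) // => H.
  have -> : b`_k.+1 *+ k.+1 = (- 2^-1 - k%:R) * b`_k by rewrite -H mulr_natl.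
  have -> : (if k == 0%N then 0 else b`_k.-1.+1 *+ k.-1.+1) = k%:R * b`_k.
    by case: k {kn H} => [|k]; rewrite ?mul0r //= mulr_natl.
  by rewrite -mulr_natr; field.
have dE : d^`() = b * (b^`() * (1 + 'X) *+ 2 + b).
  by rewrite derivM deriv_exp derivD derivC derivX add0r mulr1 /=; ring.
have d0 k : (0 < k <= n)%N -> d`_k = 0.
  case: k => // k /andP[_ kn].
  have : d^`()`_k = 0.
    by rewrite dE coefM big1 // => i _; rewrite ode ?mulr0 //; lia.
  by rewrite coef_deriv => /eqP; rewrite mulrn_eq0 => /eqP.
exists (drop_poly n.+1 d); rewrite mulrC [LHS]mulrC -/d -{1}(poly_take_drop n.+1 d) [X in _ = 1 + X]mulrC.
congr (_ + _); apply/polyP => k; rewrite coef_take_poly coef1.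
case: k => [|k] /=; last by case: ifP => // kn; rewrite d0.
by rewrite /d coefM big_ord_recl big_ord0 /= addr0 expr2 coefM big_ord_recl big_ord0 /= b0 coefD coef1 coefX /=; ring.
Qed.

Lemma coef_expr_lt p k j : p`_0 = 0 -> (j < k)%N -> (p ^+ k)`_j = 0.
Proof.
move=> p0 jk; rewrite -(poly_take_drop 1 p) (_ : take_poly 1 p = 0).
  by rewrite add0r exprMn -exprM mul1n coefMXn jk.
by apply/polyP => i; rewrite coef_take_poly coef0; case: i => [|i]; rewrite //= p0.
Qed.

(** The binomial series of (r^2)^(-1/2) inverts r up to order n: w = r G has w^2 = 1 to that order
    and constant term 1, which forces w = 1. *)
Lemma invsqrt_inverse r n : r`_0 = 1 -> exists G : {poly T},
  (forall j, (j <= n)%N -> G`_j = invsqrt_coef (r ^+ 2) j) /\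
  forall i, (i <= n)%N -> (r * G)`_i = (i == 0)%:R.
Proof.
move=> r0; have [c bc] := binom_mhalf_series n.
set b := \poly_(k < n.+1) _ in bc; set u := r ^+ 2 - 1.
have u0 : u`_0 = 0.
  by rewrite coefB coef1 expr2 coefM big_ord_recl big_ord0 /= r0 mulr1 addr0 subrr.
pose h : {rmorphism {poly K} -> {poly T}} := comp_poly u \o map_poly (in_alg T).
have hX : h 'X = u by rewrite /h /= map_polyX comp_polyX.
have hE j : (h b)`_j = \sum_(k < n.+1) binom_mhalf K k *: (u ^+ k)`_j.
  rewrite /b poly_def rmorph_sum coef_sum; apply: eq_bigr => k _.
  by rewrite -mul_polyC rmorphM rmorphXn hX /h /= map_polyC comp_polyC coefCM /= mulr_algl.
exists (h b); split=> [j jn|i].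
  rewrite hE /invsqrt_coef [RHS](big_ord_widen n.+1 (fun k => binom_mhalf K k *: (u ^+ k)`_j)) //.
  rewrite [RHS]big_mkcond ; apply: eq_bigr => k _; case: ltnP => // kj.
  by rewrite coef_expr_lt ?scaler0.
set w := r * h b.
have w2 : w ^+ 2 = 1 + u ^+ n.+1 * h c.
  move/(congr1 h): bc; rewrite rmorphM rmorphXn rmorphD rmorph1 hX rmorphD rmorphM rmorph1 rmorphXn hX.
  by move=> <-; rewrite exprMn [1 + u]addrC subrK mulrC.
have w0 : w`_0 = 1.
  rewrite coefM big_ord_recl big_ord0 addr0 r0 mul1r hE big_ord_recl big1 => [|k _].
    by rewrite expr0 coef1 /binom_mhalf big_ord0 fact0 divr1 scale1r addr0.
  by rewrite coef_expr_lt ?scaler0.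
elim/ltn_ind: i => [[|i]] IHi im; first by rewrite w0.
(* With the lower coefficients of w known, this coefficient of w^2 is twice the one of w. *)
have : (w ^+ 2)`_i.+1 = 0.
  rewrite w2 coefD coef1 add0r coefM big1 // => j _; rewrite coef_expr_lt ?mul0r //.
  by have := ltn_ord j; lia.
rewrite expr2 coefM big_ord_recl big_ord_recr /= w0 subn0 subnn w0 mul1r mulr1 big1 => [|j _].
  rewrite add0r -mulr2n -scaler_nat => /(congr1 (fun x => 2^-1 *: x)).
  by rewrite scalerA mulVf ?pnatr_eq0 // scale1r scaler0.
have jl := ltn_ord j.
by rewrite IHi ?mul0r //; rewrite /bump /=; lia.
Qed.

End InverseSquareRoot.

Lemma map_mx_exp (R S : comNzRingType) (f : {rmorphism R -> S}) n (A : 'M[R]_n) k :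
  map_mx f (A ^+ k) = map_mx f A ^+ k.
Proof.
by elim: k => [|k IHk]; rewrite ?expr0 ?map_mx1 // !exprS -IHk -[RHS]map_mxM.
Qed.

Section Gamma.
Context (K : numFieldType) (n : nat).

Definition bilin (T : comAlgType K) (x y : 'cV[K]_n) (M : 'M[T]_n) : T :=
  \sum_a \sum_b (x a 0 * y b 0) *: M a b.

Lemma map_gamma (T T' : comAlgType K) (f : {lrmorphism T -> T'}) j x y (A : 'M[T]_n) :
  f (gamma j x y A) = gamma j x y (map_mx f A).
Proof.
rewrite rmorph_sum; apply: eq_bigr => k _; rewrite rmorphM; congr (_ * _).
  rewrite raddf_sum; apply: eq_bigr => a _; rewrite raddf_sum; apply: eq_bigr => b _ /=.
  by rewrite linearZ /= !mxE -map_mx_exp mxE rmorphM rmorph_sign.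
rewrite raddf_sum; apply: eq_bigr => i _ /=.
by rewrite linearZ /= -coef_map rmorphXn rmorphB rmorph1 /= map_det1X map_mx_exp.
Qed.

Context (T : comAlgType K).
Implicit Types (A : 'M[T]_n) (p D : {poly T}).

(* [s = -t^2] *)
Definition subst_sqr (p : {poly T}) : {poly T} := (p \Po (- 'X)) \Po 'X^2.

Lemma subst_sqrM : {morph subst_sqr : p q / p * q}.
Proof. by move=> p q; rewrite /subst_sqr !rmorphM. Qed.

Lemma coef_subst_sqr p i : (subst_sqr p)`_i.*2 = (-1) ^+ i * p`_i.
Proof.
rewrite coef_comp_poly_Xn // -muln2 dvdn_mull // mulnK // -['X]scale1r -scaleNr.
rewrite coef_comp_poly (eq_bigr (fun k : 'I_(size p) => p`_k * ((-1) ^+ k * (k == i :> nat)%:R))); last first.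
  by move=> k _; rewrite exprZn coefZ coefXn eq_sym.
have [ip|ip] := ltnP i (size p).
  rewrite (bigD1 (Ordinal ip)) //= eqxx mulr1 mulrC big1 ?addr0 // => k ki.
  by rewrite -[nat_of_ord k == i]/(k == Ordinal ip) (negPf ki) !mulr0.
rewrite nth_default // mulr0 big1 // => k _; rewrite ltn_eqF ?mulr0 //.
exact: leq_trans (ltn_ord k) ip.
Qed.

Lemma subst_sqr_inj : injective subst_sqr.
Proof.
move=> p q pq; apply/polyP => i; apply: (can_inj (signrMK i)).
by rewrite -!coef_subst_sqr pq.
Qed.

Lemma even_subst_sqr p : (forall i, odd i -> p`_i = 0) -> exists q, p = subst_sqr q.
Proof.
move=> podd; exists (even_poly p \Po (- 'X)).
rewrite /subst_sqr -[X in X \Po 'X^2]comp_polyA rmorphN /= comp_polyX opprK comp_polyXr.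
rewrite -{1}(poly_even_odd p) (_ : odd_poly p = 0) ?comp_poly0 ?mul0r ?addr0 //.
by apply/polyP => i; rewrite coef_odd_poly coef0 podd //= odd_double.
Qed.

Lemma det1X_even A i : A^T = - A -> odd i -> (det1X A)`_i = 0.
Proof.
move=> AT; apply: (@det1X_odd _ _ A 1%:M); rewrite ?mulmx1 ?mul1mx ?AT ?addNr // => x.
rewrite -scaler_nat => /(congr1 (fun z => 2^-1 *: z)).
by rewrite scalerA mulVf ?pnatr_eq0 // scale1r scaler0.
Qed.

(** 1 - t^2 A^2 is (1 - tA)(1 + tA), and for skew A the two factors have the same determinant. *)
Lemma det1X_sqr A : A^T = - A -> (det1X A) ^+ 2 = subst_sqr (det1X (A ^+ 2)).
Proof.
move=> AT; have H : det1X (- A) = det1X A.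
  by apply: (@det1X_skew _ _ _ 1%:M); rewrite ?mulmx1 // mul1mx AT addNr.
rewrite expr2 -{1}H -det_mulmx.
rewrite /subst_sqr -[(_ \Po _) \Po _]/(((comp_poly 'X^2) \o (comp_poly (- 'X))) _) -det_map_mx.
congr (\det _).
have -> : map_mx (comp_poly 'X^2 \o comp_poly (- 'X)) (1%:M + 'X *: map_mx polyC (A ^+ 2)) =
   1%:M - 'X^2 *: map_mx polyC (A *m A).
  apply/matrixP => i j; rewrite !mxE /= !rmorphD !rmorphM /= !comp_polyX !comp_polyC !raddfN /= !comp_polyX.
  by rewrite !raddfMn /= !rmorph1 mulNr.
rewrite map_mxN scalerN mulmxDl mul1mx mulmxDr mulmx1 mulNmx -scalemxAr -scalemxAl scalerA -expr2 map_mxM.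
by rewrite -addrA addNKr.
Qed.

(** Put t^2 = - s and let E', D' be det (1 + tA) and D as series in s. The gamma_j are the
    coefficients of S / E', and the factors in front of them those of E' D'. In the product E'
    cancels, and the coefficient of s^m in D' S remains. *)
Lemma gamma_sum m x y A D : A^T = - A -> D`_0 = 1 -> (forall i, odd i -> D`_i = 0) ->
  \sum_(j < m) ((-1) ^+ (m - j) * (det1X A * D)`_(2 * (m - j))) * gamma j x y A
    + gamma m x y A =
  (-1) ^+ m * \sum_(i < m.+1) D`_(2 * i) * bilin x y (A ^+ (2 * (m - i)).+1).
Proof.
move=> AT D0 Dodd.
have [E' EE] := even_subst_sqr (fun i => det1X_even AT (i := i)).
have [D' DE] := even_subst_sqr Dodd.
have E'2 : E' ^+ 2 = det1X (A ^+ 2).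
  by apply: subst_sqr_inj; rewrite -det1X_sqr // expr2 subst_sqrM -EE expr2.
have E'0 : E'`_0 = 1 by rewrite -(det1X_0 A) EE (coef_subst_sqr _ 0) expr0 mul1r.
have D'0 : D'`_0 = 1 by rewrite -D0 DE (coef_subst_sqr _ 0) expr0 mul1r.
have [G [GE EG]] := invsqrt_inverse m E'0.
pose S := \poly_(k < m.+1) ((-1) ^+ k * bilin x y (A ^+ (2 * k).+1)).
have gammaE j : (j <= m)%N -> gamma j x y A = (S * G)`_j.
  move=> jm; rewrite coefM; apply: eq_bigr => k _.
  have km : (k < m.+1)%N by have := ltn_ord k; lia.
  rewrite coef_poly km GE ?(leq_trans (leq_subr _ _)) // E'2; congr (_ * _).
  rewrite /bilin mulr_sumr; apply: eq_bigr => a _; rewrite mulr_sumr; apply: eq_bigr => b _.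
  by rewrite mxE scalerAr.
have -> : \sum_(j < m) ((-1) ^+ (m - j) * (det1X A * D)`_(2 * (m - j))) * gamma j x y A
    + gamma m x y A = (E' * D' * (S * G))`_m.
  (* The separate summand [gamma m] is the term j = m, since E' D' has constant term 1. *)
  rewrite [in RHS]mulrC coefM big_ord_recr /= subnn coef0M E'0 D'0 !mulr1.
  rewrite gammaE //; congr (_ + _); apply: eq_bigr => j _.
  rewrite gammaE ?(ltnW (ltn_ord j)) // [RHS]mulrC; congr (_ * _).
  by rewrite EE DE -subst_sqrM mul2n coef_subst_sqr signrMK.
have -> : E' * D' * (S * G) = (D' * S) * (E' * G) by ring.
rewrite coefM big_ord_recr /= subnn EG // mulr1 big1 ?add0r => [|k _]; last first.
  by rewrite EG ?leq_subr // subn_eq0 leqNgt ltn_ord mulr0.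
rewrite coefM mulr_sumr; apply: eq_bigr => i _.
have im : (i <= m)%N by rewrite -ltnS.
rewrite DE mul2n coef_subst_sqr coef_poly ltnS leq_subr.
have -> : (-1) ^+ m = (-1) ^+ i * (-1) ^+ (m - i) :> T by rewrite -exprD subnKC.
by rewrite -[(-1) ^+ i]signr_odd; case: odd; rewrite ?expr1 ?expr0; ring.
Qed.

End Gamma.

(** * Block determinants and adjugates *)

Section CornerDet.
Context (T : idomainType) (N m : nat).
Local Notation q := (2 * m).+1.

(* Scaling turns the corner entries of [ursubmx X] into multiples of t^(2m+2). *)
Lemma det1X_corner (X : 'M[T]_(N + q)) j :
  (forall i k, k != ord0 -> X (lshift q i) (rshift N k) = 0) ->
  (forall i k, k != ord_max -> X (rshift N k) (lshift q i) = 0) ->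
  (forall k l : 'I_q, (k.+1 < l)%N -> X (rshift N k) (rshift N l) = 0) ->
  (j <= 2 * m)%N -> (det1X X)`_j = (det1X (ulsubmx X) * det1X (drsubmx X))`_j.
Proof.
move=> ur0 dl0 dr0 jm.
(* The first N indices get the weight q, above all k <= 2m: the first column of the upper right
   block acquires t^(q + 1), while the last row of the lower left block loses its power of t. *)
pose sh (a : 'I_(N + q)) : nat := match split a with inl _ => q | inr k => k end.
have shl i : sh (lshift q i) = q by rewrite /sh (unsplitK (inl i)).
have shr k : sh (rshift N k) = k by rewrite /sh (unsplitK (inr k)).
pose D' : 'M[{poly T}]_q := \matrix_(k, l)
  ((k == l)%:R + if (k.+1 == l)%N then (X (rshift N k) (rshift N l))%:P
                 else (X (rshift N k) (rshift N l))%:P * 'X^((k - l).+1)).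
have D'E (k l : 'I_q) : 'X^k * ((k == l)%:R + 'X * (X (rshift N k) (rshift N l))%:P) = D' k l * 'X^l.
  rewrite !mxE mulrDr mulrDl; congr (_ + _).
    by have [->|_] := eqVneq k l; rewrite ?mulr0 ?mul0r // mulr1 mul1r.
  have [kl|kl] := eqVneq k.+1 l; first by rewrite -kl mulrA -exprSr mulrC.
  have [lk|lk] := leqP l k.
    by rewrite mulrA -exprSr mulrC -mulrA -exprD; congr (_ * 'X^_); lia.
  by rewrite dr0 ?polyC0 ?(mulr0, mul0r) //; lia.
have detD' : det1X (drsubmx X) = \det D'.
  by apply: (@det_scaling T q (fun k => k)) => k l; rewrite -D'E !mxE.
pose M0 : 'M[{poly T}]_(N + q) := block_mx (1%:M + 'X *: map_mx polyC (ulsubmx X)) 0 (map_mx polyC (dlsubmx X)) D'.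
pose B : 'M[{poly T}]_(N + q) := block_mx 0 (map_mx polyC (ursubmx X)) 0 0.
have dX : det1X X = \det (M0 + 'X^(q.+1) *: B).
  apply: (det_scaling (sh := sh)) => a b.
  rewrite /M0 /B scale_block_mx add_block_mx !scaler0 !addr0 add0r.
  case: (split_ordP a) => i ->; case: (split_ordP b) => k ->; rewrite ?shl ?shr
    ?block_mxEul ?block_mxEur ?block_mxEdl ?block_mxEdr.
  - by rewrite !mxE (inj_eq (@lshift_inj _ _)) mulrC.
  - rewrite !mxE eq_lrshift add0r; have [->|k0] := eqVneq k ord0; last by rewrite ur0 // polyC0 !mulr0 mul0r.
    by rewrite expr0 mulr1 mulrA -exprSr.
  - rewrite !mxE eq_rlshift add0r; have [->|k0] := eqVneq i ord_max; last by rewrite dl0 // polyC0 !mulr0 mul0r.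
    by rewrite mulrA -exprSr mulrC.
  by rewrite -D'E !mxE (inj_eq (@rshift_inj _ _)).
have [p pE] := det_first_order M0 B.
rewrite dX pE det_lblock -detD' !coefD coefXnM ltnS leqW // addr0 -exprM coefXnM ifT ?addr0 //; lia.
Qed.

End CornerDet.

(** * Coefficients of the adjugate of 1 + td *)

Section AdjugateCoefficients.
Context (T : comNzRingType) (p : nat) (d : 'M[T]_p.+1).

Definition adj_coef k : 'M[T]_p.+1 := map_mx (coefp k) (\adj (1%:M + 'X *: map_mx polyC d)).
Local Notation del k := (det1X d)`_k.

Lemma coef_mulX_map k (P : 'M[{poly T}]_p.+1) :
  map_mx (coefp k.+1) (P *m (1%:M + 'X *: map_mx polyC d)) = map_mx (coefp k.+1) P + map_mx (coefp k) P *m d.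
Proof.
rewrite mulmxDr mulmx1 map_mxD; congr (_ + _); apply/matrixP => i j.
rewrite -scalemxAr !mxE /= coefXM /= coef_sum; apply: eq_bigr => l _.
by rewrite !mxE /= coefMC.
Qed.

Lemma coef_map_mulX k (P : 'M[{poly T}]_p.+1) :
  map_mx (coefp k.+1) ((1%:M + 'X *: map_mx polyC d) *m P) = map_mx (coefp k.+1) P + d *m map_mx (coefp k) P.
Proof.
rewrite mulmxDl mul1mx map_mxD; congr (_ + _); apply/matrixP => i j.
rewrite -scalemxAl !mxE /= coefXM /= coef_sum; apply: eq_bigr => l _.
by rewrite !mxE /= coefCM.
Qed.

Lemma coef_scalar k (x : {poly T}) : map_mx (coefp k) (x%:M : 'M_p.+1) = (x`_k)%:M.
Proof. by apply/matrixP => i j; rewrite !mxE /= coefMn. Qed.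

(** The Faddeev-LeVerrier recursion, read off from the product of 1 + td with its adjugate. *)
Lemma adj_coefSr k : adj_coef k.+1 = (del k.+1)%:M - adj_coef k *m d.
Proof. by rewrite -coef_scalar -mul_adj_mx coef_mulX_map addrK. Qed.

Lemma adj_coefSl k : adj_coef k.+1 = (del k.+1)%:M - d *m adj_coef k.
Proof. by rewrite -coef_scalar -mul_mx_adj coef_map_mulX addrK. Qed.

Lemma adj_coef0 : adj_coef 0 = 1%:M.
Proof.
rewrite -[1]/(1 : T) -(det1X_0 d) -coef_scalar -mul_adj_mx mulmxDr mulmx1 map_mxD.
rewrite [X in _ + X](_ : _ = 0) ?addr0 //.
by apply/matrixP => i j; rewrite -scalemxAr !mxE /= coefXM.
Qed.

(** The entries of the adjugate are minors of size p, hence of degree at most p in t. This end of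
    the recursion is the Cayley-Hamilton theorem for d. *)
Lemma adj_coef_top : adj_coef p.+1 = 0.
Proof.
apply/matrixP => i j; rewrite !mxE /= /cofactor; set P := \det _.
have P0 : P`_p.+1 = 0.
  apply/nth_default/size_det_linear => k l; apply/leq_sizeP => h h2; rewrite !mxE.
  by rewrite coefD coefMn coef1 coefXM coefC; case: h h2 => [|[|h]] //=; rewrite mul0rn addr0.
by rewrite -signr_odd; case: odd; rewrite ?expr0 ?expr1 ?mulN1r ?mul1r ?coefN P0 ?oppr0.
Qed.

Lemma adj_coefE k : adj_coef k = \sum_(i < k.+1) del i *: (- d) ^+ (k - i).
Proof.
elim: k => [|k IHk]; first by rewrite big_ord1 adj_coef0 det1X_0 scale1r.
rewrite adj_coefSr big_ord_recr /= subnn expr0 scalemx1 addrC IHk; congr (_ + _).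
rewrite mulmx_suml -sumrN; apply: eq_bigr => i _.
rewrite -scalemxAl -scalerN subSn; last by rewrite -ltnS.
by rewrite exprSr -[_ * - d]/(_ *m - d) mulmxN.
Qed.

End AdjugateCoefficients.

(** * Symmetric algebras and orthogonal Lie algebras *)

Section SymEvaluation.
Context (K : fieldType) (vT : vectType K).
Implicit Types (U : {vspace vT}) (phi : {scalar vT}).

Definition symev U phi (p : Sym U) : K := p.@[fun i => phi (vbasis U)`_i].

Lemma symev_symv U phi u : u \in U -> symev phi (symv U u) = phi u.
Proof.
move=> uU; rewrite {2}(coord_vbasis uU) /symev /symv !raddf_sum.
by apply: eq_bigr => i _ /=; rewrite mevalZ mevalXU linearZ.
Qed.

Lemma symv_is_linear U : linear (symv U).
Proof.
move=> a u v; rewrite /symv scaler_sumr -big_split; apply: eq_bigr => i _ /=.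
by rewrite linearP scalerDl scalerA.
Qed.

HB.instance Definition _ U := GRing.isLinear.Build K vT (Sym U) _ (symv U) (symv_is_linear U).

Lemma symv_vbasis U (i : 'I_(\dim U)) : symv U (vbasis U)`_i = 'X_i.
Proof.
rewrite /symv (bigD1 i) //= coord_free ?eqxx ?scale1r ?(basis_free (vbasisP U)) //.
rewrite big1 ?addr0 // => j ji.
by rewrite coord_free ?(basis_free (vbasisP U)) // -[_ == _]/(i == j) eq_sym (negPf ji) scale0r.
Qed.

Lemma mderiv_symv U (i : 'I_(\dim U)) u : (symv U u)^`M(i) = (coord (vbasis U) i u)%:MP.
Proof.
rewrite /symv linear_sum (bigD1 i) //= big1 ?addr0 => [|j ji]; rewrite linearZ /= mderivX mnm1E.
  have -> : (U_(i) - U_(i) = 0 :> 'X_{1..\dim U})%MM by apply/mnmP => k; rewrite mnmBE mnm0E subnn.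
  by rewrite eqxx scale1r mpolyX0 alg_mpolyC.
by rewrite (negPf ji) scale0r scaler0.
Qed.

End SymEvaluation.

Lemma adE (K : fieldType) n (X Z : 'M[K]_n) : ad X Z = lie X Z.
Proof. by rewrite /ad add_lfunE opp_lfunE !lfunE. Qed.

Section Orthogonal.
Context (K : numFieldType) (n : nat) (J : 'M[K]_n).
Hypotheses (JT : J^T = J) (JJ : J *m J = 1%:M).
Local Notation g := (lie_preserving J).
Implicit Types X Y Z : 'M[K]_n.

Lemma mem_lie_preserving X : (X \in g) = (X^T *m J + J *m X == 0).
Proof. by rewrite memv_ker add_lfunE !lfunE. Qed.

Let mulJJ p (A : 'M[K]_(n, p)) : J *m (J *m A) = A.
Proof. by rewrite mulmxA JJ mul1mx. Qed.

Lemma lie_preservingP X : reflect (X^T = - (J *m X *m J)) (X \in g).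
Proof.
rewrite mem_lie_preserving addr_eq0; apply: (iffP eqP) => [H|->].
  by rewrite -mulNmx -H -mulmxA JJ mulmx1.
by rewrite mulNmx -!mulmxA JJ mulmx1.
Qed.

(** The projection of all matrices onto g that is orthogonal for the trace form. *)
Definition skew_part Z := 2^-1 *: (Z - J *m Z^T *m J).

Lemma skew_part_mem Z : skew_part Z \in g.
Proof.
apply/lie_preservingP; rewrite /skew_part linearZ /= -scalemxAr -scalemxAl -scalerN; congr (_ *: _).
by rewrite linearB /= !trmx_mul JT trmxK mulmxBr mulmxBl opprB -!mulmxA mulJJ JJ mulmx1.
Qed.

Lemma skew_part_id X : X \in g -> skew_part X = X.
Proof.
move/lie_preservingP=> XT; rewrite /skew_part XT mulmxN mulNmx opprK -!mulmxA mulJJ JJ mulmx1.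
by rewrite -mulr2n -scaler_nat scalerA mulVf ?pnatr_eq0 // scale1r.
Qed.

Lemma mxtrace_mulJ X Z : X \in g -> \tr (X *m (J *m Z^T *m J)) = - \tr (X *m Z).
Proof.
move/lie_preservingP=> XT; rewrite -mxtrace_tr !trmx_mul JT trmxK XT.
by rewrite mulmxN raddfN /= -!mulmxA mulJJ mxtrace_mulC -!mulmxA JJ mulmx1 mxtrace_mulC.
Qed.

Lemma mxtrace_skew_part X Z : X \in g -> \tr (X *m skew_part Z) = \tr (X *m Z).
Proof.
move=> Xg; rewrite /skew_part -scalemxAr mulmxBr mxtraceZ raddfB /= mxtrace_mulJ // opprK.
by field.
Qed.

Lemma lie_mem X Y : X \in g -> Y \in g -> lie X Y \in g.
Proof.
move=> /lie_preservingP XT /lie_preservingP YT; apply/lie_preservingP.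
rewrite /lie linearB /= !trmx_mul XT YT !mulmxN !mulNmx !opprK mulmxBr mulmxBl opprB.
by rewrite -!mulmxA !mulJJ.
Qed.

Lemma mxtrace_so X : X \in g -> \tr X = 0.
Proof.
move=> Xg; have := mxtrace_mulJ 1%:M Xg.
by rewrite trmx1 mulmx1 JJ mulmx1 => /eqP; rewrite -addr_eq0 -mulr2n mulrn_eq0 /= => /eqP.
Qed.

Lemma mxtrace_lie X Y Z : \tr (lie X Y *m Z) = \tr (X *m lie Y Z).
Proof.
rewrite /lie mulmxBl mulmxBr !raddfB /= -!mulmxA; congr (_ - _).
by rewrite mxtrace_mulC -mulmxA.
Qed.

Lemma mul_delta_mxE (A B : 'M[K]_n) a b c d : (A *m delta_mx c d *m B) a b = A a c * B d b.
Proof.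
rewrite mxE (bigD1 d) //= big1 ?addr0 => [|k kd].
  rewrite mxE (bigD1 c) //= big1 ?addr0 => [|k kc]; first by rewrite mxE !eqxx mulr1.
  by rewrite mxE (negPf kc) mulr0.
by rewrite mxE big1 ?mul0r // => l _; rewrite mxE (negPf kd) andbF mulr0.
Qed.

(** A trace over g is a trace over all matrices after composition with the projection [skew_part].
    Its terms in Z contribute 2n tr (XY), X and Y being traceless, and its terms in J Z^T J
    contribute 4 tr (XY); half the difference is (n - 2) tr (XY). *)
Lemma killing_trace X Y : X \in g -> Y \in g ->
  killing g X Y = (n%:R - 2) * \tr (X *m Y).
Proof.
move=> Xg Yg; pose T Z := lie X (lie Y Z).
have TP Z : T Z = X *m Y *m Z *m 1%:M - X *m Z *m Y - Y *m Z *m X + 1%:M *m Z *m (Y *m X).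
  by rewrite /T /lie mulmxBr mulmxBl !mulmxA opprD opprK addrA mulmx1 mul1mx.
have Tlin : linear T.
  by move=> c u v; rewrite /T -!adE !linearP.
pose Tl : {linear _ -> _} := HB.pack T (GRing.isLinear.Build K _ _ _ T Tlin).
have Tg Z : Z \in g -> T Z \in g by move=> Zg; apply: lie_mem => //; apply: lie_mem.
have Plin : linear skew_part.
  move=> c u v; rewrite /skew_part linearP /= mulmxDr mulmxDl -scalemxAr -scalemxAl.
  by rewrite opprD addrACA -scalerBr scalerDr !scalerA mulrC.
pose Pl : {linear _ -> _} := HB.pack skew_part (GRing.isLinear.Build K _ _ _ _ Plin).
pose E a b : 'M[K]_n := delta_mx a b.
have -> : killing g X Y = \sum_a \sum_b (T (skew_part (E a b))) a b.
  have coordT i : coord (vbasis g) i (T (vbasis g)`_i) =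
      \sum_a \sum_b (T (vbasis g)`_i) a b * coord (vbasis g) i (skew_part (E a b)).
    have bg : (vbasis g)`_i \in g by apply: vbasis_mem; apply: mem_nth; rewrite size_tuple.
    rewrite -{1}(skew_part_id (Tg _ bg)) [T _ in LHS]matrix_sum_delta.
    rewrite -[skew_part _]/(Pl _) !linear_sum; apply: eq_bigr => a _ /=.
    rewrite -[skew_part _ in LHS]/(Pl _) !linear_sum; apply: eq_bigr => b _.
    have -> : Pl (T (vbasis g)`_i a b *: delta_mx a b) = T (vbasis g)`_i a b *: Pl (E a b).
      exact: linearZ.
    by rewrite linearZ.
  rewrite /killing (eq_bigr _ (fun i _ => coordT i)) exchange_big; apply: eq_bigr => a _ /=.
  rewrite exchange_big; apply: eq_bigr => b _ /=.
  rewrite [in RHS](coord_vbasis (skew_part_mem (E a b))) -[T _ in RHS]/(Tl _) linear_sum summxE.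
  by apply: eq_bigr => i _; rewrite [Tl _](_ : _ = coord (vbasis g) i (skew_part (E a b)) *: Tl (vbasis g)`_i) ?mxE 1?mulrC //; apply: linearZ.
have trD (A B : 'M[K]_n) : \sum_a \sum_b (A *m E a b *m B) a b = \tr A * \tr B.
  rewrite mulr_suml; apply: eq_bigr => a _; rewrite mulr_sumr; apply: eq_bigr => b _.
  exact: mul_delta_mxE.
have trDT (A B : 'M[K]_n) : \sum_a \sum_b (A *m (J *m (E a b)^T *m J) *m B) a b = \tr (A *m J *m (J *m B)^T).
  apply: eq_bigr => a _; rewrite mxE; apply: eq_bigr => b _.
  by rewrite !mulmxA -[_ *m J *m B]mulmxA /E trmx_delta mul_delta_mxE [_^T _ _]mxE.
have TPE a b : T (skew_part (E a b)) a b = 2^-1 * (T (E a b) a b - T (J *m (E a b)^T *m J) a b).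
  by rewrite -[T _ in LHS]/(Tl _) linearZ linearB /= !mxE.
rewrite (eq_bigr _ (fun a _ => eq_bigr _ (fun b _ => TPE a b))).
under eq_bigr => a _ do rewrite -mulr_sumr sumrB.
rewrite -mulr_sumr sumrB.
have sumT (F : 'I_n -> 'I_n -> 'M[K]_n) : \sum_a \sum_b (T (F a b)) a b =
    \sum_a \sum_b (X *m Y *m F a b *m 1%:M) a b - \sum_a \sum_b (X *m F a b *m Y) a b
    - \sum_a \sum_b (Y *m F a b *m X) a b + \sum_a \sum_b (1%:M *m F a b *m (Y *m X)) a b.
  rewrite -!sumrB -big_split; apply: eq_bigr => a _ /=; rewrite -!sumrB -big_split.
  by apply: eq_bigr => b _ /=; rewrite TP !mxE.
rewrite !sumT !trD !trDT !mxtrace1 (mxtrace_so Xg) (mxtrace_so Yg) !(mul0r, mulr0).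
have [/lie_preservingP XT /lie_preservingP YT] := (Xg, Yg).
have -> : \tr (X *m Y *m J *m (J *m 1%:M)^T) = \tr (X *m Y) by rewrite mulmx1 JT -mulmxA JJ mulmx1.
have -> : \tr (X *m J *m (J *m Y)^T) = - \tr (X *m Y).
  by rewrite trmx_mul JT YT mulNmx mulmxN raddfN /= -!mulmxA !mulJJ JJ mulmx1.
have -> : \tr (Y *m J *m (J *m X)^T) = - \tr (Y *m X).
  by rewrite trmx_mul JT XT mulNmx mulmxN raddfN /= -!mulmxA !mulJJ JJ mulmx1.
have -> : \tr (1%:M *m J *m (J *m (Y *m X))^T) = \tr (Y *m X).
  by rewrite mul1mx [(J *m _)^T]trmx_mul JT mxtrace_mulC -!mulmxA JJ mulmx1 mxtrace_tr.
by rewrite (mxtrace_mulC Y X); field.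
Qed.

End Orthogonal.

(** * The sl2-triple and its centralizers *)

Section ShiftCommutant.
Context (K : numFieldType) (m : nat) (al : nat -> K).
Local Notation q := (2 * m).+1.
Hypothesis al0 : forall k, (k < 2 * m)%N -> al k != 0.

Definition shift_mx : 'M[K]_q := \matrix_(k, l) ((l == k.+1 :> nat)%:R * al k).
Local Notation eps := shift_mx.

Lemma mul_shift_mx (d : 'M_q) (k l : 'I_q) (k1 : (k.+1 < q)%N) : (eps *m d) k l = al k * d (Ordinal k1) l.
Proof.
rewrite mxE (bigD1 (Ordinal k1)) //= mxE eqxx mul1r big1 ?addr0 // => i ik.
by rewrite mxE -[i == k.+1 :> nat]/(i == Ordinal k1) (negPf ik) !mul0r.
Qed.

Lemma shift_mx_exp j (k l : 'I_q) :
  (eps ^+ j) k l = (l == k + j :> nat)%N%:R * \prod_(k <= i < k + j) al i.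
Proof.
elim: j k => [|j IHj] k.
  by rewrite expr0 mxE addn0 big_geq // mulr1 eq_sym.
rewrite exprS -[eps * _]/(eps *m _); have [k1|k1] := ltnP k.+1 q.
  rewrite (mul_shift_mx _ _ k1) IHj /= addSnnS.
  have -> : \prod_(k <= i < k + j.+1) al i = al k * \prod_(k.+1 <= i < k + j.+1) al i.
    by apply: big_ltn; lia.
  exact: mulrCA.
rewrite mxE big1 => [|i _]; last by rewrite mxE ltn_eqF ?mul0r // (leq_trans (ltn_ord i)).
by rewrite ltn_eqF ?mul0r //; have := ltn_ord l; lia.
Qed.

(** Commuting with eps expresses row k + 1 of d by row k, because the weights are nonzero. So d is
    determined by its row 0, and the powers of eps provide every such row. *)
Lemma shift_commutant (d : 'M_q) : eps *m d = d *m eps ->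
  exists x : nat -> K, d = \sum_(j < q) x j *: eps ^+ j.
Proof.
move=> cd; pose pr j := \prod_(0 <= i < j) al i.
have pr0 j : (j < q)%N -> pr j != 0.
  move=> jq; rewrite /pr prodf_seq_neq0; apply/allP => i; rewrite mem_index_iota => /andP[_ ij].
  by apply/implyP => _; apply: al0; lia.
(* [pr j] is the only nonzero entry in row 0 of eps^j. *)
pose x j := d ord0 (inord j) / pr j; exists x.
set s := \sum_(j < q) _.
have cs : eps *m s = s *m eps.
  rewrite mulmx_sumr mulmx_suml; apply: eq_bigr => j _.
  by rewrite -scalemxAr -scalemxAl -[eps *m _]exprS -[_ *m eps]exprSr.
have cds : eps *m (d - s) = (d - s) *m eps by rewrite mulmxBr mulmxBl cd cs.
suff H k l : (d - s) k l = 0.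
  by apply/eqP; rewrite -subr_eq0; apply/eqP/matrixP => k l; rewrite H mxE.
case: k => k; elim: k l => [|k IHk] l k1.
  rewrite !mxE summxE (bigD1 l) //= mxE shift_mx_exp /= add0n eqxx mul1r.
  rewrite [\sum_(i < q | _) _]big1 ?addr0 => [|j jl].
    rewrite /x inord_val -/(pr _) mulfVK ?pr0 //.
    by apply/eqP; rewrite subr_eq0; apply/eqP; congr (d _ _); apply/val_inj.
  by rewrite mxE shift_mx_exp /= add0n -[l == j :> nat]/(l == j) eq_sym (negPf jl) mul0r mulr0.
have kq : (k < q)%N by lia.
have := @mul_shift_mx (d - s) (Ordinal kq) l k1.
rewrite cds mxE big1 => [/esym/eqP|j _]; last by rewrite IHk mul0r.
by rewrite mulf_eq0 (negPf (al0 _)) //= => /eqP.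
Qed.

Hypothesis al_sym : forall k, (k < 2 * m)%N -> al (2 * m - k.+1) = - al k.

Lemma sum_odd (V : zmodType) p (F : nat -> V) : (forall j, ~~ odd j -> F j = 0) ->
  \sum_(j < (2 * p).+1) F j = \sum_(k < p) F (2 * (p - k)).-1%N.
Proof.
move=> F0; rewrite -(big_mkord xpredT F); elim: p => [|p IHp].
  by rewrite big_nat1 big_ord0 F0.
have -> : (2 * p.+1).+1 = (2 * p).+3 by lia.
rewrite 2?big_nat_recr // IHp big_ord_recl subn0 [F (2 * p).+2]F0 /=; last by lia.
rewrite addr0 addrC; congr (F _ + _); lia.
Qed.

(** By [al_sym], reflection in the antidiagonal multiplies eps^j by (-1)^j, so that skewness kills
    the even powers. The proof sees this on one entry of d in row 0 and its mirror image. *)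
Lemma shift_commutant_skew (d : 'M_q) : eps *m d = d *m eps ->
  (forall k l, d k l = - d (rev_ord l) (rev_ord k)) ->
  exists c : 'rV[K]_m, d = \sum_(k < m) c 0 k *: eps ^+ (2 * (m - k)).-1.
Proof.
move=> /shift_commutant[x dx] dsk.
have dE k l : d k l = \sum_(j < q) x j * ((l == k + j :> nat)%N%:R * \prod_(k <= i < k + j) al i).
  by rewrite dx summxE; apply: eq_bigr => j _; rewrite mxE shift_mx_exp.
have x0 j : (j < q)%N -> ~~ odd j -> x j = 0.
  move=> jq oj; have d0 : d ord0 (Ordinal jq) = x j * \prod_(0 <= i < j) al i.
    rewrite dE (bigD1 (Ordinal jq)) //= add0n eqxx mul1r [\sum_(i < q | _) _]big1 ?addr0 // => i ij.
    by rewrite add0n -[j == i]/(Ordinal jq == i) eq_sym (negPf ij) mul0r mulr0.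
  have d1 : d (rev_ord (Ordinal jq)) (rev_ord ord0) = x j * \prod_(2 * m - j <= i < 2 * m) al i.
    have Hj : ((2 * m).+1 - j.+1 + j = 2 * m)%N by lia.
    rewrite dE (bigD1 (Ordinal jq)) //= Hj subSS subn0 eqxx mul1r [\sum_(i < q | _) _]big1 ?addr0 // => i ij.
    rewrite (_ : _ == _ = false) ?mul0r ?mulr0 //; apply: contraNF ij => /eqP H.
    by apply/eqP/val_inj => /=; lia.
  have pE : \prod_(2 * m - j <= i < 2 * m) al i = \prod_(0 <= i < j) al i.
    rewrite -[(2 * m - j)%N]add0n big_addn (_ : 2 * m - _ = j)%N; last by lia.
    rewrite big_nat_rev big_nat (eq_bigr (fun i => - al i)); last first.
      by move=> i /andP[_ ij]; rewrite -al_sym; [congr al; lia | lia].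
    rewrite -big_nat; have H p : \prod_(0 <= i < p) - al i = (-1) ^+ p * \prod_(0 <= i < p) al i.
      elim: p => [|p IHp]; first by rewrite !big_geq // mulr1.
      by rewrite !big_nat_recr //= IHp exprS; ring.
    by rewrite H -signr_odd (negPf oj) mul1r.
  have := dsk ord0 (Ordinal jq); rewrite d0 d1 pE => /eqP.
  rewrite -addr_eq0 -mulr2n mulrn_eq0 /= mulf_eq0 => /orP[/eqP //|].
  rewrite prodf_seq_eq0; case/hasP => i; rewrite mem_index_iota => /andP[_ ij] /= /eqP ai.
  by have im : (i < 2 * m)%N; [lia | have := al0 im; rewrite ai eqxx].
exists (\row_k x (2 * (m - k)).-1).
pose F j := (if (j < q)%N then x j else 0) *: eps ^+ j.
rewrite dx (eq_bigr (fun j : 'I_q => F j)); last by move=> j _; rewrite /F ltn_ord.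
rewrite (@sum_odd _ m F) => [|j oj]; last first.
  by rewrite /F; case: ifP => jq; rewrite ?x0 ?scale0r.
apply: eq_bigr => k _; rewrite /F mxE ifT //; have := ltn_ord k; lia.
Qed.

End ShiftCommutant.

Section Slice.
Context (C : numClosedFieldType) (N m : nat).
Local Notation q := (2 * m).+1.
Local Notation n := (N + q)%N.
Local Notation g := (gso C N m).
Local Notation J := (Jform C N m).
Implicit Types X Y Z : 'M[C]_n.

Definition inv_idx (a : 'I_n) : 'I_n :=
  match split a with inl i => lshift q i | inr k => rshift N (rev_ord k) end.

(* The eigenvalue of ad h on E_ab is 2 (level b - level a). *)
Definition level (a : 'I_n) : nat := match split a with inl _ => m | inr k => k end.

Lemma inv_idxl (i : 'I_N) : inv_idx (lshift q i) = lshift q i.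
Proof. by rewrite /inv_idx (unsplitK (inl i)). Qed.

Lemma inv_idxr (k : 'I_q) : inv_idx (rshift N k) = rshift N (rev_ord k).
Proof. by rewrite /inv_idx (unsplitK (inr k)). Qed.

Lemma levell (i : 'I_N) : level (lshift q i) = m.
Proof. by rewrite /level (unsplitK (inl i)). Qed.

Lemma levelr (k : 'I_q) : level (rshift N k) = k.
Proof. by rewrite /level (unsplitK (inr k)). Qed.

Lemma inv_idxK : involutive inv_idx.
Proof. by move=> a; case: (split_ordP a) => i ->; rewrite ?inv_idxl ?inv_idxl // !inv_idxr rev_ordK. Qed.

Lemma level_lt a : (level a < q)%N.
Proof. by case: (split_ordP a) => i ->; rewrite ?levell ?levelr //; lia. Qed.

Lemma level_inv a : (level (inv_idx a) + level a = 2 * m)%N.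
Proof.
case: (split_ordP a) => i ->; rewrite ?inv_idxl ?inv_idxr ?levell ?levelr; first by lia.
by have := ltn_ord i; rewrite /=; lia.
Qed.

Lemma JformE a b : J a b = (b == inv_idx a)%:R.
Proof.
rewrite /Jform; case: (split_ordP a) => i ->; case: (split_ordP b) => j ->;
  rewrite ?inv_idxl ?inv_idxr ?block_mxEul ?block_mxEur ?block_mxEdl ?block_mxEdr ?mxE.
- by rewrite eq_sym (inj_eq (@lshift_inj _ _)).
- by rewrite eq_rlshift.
- by rewrite eq_lrshift.
rewrite (inj_eq (@rshift_inj _ _)) -val_eqE /=; congr (nat_of_bool _)%:R.
by have := ltn_ord i; have := ltn_ord j; lia.
Qed.

Lemma Jform_tr : J^T = J.
Proof. by apply/matrixP => a b; rewrite mxE !JformE eq_sym (canF_eq inv_idxK). Qed.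

Lemma mulJE p (A : 'M[C]_(n, p)) a b : (J *m A) a b = A (inv_idx a) b.
Proof.
rewrite mxE (bigD1 (inv_idx a)) //= JformE eqxx mul1r big1 ?addr0 // => c ca.
by rewrite JformE (negPf ca) mul0r.
Qed.

Lemma mulEJ p (A : 'M[C]_(p, n)) a b : (A *m J) a b = A a (inv_idx b).
Proof.
rewrite mxE (bigD1 (inv_idx b)) //= JformE inv_idxK eqxx mulr1 big1 ?addr0 // => c cb.
by rewrite JformE eq_sym (canF_eq inv_idxK) (negPf cb) mulr0. Qed.

Lemma Jform_sq : J *m J = 1%:M.
Proof. by apply/matrixP => a b; rewrite mulJE JformE inv_idxK mxE eq_sym. Qed.

Lemma gsoP X : reflect (forall a b, X a b = - X (inv_idx b) (inv_idx a)) (X \in g).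
Proof.
apply: (iffP (lie_preservingP Jform_sq X)) => [H a b|H].
  have -> : X a b = X^T b a by rewrite mxE.
  by rewrite H mxE mulEJ mulJE.
by apply/matrixP => a b; rewrite mxE H [RHS]mxE mulEJ mulJE.
Qed.

Lemma trmx_gso X : (X^T \in g) = (X \in g).
Proof.
by apply/gsoP/gsoP => H a b; have := H b a; rewrite !mxE.
Qed.

(** The component of Z of ad h-eigenvalue 2 (x - y), with two natural numbers in place of an
    integer. *)
Definition graded x y Z : 'M[C]_n := \matrix_(a, b) (Z a b *+ (level a + x == level b + y)%N).

Lemma graded_gso x y Z : Z \in g -> graded x y Z \in g.
Proof.
move/gsoP=> H; apply/gsoP => a b; rewrite !mxE H mulNrn; congr (- (_ *+ nat_of_bool _)).
by have := level_inv a; have := level_inv b; lia.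
Qed.

Lemma hmE : hm C N m = diag_mx (\row_a (2 * m%:R - 2 * (level a)%:R)).
Proof.
apply/matrixP => a b; rewrite /hm.
case: (split_ordP a) => i ->; case: (split_ordP b) => j ->;
  rewrite ?block_mxEul ?block_mxEur ?block_mxEdl ?block_mxEdr !mxE ?levell ?levelr ?subrr ?mul0rn //.
  by rewrite eq_rlshift.
by rewrite (inj_eq (@rshift_inj _ _)) !natrM.
Qed.

Lemma lie_hmE Z a b : lie (hm C N m) Z a b = (2 * (level b)%:R - 2 * (level a)%:R) * Z a b.
Proof. by rewrite /lie hmE mul_diag_mx mul_mx_diag !mxE; ring. Qed.

Lemma leigen_hmE c Z a b :
  (ad (hm C N m) - c *: \1%VF)%VF Z a b = (2 * (level b)%:R - 2 * (level a)%:R - c) * Z a b.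
Proof.
rewrite add_lfunE opp_lfunE scale_lfunE id_lfunE adE [LHS]mxE [(- (c *: Z)) a b]mxE [(c *: Z) a b]mxE lie_hmE; ring.
Qed.

Lemma mnegP X : reflect (X \in g /\ forall a b, X a b != 0 -> (level b < level a)%N) (X \in mneg C N m).
Proof.
apply: (iffP idP).
  rewrite /mneg; elim: (4 * m)%N X => [|k IHk] X.
    by rewrite big_geq // memv0 => /eqP ->; split=> [|a b]; rewrite ?mem0v // mxE eqxx.
  rewrite big_nat_recr //= => /memv_addP[Y /IHk[Yg YP] [Z ZP ->]].
  move: ZP; rewrite memv_cap => /andP[Zg]; rewrite memv_ker => /eqP ZP.
  split=> [|a b]; first by rewrite memvD.
  rewrite mxE; have [->|/YP //] := eqVneq (Y a b) 0; rewrite add0r.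
  move/matrixP: ZP => /(_ a b); rewrite leigen_hmE [RHS]mxE opprK => /eqP.
  rewrite mulf_eq0 => /orP[H _|-> //].
  have H2 : ((2 * level b + k.+1)%N%:R : C) = (2 * level a)%N%:R.
    by move/eqP: H; rewrite natrD !natrM => H; apply/eqP; rewrite -subr_eq0 -[X in _ == X]H; apply/eqP; ring.
  by move/eqP: H2; rewrite eqr_nat; lia.
move=> [Xg XP].
(* The summand d has eigenvalue - 2 (d + 1). Levels lie between 0 and 2m, so these summands exhaust
   X. *)
have -> : X = \sum_(0 <= d < 2 * m) graded 0 d.+1 X.
  apply/matrixP => a b; rewrite summxE.
  have [Xab0|/XP ab] := eqVneq (X a b) 0.
    by rewrite Xab0 big1 // => d _; rewrite mxE Xab0 mul0rn.
  rewrite (bigD1_seq (level a - level b).-1) ?iota_uniq ?mem_index_iota //=; last by have := level_lt a; lia.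
  rewrite mxE big1 ?addr0 => [|d dn]; first by rewrite (_ : _ == _) ?mulr1n //; lia.
  by rewrite mxE (_ : _ == _ = false) ?mulr0n //; lia.
rewrite big_nat; apply: memv_suml => d /andP[_ dm].
have /subvP : (g :&: passmx.leigenspace (ad (hm C N m)) (- (2 * d.+1)%:R) <= mneg C N m)%VS.
  rewrite /mneg (bigD1_seq (2 * d.+1)%N) ?iota_uniq ?mem_index_iota //=; last by lia.
  exact: addvSl.
apply; rewrite memv_cap graded_gso //= memv_ker; apply/eqP/matrixP => a b.
rewrite leigen_hmE !mxE opprK addn0; case: eqP => [->|_]; last by rewrite mulr0n mulr0.
by rewrite mulr1n natrD natrM; ring.
Qed.

End Slice.

Section Centralizers.
Context (C : numClosedFieldType) (N m : nat).
Local Notation q := (2 * m).+1.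
Local Notation n := (N + q)%N.
Local Notation g := (gso C N m).
Local Notation J := (Jform C N m).
Local Notation e := (em C N m).
Local Notation f := (fm C N m).
Implicit Types X Y Z : 'M[C]_n.

Definition low_block (d : 'M[C]_q) : 'M[C]_n := block_mx 0 0 0 d.

Lemma low_block_exp d k : (0 < k)%N -> low_block d ^+ k = low_block (d ^+ k).
Proof.
case: k => // k _; elim: k => [//|k IHk].
rewrite exprS IHk -[_ * _]/(_ *m _) /low_block mulmx_block.
by rewrite !(mul0mx, mulmx0, addr0, add0r) -[d *m _]exprS.
Qed.

Definition al_e (k : nat) : C := (-1) ^+ (m <= k)%N.
Definition al_f (k : nat) : C := (-1) ^+ (m <= k)%N * (k.+1 * (2 * m - k))%:R.

Lemma em_shift : e = low_block (shift_mx m al_e).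
Proof. by []. Qed.

Lemma fm_shift : f^T = low_block (shift_mx m al_f).
Proof.
rewrite /fm tr_block_mx !trmx0 /low_block; congr block_mx; apply/matrixP => k l.
by rewrite !mxE mulrA.
Qed.

Lemma al_e_neq0 k : (k < 2 * m)%N -> al_e k != 0.
Proof. by move=> _; rewrite signr_eq0. Qed.

Lemma al_f_neq0 k : (k < 2 * m)%N -> al_f k != 0.
Proof. by move=> km; rewrite mulf_neq0 ?signr_eq0 // pnatr_eq0 muln_eq0 /= subn_eq0 -ltnNge. Qed.

Lemma sign_sym k : (k < 2 * m)%N -> (-1) ^+ (m <= 2 * m - k.+1)%N = - (-1) ^+ (m <= k)%N :> C.
Proof.
by move=> km; rewrite (_ : (m <= _ - _)%N = ~~ (m <= k)%N); [case: leqP; rewrite /= ?opprK | lia].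
Qed.

Lemma al_e_sym k : (k < 2 * m)%N -> al_e (2 * m - k.+1) = - al_e k.
Proof. exact: sign_sym. Qed.

Lemma al_f_sym k : (k < 2 * m)%N -> al_f (2 * m - k.+1) = - al_f k.
Proof.
move=> km; rewrite /al_f sign_sym // mulNr; congr (- (_ * _%:R)).
have -> : (2 * m - (2 * m - k.+1) = k.+1)%N by lia.
by rewrite mulnC; congr (_ * _)%N; lia.
Qed.

Definition head_part (A : 'M[C]_N) (x : 'cV[C]_N) : 'M[C]_n :=
  block_mx A (x *m (delta_mx 0 ord_max : 'rV_q)) (- ((delta_mx ord0 0 : 'cV_q) *m x^T)) 0.

Lemma exp_odd_gso X k : X \in g -> odd k -> X ^+ k \in g.
Proof.
move=> /(lie_preservingP (Jform_sq C N m)) XT ok; apply/(lie_preservingP (Jform_sq C N m)).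
have trX j : (X ^+ j)^T = (-1) ^+ j *: (J *m X ^+ j *m J).
  elim: j => [|j IHj]; first by rewrite !expr0 trmx1 mulmx1 Jform_sq scale1r.
  rewrite exprSr -[_ * X]/(_ *m X) trmx_mul IHj XT mulNmx -scalemxAr exprS mulN1r scaleNr; congr (- (_ *: _)).
  rewrite -!mulmxA; congr (_ *m _); rewrite [J *m (J *m _)]mulmxA Jform_sq mul1mx !mulmxA.
  by rewrite -[X *m _]exprS exprSr.
by rewrite trX -signr_odd ok expr1 scaleN1r.
Qed.

Section LowBlock.
Context (al : nat -> C).
Hypothesis al0 : forall k, (k < 2 * m)%N -> al k != 0.
Hypothesis al_sym : forall k, (k < 2 * m)%N -> al (2 * m - k.+1) = - al k.
Local Notation E := (low_block (shift_mx m al)).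

Lemma lie_head_part A x : lie E (head_part A x) = 0.
Proof.
rewrite /lie /head_part /low_block !mulmx_block !(mul0mx, mulmx0, addr0, add0r).
have -> : x *m delta_mx 0 ord_max *m shift_mx m al = 0.
  apply/matrixP => i l; rewrite !mxE big1 // => k _; rewrite !mxE big_ord1 !mxE eqxx /=.
  have [->|_] := eqVneq k ord_max; last by rewrite mulr0 mul0r.
  by rewrite /= ltn_eqF ?mul0r ?mulr0 // ltn_ord.
have -> : shift_mx m al *m - (delta_mx ord0 0 *m x^T) = 0.
  apply/matrixP => l i; rewrite !mxE big1 // => k _; rewrite !mxE big_ord1 !mxE eqxx andbT.
  have [->|_] := eqVneq k ord0; last by rewrite mul0r oppr0 mulr0.
  by rewrite /= !mul0r.
by rewrite subrr.
Qed.

Lemma head_part_gso A x : A \in so C N -> head_part A x \in g.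
Proof.
move=> /(lie_preservingP (mul1mx _)) AT; apply/gsoP => a b.
have Aij i j : A i j = - A j i.
  by move/matrixP: AT => /(_ j i); rewrite mul1mx mulmx1 !mxE.
case: (split_ordP a) => i ->; case: (split_ordP b) => j ->; rewrite ?inv_idxl ?inv_idxr /head_part
  ?block_mxEul ?block_mxEur ?block_mxEdl ?block_mxEdr.
- exact: Aij.
- rewrite !mxE !big_ord1 !mxE !eqxx ?andbT /= opprK mulrC; congr (_%:R * _).
  by rewrite -!val_eqE /=; have := ltn_ord j; lia.
- rewrite !mxE !big_ord1 !mxE !eqxx ?andbT /= mulrC; congr (- (_ * _%:R)).
  by rewrite -!val_eqE /=; have := ltn_ord i; lia.
by rewrite !mxE oppr0.
Qed.

Lemma shift_low_block_gso : E \in g.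
Proof.
apply: block_gso => k l; rewrite !mxE /=.
have kl := ltn_ord k; have ll := ltn_ord l.
rewrite (_ : ((2 * m).+1 - k.+1 == ((2 * m).+1 - l.+1).+1)%N = (l == k.+1 :> nat)); last by lia.
case: eqP => [lk|]; last by rewrite !mul0r addr0.
rewrite !mul1r (_ : (2 * m).+1 - l.+1 = 2 * m - k.+1)%N ?al_sym ?subrr //; lia.
Qed.

(** A general weighted shift E covers both e and the transpose of f. Commutation leaves only the
    last column of the upper right block, skewness gives the lower left block from it, and the lower
    right block is a skew element of the commutant of the shift. *)
Lemma centralizer_low_block Z : Z \in g -> lie E Z = 0 ->
  exists A x (c : 'rV[C]_m), A \in so C N /\
    Z = head_part A x + \sum_(k < m) c 0 k *: E ^+ (2 * (m - k)).-1.
Proof.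
move=> Zg; have Zsk := elimT (gsoP Z) Zg.
rewrite -[Z]submxK; set A := ulsubmx Z; set b := ursubmx Z; set c := dlsubmx Z; set d := drsubmx Z.
rewrite /lie /low_block !mulmx_block !(mul0mx, mulmx0, addr0, add0r) opp_block_mx add_block_mx.
move/eqP; rewrite block_mx_eq0 !sub0r !oppr_eq0 => /and4P[_ /eqP bE _ /eqP/subr0_eq cd].
have [c' dE] : exists c' : 'rV[C]_m, d = \sum_(k < m) c' 0 k *: shift_mx m al ^+ (2 * (m - k)).-1.
  apply: shift_commutant_skew => // k l; rewrite !mxE Zsk !inv_idxr //.
exists A, (col ord_max b), c'; split.
  apply/(lie_preservingP (mul1mx _)); rewrite mul1mx mulmx1; apply/matrixP => i j.
  by rewrite !mxE Zsk !inv_idxl.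
have -> : \sum_(k < m) c' 0 k *: E ^+ (2 * (m - k)).-1 = low_block d.
  rewrite dE /low_block -[RHS]/(low_block _).
  have -> (F : 'I_m -> 'M[C]_q) : low_block (\sum_k F k) = \sum_k low_block (F k).
    rewrite /low_block; elim/big_ind2: _ => [|x1 x2 y1 y2 <- <-|//]; first by rewrite block_mx_const.
    by rewrite add_block_mx !addr0.
  apply: eq_bigr => k _; rewrite low_block_exp; last by have := ltn_ord k; lia.
  by rewrite /low_block scale_block_mx !scaler0.
have cE k i : c k i = - b i (rev_ord k) by rewrite !mxE Zsk inv_idxl inv_idxr.
clearbody b c.
have bx : b = col ord_max b *m delta_mx 0 ord_max.
  apply/matrixP => i k; rewrite mxE big_ord1 mxE mxE eqxx /=.
  have [->|kmax] := eqVneq k ord_max; first by rewrite mulr1.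
  have k1 : (k < 2 * m)%N by move: kmax; rewrite -val_eqE /=; have := ltn_ord k; lia.
  move/matrixP: bE => /(_ i (Ordinal (k1 : (k.+1 < q)%N))); rewrite mxE (bigD1 k) //= !mxE eqxx mul1r.
  rewrite big1 ?addr0 => [/eqP|j jk]; last first.
    by rewrite !mxE /= eqSS [_ == j :> nat]eq_sym -[j == k :> nat]/(j == k) (negPf jk) mul0r mulr0.
  by rewrite mulr0 mulf_eq0 (negPf (al0 k1)) orbF => /eqP.
rewrite /head_part /low_block add_block_mx addr0 -bx !addr0 add0r; congr block_mx.
apply/matrixP => k i; rewrite !mxE big_ord1 !mxE eqxx andbT cE.
move/matrixP: bx => /(_ i (rev_ord k)); rewrite !mxE big_ord1 !mxE eqxx /= => ->.
rewrite mulrC; congr (- (_%:R * _)).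
by rewrite -!val_eqE /=; have := ltn_ord k; lia.
Qed.

Lemma centralizer_low_block_mem A x (c : 'rV[C]_m) : A \in so C N ->
  head_part A x + \sum_(k < m) c 0 k *: E ^+ (2 * (m - k)).-1 \in (g :&: lker (ad E))%VS.
Proof.
move=> Aso; have Eg := shift_low_block_gso.
rewrite memv_cap memvD ?head_part_gso //=.
  rewrite memv_ker linearD /= adE lie_head_part add0r linear_sum big1 //= => k _.
  by rewrite linearZ /= adE /lie -[E *m _]exprS -[_ *m E]exprSr subrr scaler0.
apply: memv_suml => k _; rewrite memvZ // exp_odd_gso //.
by have := ltn_ord k; lia.
Qed.

End LowBlock.

Lemma iotabarE (w : W C N m) :
  iotabar w = head_part (vsval w.1.1) w.1.2 + \sum_(k < m) w.2 0 k *: e ^+ (2 * (m - k)).-1.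
Proof. by case: w => [[A x] c]. Qed.

Lemma zcentP Z : reflect (exists w : W C N m, Z = iotabar w) (Z \in zcent C N m).
Proof.
apply: (iffP idP) => [|[w ->]]; last first.
  rewrite iotabarE em_shift; apply: centralizer_low_block_mem; [exact: al_e_sym | exact: subvsP].
rewrite memv_cap memv_ker adE em_shift => /andP[Zg /eqP].
move/(centralizer_low_block al_e_neq0 al_e_sym Zg) => [A [x [c [Aso ->]]]].
by exists (vsproj (so C N) A, x, c); rewrite iotabarE /= vsprojK.
Qed.

Definition slice_elt (a : 'M[C]_N) (v : 'cV[C]_N) (c : 'rV[C]_m) : 'M[C]_n :=
  block_mx a (v *m (delta_mx 0 ord0 : 'rV_q)) (- ((delta_mx ord_max 0 : 'cV_q) *m v^T)) 0
  + \sum_(k < m) c 0 k *: f ^+ (2 * (m - k)).-1.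

Lemma trmx_exp (K : comNzRingType) p (A : 'M[K]_p) k : (A ^+ k)^T = A^T ^+ k.
Proof.
elim: k => [|k IHk]; first by rewrite !expr0 trmx1.
by rewrite exprSr exprS -[_ * A]/(_ *m A) trmx_mul IHk.
Qed.

Lemma slice_elt_tr a v c : (slice_elt a v c)^T =
  head_part a^T (- v) + \sum_(k < m) c 0 k *: f^T ^+ (2 * (m - k)).-1.
Proof.
rewrite /slice_elt linearD /= tr_block_mx; congr (_ + _).
  rewrite trmx0 /head_part; congr block_mx.
    by rewrite [(- _)^T]linearN /= trmx_mul trmxK trmx_delta mulNmx.
  by rewrite trmx_mul trmx_delta [(- v)^T]linearN /= mulmxN opprK.
by rewrite linear_sum; apply: eq_bigr => k _; rewrite /= linearZ /= trmx_exp.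
Qed.

Lemma so_tr (A : 'M[C]_N) : (A^T \in so C N) = (A \in so C N).
Proof.
apply/(lie_preservingP (mul1mx _))/(lie_preservingP (mul1mx _)); rewrite !mul1mx !mulmx1 trmxK.
  by move=> H; rewrite [in RHS]H opprK.
by move=> ->; rewrite opprK.
Qed.

(** Transposition carries Ker (ad f) to the centralizer of the transpose of f, a weighted shift of
    the same kind as e. *)
Lemma kerfP Y : reflect (exists a v c, a \in so C N /\ Y = slice_elt a v c) (Y \in kerf C N m).
Proof.
have -> : (Y \in kerf C N m) = (Y^T \in (g :&: lker (ad f^T))%VS).
  rewrite !memv_cap trmx_gso !memv_ker !adE; congr (_ && _).
  have -> : lie f^T Y^T = - (lie f Y)^T by rewrite /lie linearB /= !trmx_mul opprB.
  by rewrite oppr_eq0 trmx_eq0.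
apply: (iffP idP) => [|[a [v [c [aso ->]]]]]; last first.
  rewrite slice_elt_tr fm_shift; apply: centralizer_low_block_mem; first exact: al_f_sym.
  by rewrite so_tr.
rewrite memv_cap memv_ker adE fm_shift => /andP[Zg /eqP].
move/(centralizer_low_block al_f_neq0 al_f_sym Zg) => [A [x [c [Aso H]]]].
exists A^T, (- x), c; rewrite so_tr; split=> //.
by apply: trmx_inj; rewrite slice_elt_tr trmxK opprK fm_shift.
Qed.

End Centralizers.

(** * Evaluation at points *)

Section Pairing.
Context (K : fieldType) (vT : vectType K) (U W : {vspace vT}).
Context (T : vT -> {scalar vT}).
Hypothesis T_linear : forall w, linear_for *%R (T^~ w).

Let Tl w : {scalar vT} := HB.pack (T^~ w) (GRing.isLinear.Build K vT K *%R (T^~ w) (@T_linear w)).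

Let TZ a u w : T (a *: u) w = a * T u w.
Proof. exact: (scalarZ (Tl w)). Qed.

Let Tsum (I : finType) (F : I -> vT) w : T (\sum_i F i) w = \sum_i T (F i) w.
Proof. exact: (linear_sum (Tl w)). Qed.

Let gram : 'M_(\dim U, \dim W) := \matrix_(i, j) T (vbasis U)`_i (vbasis W)`_j.

(** The Gram matrix has independent rows. This realizes every evaluation of the polynomial ring
    [Sym U] by a vector of W. *)
Lemma dual_point : {in U, forall u, {in W, forall w, T u w = 0} -> u = 0} ->
  forall v : 'I_(\dim U) -> K, exists2 w, w \in W & forall i : 'I_(\dim U), T (vbasis U)`_i w = v i.
Proof.
move=> nd v; have /row_freeP[B gB] : row_free gram.
  apply: inj_row_free => x xg; have x0 : \sum_i x 0 i *: (vbasis U)`_i = 0.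
    apply: nd => [|w wW].
      by apply: memv_suml => i _; rewrite memvZ // vbasis_mem // mem_nth // size_tuple.
    rewrite (coord_vbasis wW) linear_sum big1 //= => j _; rewrite linearZ /=.
    rewrite Tsum.
    move/matrixP: xg => /(_ 0 j); rewrite !mxE => xg; rewrite -[RHS](mulr0 (coord (vbasis W) j w)) -[in RHS]xg.
    by congr (_ * _); apply: eq_bigr => i _; rewrite [gram _ _]mxE TZ.
  apply/rowP => i; rewrite [RHS]mxE -(coord_sum_free (x 0) i (basis_free (vbasisP U))) x0 linear0 //.
pose c := B *m \col_i v i; exists (\sum_j c j 0 *: (vbasis W)`_j).
  by apply: memv_suml => j _; rewrite memvZ // vbasis_mem // mem_nth // size_tuple.
move=> i; have : (gram *m c) i 0 = v i by rewrite mulmxA gB mul1mx mxE.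
move=> <-; rewrite mxE linear_sum; apply: eq_bigr => j _ /=.
by rewrite linearZ [gram _ _]mxE mulrC.
Qed.

Lemma riesz_mem (B : vT -> vT -> K) phi : riesz B U W phi \in U.
Proof. by apply: memv_suml => i _; rewrite memvZ // vbasis_mem // mem_nth // size_tuple. Qed.

(** Nondegeneracy on the side of W makes the Gram matrix row-full, so that [pinvmx] gives a true
    solution. B is compared with the bilinear T only on U and W because the Killing form is a trace
    form only on g. *)
Lemma rieszE (B : vT -> vT -> K) (phi : {scalar vT}) :
  {in U & W, forall u w, B u w = T u w} ->
  {in W, forall w, {in U, forall u, T u w = 0} -> w = 0} ->
  {in W, forall w, T (riesz B U W phi) w = phi w}.
Proof.
move=> BT nd w wW; pose gramB : 'M_(\dim U, \dim W) := \matrix_(i, j) B (vbasis U)`_i (vbasis W)`_j.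
have gBE : gramB = gram.
  by apply/matrixP => i j; rewrite !mxE BT // vbasis_mem // mem_nth // size_tuple.
have full : row_full gram.
  rewrite -[row_full _]/(\rank gram == _) -mxrank_tr -[_ == _]/(row_free gram^T).
  apply: inj_row_free => x xg; have x0 : \sum_j x 0 j *: (vbasis W)`_j = 0.
    apply: nd => [|u uU].
      by apply: memv_suml => i _; rewrite memvZ // vbasis_mem // mem_nth // size_tuple.
    rewrite (coord_vbasis uU) Tsum big1 //= => i _; rewrite TZ.
    rewrite linear_sum /=; move/matrixP: xg => /(_ 0 i); rewrite !mxE => xg.
    rewrite -[RHS](mulr0 (coord (vbasis U) i u)) -[in RHS]xg; congr (_ * _).
    by apply: eq_bigr => j _; rewrite linearZ /= !mxE.
  apply/rowP => j; rewrite [RHS]mxE -(coord_sum_free (x 0) j (basis_free (vbasisP W))) x0 linear0 //.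
rewrite /riesz -/gramB gBE; set c : 'rV_(\dim U) := _ *m _.
have cg : c *m gram = \row_j phi (vbasis W)`_j by rewrite /c mulmxKpV // submx_full.
rewrite (coord_vbasis wW) [in RHS]linear_sum linear_sum; apply: eq_bigr => j _ /=.
rewrite !linearZ /=; congr (_ * _); move/matrixP: cg => /(_ 0 j); rewrite !mxE => <-.
rewrite Tsum; apply: eq_bigr => i _.
by rewrite TZ [gram _ _]mxE.
Qed.

End Pairing.

Section TraceForm.
Context (K : comNzRingType) (n : nat) (k : K).

Definition trform (Y X : 'M[K]_n) : K := k * \tr (X *m Y).

Lemma trform_is_linear Y : linear_for *%R (trform Y).
Proof.
by move=> a u v; rewrite /trform mulmxDl -scalemxAl linearP mulrDr mulrCA.
Qed.

HB.instance Definition _ Y := GRing.isLinear.Build K 'M[K]_n K *%R (trform Y) (trform_is_linear Y).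

Lemma trformC X Y : trform X Y = trform Y X.
Proof. by rewrite /trform mxtrace_mulC. Qed.

Lemma trform_linear_r X : linear_for *%R (trform^~ X).
Proof. by move=> a u v; rewrite !(trformC _ X) linearP. Qed.

End TraceForm.

Section Evaluation.
Context (C : numClosedFieldType) (N m : nat) (r : C).
Local Notation q := (2 * m).+1.
Local Notation n := (N + q)%N.
Local Notation g := (gso C N m).
Local Notation J := (Jform C N m).
Local Notation e := (em C N m).
Local Notation f := (fm C N m).
Local Notation zc := (zcent C N m).
Local Notation kf := (kerf C N m).
Implicit Types X Y Z : 'M[C]_n.

(** The ratio of the invariant form to the trace form: r (n - 2) for n = N + 2m + 1, by
    [killing_trace]. *)
Definition kappa : C := r * (N + 2 * m - 1)%:R.

Hypothesis m0 : (0 < m)%N.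
Lemma form_trace X Y : X \in g -> Y \in g -> Defs.form r X Y = trform kappa Y X.
Proof.
move=> Xg Yg; rewrite /Defs.form (killing_trace (Jform_tr C N m) (Jform_sq C N m)) // /trform /kappa mulrA.
by congr (_ * _ * _); rewrite natrB ?addnS ?natrD ?natrM -?natr1; [ring | lia].
Qed.

Lemma trace_nondeg X : X \in g -> (forall Y, Y \in g -> \tr (X *m Y) = 0) -> X = 0.
Proof.
move=> Xg X0; apply/matrixP => a b; rewrite [RHS]mxE.
have := X0 _ (skew_part_mem (Jform_tr C N m) (Jform_sq C N m) (delta_mx b a)).
rewrite mxtrace_skew_part ?Jform_tr ?Jform_sq // => <-.
rewrite /mxtrace (bigD1 a) //= big1 => [|c ca]; last first.
  by rewrite mxE big1 // => d _; rewrite mxE (negPf ca) andbF mulr0.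
rewrite addr0 mxE (bigD1 b) //= big1 => [|c cb]; first by rewrite mxE !eqxx mulr1 addr0.
by rewrite mxE (negPf cb) mulr0.
Qed.

Definition beta p : C := \tr (e ^+ p *m f ^+ p).

Lemma mul_low_block (A B : 'M[C]_q) : low_block N A *m low_block N B = low_block N (A *m B).
Proof. by rewrite /low_block mulmx_block !(mul0mx, mulmx0, addr0, add0r). Qed.

Lemma mxtrace_low_block (A : 'M[C]_q) : \tr (low_block N A) = \tr A.
Proof. by rewrite mxtrace_block mxtrace0 add0r. Qed.

Lemma fm_low_block : f = low_block N (shift_mx m (al_f C m))^T.
Proof. by rewrite -[f]trmxK fm_shift tr_block_mx !trmx0. Qed.

Lemma mxtrace_em_fm p p' : (0 < p)%N -> (0 < p')%N -> \tr (e ^+ p *m f ^+ p') =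
  \sum_(k < q) \sum_(l < q) (shift_mx m (al_e C m) ^+ p) k l * (shift_mx m (al_f C m) ^+ p') k l.
Proof.
move=> p0 p0'; rewrite em_shift fm_low_block !low_block_exp // mul_low_block mxtrace_low_block.
apply: eq_bigr => k _; rewrite mxE; apply: eq_bigr => l _.
by rewrite -trmx_exp [_^T l k]mxE.
Qed.

Lemma mxtrace_em_fm_neq p p' : (0 < p)%N -> (0 < p')%N -> p != p' -> \tr (e ^+ p *m f ^+ p') = 0.
Proof.
move=> p0 p0' pp; rewrite mxtrace_em_fm // big1 // => k _; rewrite big1 // => l _.
rewrite !shift_mx_exp; have [->|lk] := eqVneq (l : nat) (k + p)%N; last by rewrite !mul0r.
by rewrite eqn_add2l (negPf pp) !mul0r mulr0.
Qed.

(** The signs in e and f cancel, so the trace is a natural number, a sum to which the row 0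
    contributes a positive product. *)
Lemma beta_neq0 p : (0 < p <= 2 * m)%N -> beta p != 0.
Proof.
move=> /andP[p0 pm]; rewrite /beta mxtrace_em_fm //.
have -> : \sum_(k < q) \sum_(l < q)
     (shift_mx m (al_e C m) ^+ p) k l * (shift_mx m (al_f C m) ^+ p) k l =
   (\sum_(k < q) \sum_(l < q) (l == k + p :> nat)%N * \prod_(k <= i < k + p) (i.+1 * (2 * m - i)))%N%:R.
  rewrite natr_sum; apply: eq_bigr => k _; rewrite natr_sum; apply: eq_bigr => l _.
  rewrite !shift_mx_exp natrM; case: eqP => _; last by rewrite !mul0r.
  rewrite !mul1r natr_prod -big_split; apply: eq_bigr => i _ /=.
  by rewrite /al_e /al_f mulrA -expr2 sqrr_sign mul1r.
rewrite pnatr_eq0 -lt0n (bigD1 ord0) //= ltn_addr //.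
have pq : (p < q)%N by [].
rewrite (bigD1 (Ordinal pq)) //= ltn_addr // add0n eqxx mul1n.
rewrite big_nat; apply: (big_ind (fun x => 0 < x)%N) => // [x y x0 y0|i /andP[_ ip]]; first by rewrite muln_gt0 x0.
by rewrite muln_gt0 /= subn_gt0; lia.
Qed.

Definition dotp (x v : 'cV[C]_N) : C := \sum_i x i 0 * v i 0.

Lemma mxtrace_rank1 p (x : 'cV[C]_p) (y : 'rV[C]_p) : \tr (x *m y) = \sum_i x i 0 * y 0 i.
Proof. by apply: eq_bigr => i _; rewrite mxE big_ord1. Qed.

Lemma head_part_low_block A x (d : 'M[C]_q) : \tr (head_part m A x *m low_block N d) = 0.
Proof.
rewrite /head_part /low_block mulmx_block !(mul0mx, mulmx0, addr0, add0r).
by rewrite mxtrace_block !mxtrace0 addr0.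
Qed.

Lemma low_block_head_part (d : 'M[C]_q) a b c : \tr (low_block N d *m block_mx a b c 0) = 0.
Proof.
rewrite /low_block mulmx_block !(mul0mx, mulmx0, addr0, add0r).
by rewrite mxtrace_block !mxtrace0 addr0.
Qed.

(** The pairing is diagonal in the three kinds of coordinates; a vector of V_N fills two
    off-diagonal blocks, whence the factor -2. *)
Lemma pairing_slice A x (c : 'rV[C]_m) a v (c' : 'rV[C]_m) :
  \tr ((head_part m A x + \sum_(k < m) c 0 k *: e ^+ (2 * (m - k)).-1) *m slice_elt a v c') =
  \tr (A *m a) - 2 * dotp x v + \sum_(k < m) c 0 k * c' 0 k * beta (2 * (m - k)).-1.
Proof.
have po (k : 'I_m) : (0 < (2 * (m - k)).-1)%N by have := ltn_ord k; lia.
rewrite /slice_elt mulmxDl !mulmxDr !linearD /=.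
rewrite [X in _ + X + _](_ : _ = 0); last first.
  rewrite mulmx_sumr linear_sum big1 //= => k _; rewrite -scalemxAr linearZ /= fm_low_block low_block_exp //.
  by rewrite head_part_low_block mulr0.
rewrite addr0; congr (_ + _).
  rewrite /head_part mulmx_block mxtrace_block mul0mx addr0 linearD /= -addrA; congr (_ + _).
  have delta11 (k : 'I_q) : delta_mx 0 k *m delta_mx k 0 = 1%:M :> 'M[C]_1.
    by rewrite mul_delta_mx; apply/matrixP => i j; rewrite !ord1 !mxE.
  have sw p p' (x1 : 'M[C]_(p, 1)) (k : 'I_q) (y1 : 'M[C]_(1, p')) :
      x1 *m delta_mx 0 k *m (delta_mx k 0 *m y1) = x1 *m y1.
    by rewrite mulmxA -[x1 *m _ *m _]mulmxA delta11 mulmx1.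
  rewrite mulmxN mulNmx !raddfN /= sw mxtrace_rank1 [\tr (_ *m (v *m _))]mxtrace_mulC sw mxtrace_rank1.
  have -> : \sum_i v i 0 * x^T 0 i = dotp x v by apply: eq_bigr => i _; rewrite mxE mulrC.
  have -> : \sum_i x i 0 * v^T 0 i = dotp x v by apply: eq_bigr => i _; rewrite mxE.
  ring.
rewrite [X in X + _](_ : _ = 0); last first.
  rewrite mulmx_suml linear_sum big1 //= => k _; rewrite -scalemxAl linearZ /= em_shift low_block_exp //.
  by rewrite low_block_head_part mulr0.
rewrite add0r mulmx_suml linear_sum; apply: eq_bigr => k _ /=.
rewrite mulmx_sumr linear_sum (bigD1 k) //= big1 ?addr0 => [|l lk].
  by rewrite -scalemxAl -scalemxAr !linearZ /= mulrA.
rewrite -scalemxAl -scalemxAr !linearZ /= mxtrace_em_fm_neq ?mulr0 //.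
apply: contraNN lk => /eqP H; apply/eqP/val_inj => /=; have := ltn_ord l; have := ltn_ord k; lia.
Qed.

Lemma delta_skew_so (i j : 'I_N) : delta_mx i j - delta_mx j i \in so C N.
Proof.
apply/(lie_preservingP (mul1mx _)); rewrite mul1mx mulmx1 linearB /= !trmx_delta.
by rewrite opprB.
Qed.

Lemma mem_soP (A : 'M[C]_N) : reflect (A^T = - A) (A \in so C N).
Proof. by apply: (iffP (lie_preservingP (mul1mx _) _)); rewrite mul1mx mulmx1. Qed.

Lemma so_trace_nondeg (A : 'M[C]_N) : A \in so C N ->
  (forall i j, \tr (A *m (delta_mx i j - delta_mx j i)) = 0) -> A = 0.
Proof.
move=> /mem_soP AT A0; apply/matrixP => i j; have := A0 j i.
have tr_delta a b : \tr (A *m delta_mx a b) = A b a.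
  rewrite mxtrace_mulC /mxtrace (bigD1 a) //= big1 => [|c ca]; last first.
    by rewrite mxE big1 // => d _; rewrite mxE (negPf ca) mul0r.
  rewrite addr0 mxE (bigD1 b) //= big1 => [|c cb]; first by rewrite mxE !eqxx mul1r addr0.
  by rewrite mxE (negPf cb) andbF mul0r.
rewrite mulmxBr linearB /= !tr_delta.
have -> : A j i = - A i j by move/matrixP: AT => /(_ i j); rewrite !mxE.
by rewrite opprK -mulr2n => /eqP; rewrite mulrn_eq0 /= mxE => /eqP.
Qed.

Lemma slice_elt_kerf a v (c : 'rV[C]_m) : a \in so C N -> slice_elt a v c \in kf.
Proof. by move=> aso; apply/kerfP; exists a, v, c. Qed.

Lemma dotp_deltar x i : dotp x (delta_mx i 0) = x i 0.
Proof.
rewrite /dotp (bigD1 i) //= mxE !eqxx mulr1 big1 ?addr0 // => k ki.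
by rewrite mxE (negPf ki) mulr0.
Qed.

Lemma dotpC x v : dotp x v = dotp v x.
Proof. by apply: eq_bigr => i _; rewrite mulrC. Qed.

Lemma dotp0 x : dotp x 0 = 0.
Proof. by rewrite /dotp big1 // => i _; rewrite mxE mulr0. Qed.

Lemma trace_zcent_kerf_nondegl Z : Z \in zc -> (forall Y, Y \in kf -> \tr (Z *m Y) = 0) -> Z = 0.
Proof.
move=> /zcentP[[[A x] c] ->] Z0; have Aso := subvsP A.
have sum0 (F : 'I_m -> C) : (forall k, F k = 0) -> \sum_k F k = 0 by move=> F0; rewrite big1.
have H a v (c' : 'rV[C]_m) : a \in so C N -> \tr (vsval A *m a) - 2 * dotp x v +
   \sum_(k < m) c 0 k * c' 0 k * beta (2 * (m - k)).-1 = 0.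
  by move=> aso; rewrite -[RHS](Z0 _ (slice_elt_kerf v c' aso)) iotabarE; apply/esym/pairing_slice.
have A0 : vsval A = 0.
  apply: so_trace_nondeg => // i j; rewrite -[RHS](H _ 0 0 (delta_skew_so i j)) dotp0 mulr0 subr0.
  by rewrite sum0 ?addr0 // => k; rewrite mxE mulr0 mul0r.
have x0 : x = 0.
  apply/colP => i; have := H 0 (delta_mx i 0) 0 (mem0v _); rewrite mulmx0 mxtrace0 dotp_deltar sum0.
    by rewrite addr0 sub0r => /eqP; rewrite oppr_eq0 mulf_eq0 pnatr_eq0 /= mxE => /eqP.
  by move=> k; rewrite mxE mulr0 mul0r.
have c0 : c = 0.
  apply/rowP => k; have := H 0 0 (delta_mx 0 k) (mem0v _).
  rewrite mulmx0 mxtrace0 dotp0 mulr0 subrr add0r (bigD1 k) //= big1 => [|l lk].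
    rewrite mxE !eqxx mulr1 addr0 => /eqP; rewrite mulf_eq0 [in RHS]mxE => /orP[/eqP //|].
    have km := ltn_ord k; by rewrite (negPf (beta_neq0 _)) //; lia.
  by rewrite mxE (negPf lk) andbF mulr0 mul0r.
rewrite iotabarE /= A0 x0 c0 big1 => [|k _]; last by rewrite mxE scale0r.
by rewrite /head_part mul0mx trmx0 mulmx0 oppr0 block_mx_const addr0.
Qed.

Lemma trace_zcent_kerf_nondegr Y : Y \in kf -> (forall Z, Z \in zc -> \tr (Z *m Y) = 0) -> Y = 0.
Proof.
move=> /kerfP[a [v [c' [aso ->]]]] Y0.
have sum0 (F : 'I_m -> C) : (forall k, F k = 0) -> \sum_k F k = 0 by move=> F0; rewrite big1.
have H A x (c : 'rV[C]_m) : A \in so C N -> \tr (A *m a) - 2 * dotp x v +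
   \sum_(k < m) c 0 k * c' 0 k * beta (2 * (m - k)).-1 = 0.
  move=> Aso; have <- := pairing_slice A x c a v c'; apply: Y0; apply/zcentP.
  by exists (vsproj (so C N) A, x, c); rewrite iotabarE /= vsprojK.
have a0 : a = 0.
  apply: so_trace_nondeg => // i j; rewrite mxtrace_mulC -[RHS](H _ 0 0 (delta_skew_so i j)) dotpC dotp0 mulr0 subr0.
  by rewrite sum0 ?addr0 // => k; rewrite mxE mul0r mul0r.
have v0 : v = 0.
  apply/colP => i; have := H 0 (delta_mx i 0) 0 (mem0v _); rewrite mul0mx mxtrace0 dotpC dotp_deltar sum0.
    by rewrite addr0 sub0r => /eqP; rewrite oppr_eq0 mulf_eq0 pnatr_eq0 /= mxE => /eqP.
  by move=> k; rewrite mxE mul0r mul0r.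
have c0 : c' = 0.
  apply/rowP => k; have := H 0 0 (delta_mx 0 k) (mem0v _).
  rewrite mul0mx mxtrace0 dotpC dotp0 mulr0 subrr add0r (bigD1 k) //= big1 => [|l lk].
    rewrite mxE !eqxx mul1r addr0 => /eqP; rewrite mulf_eq0 [in RHS]mxE => /orP[/eqP //|].
    have km := ltn_ord k; by rewrite (negPf (beta_neq0 _)) //; lia.
  by rewrite mxE (negPf lk) andbF !mul0r.
rewrite /slice_elt a0 v0 c0 big1 => [|k _]; last by rewrite mxE scale0r.
by rewrite mul0mx trmx0 mulmx0 oppr0 block_mx_const addr0.
Qed.

Lemma zcent_gso Z : Z \in zc -> Z \in g.
Proof. by rewrite memv_cap => /andP[]. Qed.

Lemma kerf_gso Y : Y \in kf -> Y \in g.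
Proof. by rewrite memv_cap => /andP[]. Qed.

Hypothesis kappa0 : kappa != 0.

Definition evz Y (p : Sz C N m) : C := symev (trform kappa Y) p.
Definition evg X (p : Sg C N m) : C := symev (trform kappa X) p.

HB.instance Definition _ Y := GRing.LRMorphism.copy (evz Y) (@meval _ C (fun i : 'I_(\dim zc) => trform kappa Y (vbasis zc)`_i)).
HB.instance Definition _ Y := GRing.LRMorphism.copy (evg Y) (@meval _ C (fun i : 'I_(\dim g) => trform kappa Y (vbasis g)`_i)).

(** By [dual_point], every point of the affine space with coordinate ring [Sz] comes from some Y in
    Ker (ad f), so [mpoly_vanish] applies. *)
Lemma slice_separation (p : Sz C N m) : (forall Y, Y \in kf -> evz Y p = 0) -> p = 0.
Proof.
move=> p0; apply: mpoly_vanish => v.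
have [||Y Ykf Yv] := @dual_point C _ zc kf (fun u => trform kappa u) _ _ v.
- exact: trform_linear_r.
- move=> Z Zz Z0; apply: (trace_zcent_kerf_nondegl Zz) => Y Ykf; have /eqP := Z0 Y Ykf.
  by rewrite /trform mulf_eq0 (negPf kappa0) mxtrace_mulC => /eqP.
by rewrite -[RHS](p0 Y) //; apply: meval_eq => i; rewrite -Yv; apply: trformC.
Qed.

Lemma evz_symv Y Z : Z \in zc -> evz Y (symv zc Z) = kappa * \tr (Z *m Y).
Proof. by move=> Zz; rewrite /evz symev_symv. Qed.

Lemma evg_symv X Z : Z \in g -> evg X (symv g Z) = kappa * \tr (Z *m X).
Proof. by move=> Zz; rewrite /evg symev_symv. Qed.

Lemma evz_slice_linear (phi : {scalar 'M[C]_n}) (psi : 'M[C]_n -> C) Y : Y \in kf ->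
  {in kf, psi =1 phi} -> evz Y (slice_linear r psi) = phi Y.
Proof.
move=> Ykf pp; rewrite /slice_linear evz_symv ?riesz_mem //.
have -> : riesz (Defs.form r) zc kf psi = riesz (Defs.form r) zc kf phi.
  rewrite /riesz (_ : \row_j psi _ = \row_j phi (vbasis kf)`_j) //.
  by apply/rowP => j; rewrite !mxE pp // vbasis_mem // mem_nth // size_tuple.
rewrite -[LHS]/(trform kappa Y _) trformC; apply: (@rieszE C _ zc kf (fun u => trform kappa u)) => //.
- exact: trform_linear_r.
- by move=> u w /zcent_gso ug /kerf_gso wg; rewrite form_trace // trformC.
move=> w wkf w0; apply: (trace_zcent_kerf_nondegr wkf) => Z Zz; have /eqP := w0 Z Zz.
by rewrite /trform mulf_eq0 (negPf kappa0) mxtrace_mulC => /eqP.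
Qed.

Lemma evz_restrict Y p : Y \in kf -> evz Y (Defs.restrict r p) = evg (e + Y) p.
Proof.
move=> Ykf; rewrite /evz /symev /Defs.restrict comp_mpoly_meval; apply: meval_eq => i.
have bg : (vbasis g)`_i \in g by rewrite vbasis_mem // mem_nth // size_tuple.
have eg := @em_gso C N m.
rewrite tnth_mktuple -[LHS]/(evz Y _) rmorphD /= (@evz_slice_linear (trform kappa (vbasis g)`_i)) //.
  rewrite [evz Y _]mevalC form_trace // [trform kappa e _]trformC -linearD /=.
  exact: trformC.
by move=> w /kerf_gso wg; rewrite form_trace // trformC.
Qed.

Definition entry (a b : 'I_n) X : C := X a b.

Lemma entry_is_linear a b : linear_for *%R (entry a b).
Proof. by move=> c u v; rewrite /entry !mxE. Qed.

HB.instance Definition _ a b := GRing.isLinear.Build C 'M[C]_n C *%R (entry a b) (entry_is_linear a b).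

Lemma evz_slice_point Y : Y \in kf -> map_mx (evz Y) (slice_point N m r) = e + Y.
Proof.
move=> Ykf; apply/matrixP => a b; rewrite !mxE rmorphD /= [evz Y _%:MP]mevalC; congr (_ + _).
exact: (@evz_slice_linear (entry a b)).
Qed.

Lemma evz_Theta Y k : Y \in kf -> evz Y (Theta N m r k) = (det1X (e + Y))`_(2 * (m - k)).
Proof. by move=> Ykf; rewrite /Theta coef_det1X_map evz_slice_point. Qed.

(** The tautological point of g: the entry (a, b) of X is tr (X E_ba), a linear function represented
    in g by the projection of E_ba divided by kappa. *)
Definition gpoint : 'M[Sg C N m]_n :=
  \matrix_(a, b) symv g (kappa^-1 *: skew_part J (delta_mx b a)).

Lemma gpoint_mem a b : kappa^-1 *: skew_part J (delta_mx b a) \in g.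
Proof. by rewrite memvZ // skew_part_mem // ?Jform_tr ?Jform_sq. Qed.

Lemma mxtrace_mul_delta X a b : \tr (X *m delta_mx b a) = X a b.
Proof.
rewrite /mxtrace (bigD1 a) //= big1 => [|c ca]; last first.
  by rewrite mxE big1 // => d _; rewrite mxE (negPf ca) andbF mulr0.
rewrite addr0 mxE (bigD1 b) //= big1 => [|c cb]; first by rewrite mxE !eqxx mulr1 addr0.
by rewrite mxE (negPf cb) mulr0.
Qed.

Lemma trform_gpoint X a b : X \in g -> kappa * \tr (kappa^-1 *: skew_part J (delta_mx b a) *m X) = X a b.
Proof.
move=> Xg; rewrite -scalemxAl mxtraceZ mulVKf // mxtrace_mulC mxtrace_skew_part ?Jform_tr ?Jform_sq //.
exact: mxtrace_mul_delta.
Qed.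

Lemma evg_gpoint X : X \in g -> map_mx (evg X) gpoint = X.
Proof.
by move=> Xg; apply/matrixP => a b; rewrite !mxE evg_symv ?gpoint_mem // trform_gpoint.
Qed.

End Evaluation.

(** * Gradients and Hamiltonian vector fields *)

Section HamiltonianFields.
Context (C : numClosedFieldType) (N m : nat) (r : C).
Local Notation q := (2 * m).+1.
Local Notation n := (N + q)%N.
Local Notation g := (gso C N m).
Local Notation Sg := (Sg C N m).
Local Notation kappa := (kappa N m r).
Local Notation evg := (@evg C N m r).
Local Notation gpoint := (gpoint N m r).
Implicit Types (X Y Z : 'M[C]_n) (p : Sg).
Hypothesis m0 : (0 < m)%N.
Hypothesis kappa0 : kappa != 0.

Let bg (i : 'I_(\dim g)) : (vbasis g)`_i \in g.
Proof. by rewrite vbasis_mem // mem_nth // size_tuple. Qed.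

Let JJ := Jform_sq C N m.

(** The differential at X as an element of g: the derivative of p in the direction Z is kappa times
    the trace of [gradg X p] and Z. *)
Definition gradg X p : 'M[C]_n := \sum_i evg X p^`M(i) *: (vbasis g)`_i.

Lemma gradg_mem X p : gradg X p \in g.
Proof. by apply: memv_suml => i _; rewrite memvZ. Qed.

Lemma gradgM X p p' : gradg X (p * p') = evg X p' *: gradg X p + evg X p *: gradg X p'.
Proof.
rewrite /gradg !scaler_sumr -big_split; apply: eq_bigr => i _ /=.
by rewrite mderivM rmorphD !rmorphM /= !scalerA -scalerDl mulrC.
Qed.

Lemma gradg_is_linear X : linear (gradg X).
Proof.
move=> a p p'; rewrite /gradg scaler_sumr -big_split; apply: eq_bigr => i _ /=.
by rewrite linearP /= linearP /= scalerDl scalerA.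
Qed.

HB.instance Definition _ X := GRing.isLinear.Build C Sg 'M[C]_n _ (gradg X) (gradg_is_linear X).

Lemma gradg_symv X u : u \in g -> gradg X (symv g u) = u.
Proof.
move=> ug; rewrite [RHS](coord_vbasis ug); apply: eq_bigr => i _.
by rewrite mderiv_symv [evg _ _]mevalC.
Qed.

Lemma evg_bracket X p p' : X \in g ->
  evg X (bracket_g p p') = kappa * \tr (lie (gradg X p) (gradg X p') *m X).
Proof.
move=> Xg; rewrite /bracket_g /biderivation rmorph_sum /=.
have lieE : lie (gradg X p) (gradg X p') =
   \sum_i \sum_j (evg X p^`M(i) * evg X p'^`M(j)) *: lie (vbasis g)`_i (vbasis g)`_j.
  rewrite /lie /gradg mulmx_suml mulmx_sumr -sumrB; apply: eq_bigr => i _.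
  rewrite -scalemxAl -scalemxAr -scalerBr mulmx_sumr mulmx_suml -sumrB scaler_sumr.
  by apply: eq_bigr => j _; rewrite -scalemxAl -scalemxAr -scalerBr scalerA.
rewrite lieE mulmx_suml linear_sum mulr_sumr; apply: eq_bigr => i _ /=.
rewrite rmorph_sum mulmx_suml linear_sum mulr_sumr; apply: eq_bigr => j _ /=.
rewrite !rmorphM /= evg_symv; last exact: lie_mem (bg _) (bg _).
by rewrite -scalemxAl linearZ /= mulrCA.
Qed.

Lemma g_separation p : (forall X, X \in g -> evg X p = 0) -> p = 0.
Proof.
move=> p0; apply: mpoly_vanish => v.
have [||X Xg Xv] := @dual_point C _ g g (fun u => trform kappa u) _ _ v.
- exact: trform_linear_r.
- move=> Z Zg Z0; apply: trace_nondeg => // Y Yg; have /eqP := Z0 Y Yg.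
  by rewrite /trform mulf_eq0 (negPf kappa0) mxtrace_mulC => /eqP.
by rewrite -[RHS](p0 X) //; apply: meval_eq => i; rewrite -Xv; apply: trformC.
Qed.

Definition hamilton xi p : Sg := bracket_g (symv g xi) p.

Lemma hamiltonE xi p : hamilton xi p =
  \sum_i \sum_j (coord (vbasis g) i xi)%:MP * p^`M(j) * symv g (lie (vbasis g)`_i (vbasis g)`_j).
Proof. by apply: eq_bigr => i _; apply: eq_bigr => j _; rewrite mderiv_symv. Qed.

Lemma hamilton_is_linear xi : linear (hamilton xi).
Proof.
move=> a p p'; rewrite !hamiltonE scaler_sumr -big_split; apply: eq_bigr => i _ /=.
rewrite scaler_sumr -big_split; apply: eq_bigr => j _ /=.
by rewrite linearP /= mulrDr mulrDl -scalerAr -scalerAl.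
Qed.

HB.instance Definition _ xi := GRing.isLinear.Build C Sg Sg _ (hamilton xi) (hamilton_is_linear xi).

Lemma hamiltonM xi p p' : hamilton xi (p * p') = hamilton xi p * p' + p * hamilton xi p'.
Proof.
rewrite !hamiltonE mulr_suml mulr_sumr -big_split; apply: eq_bigr => i _ /=.
rewrite mulr_suml mulr_sumr -big_split; apply: eq_bigr => j _ /=.
by rewrite mderivM; ring.
Qed.

Lemma evg_hamilton X xi p : X \in g -> xi \in g ->
  evg X (hamilton xi p) = kappa * \tr (lie xi (gradg X p) *m X).
Proof. by move=> Xg xig; rewrite /hamilton evg_bracket // gradg_symv. Qed.

Lemma hamilton_symv xi u : xi \in g -> u \in g -> hamilton xi (symv g u) = symv g (lie xi u).
Proof.
move=> xig ug; apply/eqP; rewrite -subr_eq0; apply/eqP; apply: g_separation => X Xg.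
by rewrite rmorphB /= evg_hamilton // gradg_symv // evg_symv ?subrr //; apply: lie_mem.
Qed.

(** The Hamiltonian field of xi is the infinitesimal conjugation of X to [X, xi], by invariance of
    the trace form. *)
Lemma hamilton_gpoint xi : xi \in g ->
  map_mx (hamilton xi) gpoint = gpoint *m map_mx (@mpolyC _ C) xi - map_mx (@mpolyC _ C) xi *m gpoint.
Proof.
move=> xig; apply/matrixP => a b; apply/eqP; rewrite -subr_eq0; apply/eqP.
apply: g_separation => X Xg; rewrite rmorphB /=.
have evC : map_mx (evg X) (map_mx (@mpolyC _ C) xi) = xi.
  by apply/matrixP => i j; rewrite !mxE [evg X _]mevalC.
have evE : map_mx (evg X) (gpoint *m map_mx (@mpolyC _ C) xi - map_mx (@mpolyC _ C) xi *m gpoint) = lie X xi.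
  by rewrite map_mxB !map_mxM evC evg_gpoint.
move/matrixP: evE => /(_ a b); rewrite [LHS]mxE => ->.
rewrite [map_mx _ _ _ _]mxE [gpoint _ _]mxE evg_hamilton // gradg_symv ?gpoint_mem //.
set t := _ *: _; have -> : \tr (lie xi t *m X) = \tr (t *m lie X xi).
  by rewrite mxtrace_mulC -mxtrace_lie mxtrace_mulC.
by rewrite /t trform_gpoint ?subrr //; apply: lie_mem.
Qed.

Lemma hamilton_casimir xi k : xi \in g -> hamilton xi (det1X gpoint)`_k = 0.
Proof.
move=> xig; apply: (@derivation_det1X_comm _ _ _ idfun (hamilton xi) gpoint (- map_mx (@mpolyC _ C) xi)).
  exact: hamiltonM.
have -> : map_mx idfun gpoint = gpoint by apply: map_mx_id.
apply: (etrans (hamilton_gpoint xig)).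
by rewrite mulNmx mulmxN opprK addrC.
Qed.

Lemma hamilton_gpoint_exp xi k : xi \in g ->
  map_mx (hamilton xi) (gpoint ^+ k) =
  gpoint ^+ k *m map_mx (@mpolyC _ C) xi - map_mx (@mpolyC _ C) xi *m gpoint ^+ k.
Proof.
move=> xig; elim: k => [|k IHk].
  rewrite expr0 mulmx1 mul1mx subrr; apply/matrixP => a b; rewrite !mxE.
  by rewrite raddfMn /= (@derivation1 _ _ idfun (hamilton xi)) ?mul0rn //; apply: hamiltonM.
rewrite exprS -[gpoint * _]/(gpoint *m _).
rewrite (@derivation_mulmx _ _ idfun (hamilton xi)); last exact: hamiltonM.
have idE (A : 'M[Sg]_n) : map_mx idfun A = A by apply: map_mx_id.
rewrite !idE; apply: etrans (congr2 _ (congr2 mulmx (hamilton_gpoint xig) (erefl _)) (congr2 mulmx (erefl _) IHk)) _.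
rewrite /= mulmxBl mulmxBr !mulmxA.
have cancel_mid (A B D : 'M[Sg]_n) : A - B + (D - A) = D - B by rewrite addrC addrA subrK.
exact: cancel_mid.
Qed.

End HamiltonianFields.

(** * The invariant minors *)

Section Hessenberg.
Context (T : idomainType) (n : nat) (sh : 'I_n -> nat).
Implicit Types X S : 'M[T]_n.

Definition hessenberg X := forall a b, X a b != 0 -> (sh b <= (sh a).+1)%N.

Lemma hessenberg_exp X j a b : hessenberg X -> (sh a + j < sh b)%N -> (X ^+ j) a b = 0.
Proof.
move=> HX; elim: j a => [|j IHj] a ab.
  by rewrite expr0 mxE; have [H|//] := eqVneq a b; move: ab; rewrite H; lia.
rewrite exprS -[X * _]/(X *m _) mxE big1 // => c _.
have [->|/HX ac] := eqVneq (X a c) 0; first by rewrite mul0r.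
by rewrite IHj ?mulr0 //; lia.
Qed.

(** A product of j entries that climbs j levels must climb exactly one level at each step, so only
    the entries one level up matter. *)
Lemma hessenberg_top X S j a b : hessenberg X -> hessenberg S ->
  (forall a b, sh b = (sh a).+1 -> X a b = S a b) ->
  sh b = (sh a + j)%N -> (X ^+ j) a b = (S ^+ j) a b.
Proof.
move=> HX HS XS; elim: j a => [|j IHj] a ab; first by rewrite !expr0.
rewrite !exprS -[X * _]/(X *m _) -[S * _]/(S *m _) !mxE; apply: eq_bigr => c _.
have [ac|ac|ac] := ltngtP (sh c) (sh a).+1.
- by rewrite !hessenberg_exp ?mulr0 //; lia.
- have [->|/HX] := eqVneq (X a c) 0; last by lia.
  have [->|/HS] := eqVneq (S a c) 0; last by lia.
  by rewrite !mul0r.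
by rewrite XS // IHj //; lia.
Qed.

End Hessenberg.

Section VectorLift.
Context (C : numClosedFieldType) (N m : nat).
Local Notation q := (2 * m).+1.
Local Notation n := (N + q)%N.
Local Notation e := (em C N m).
Local Notation f := (fm C N m).
Hypothesis m0 : (0 < m)%N.

Definition last_idx : 'I_n := rshift N ord_max.

(** The rows m, m - 1, ..., 0 of the lower block, then the row i of V_N: in this order the matrix
    below is triangular on the slice. *)
Definition minor_row (i : 'I_N) (a : 'I_m.+2) : 'I_n :=
  if (a <= m)%N then rshift N (inord (m - a)) else lshift q i.

(* The span of the rows chosen here is stable under left multiplication by mneg,
   which acts on it by strictly triangular matrices, and mneg kills the last basis
   vector: hence the determinant is invariant. On the slice it is a multiple of
   the coordinate v_i. *)
Definition minor_mx (T : comNzRingType) (X : 'M[T]_n) i : 'M[T]_m.+2 :=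
  \matrix_(a, j) (X ^+ (m + j)) (minor_row i a) last_idx.

Lemma map_minor_mx (T T' : comNzRingType) (phi : {rmorphism T -> T'}) (X : 'M[T]_n) i :
  map_mx phi (minor_mx X i) = minor_mx (map_mx phi X) i.
Proof. by apply/matrixP => a j; rewrite !mxE -map_mx_exp [RHS]mxE. Qed.

Lemma level_last : level last_idx = (2 * m)%N.
Proof. by rewrite levelr. Qed.

Lemma minor_row_low i (k : 'I_q) (km : (k <= m)%N) :
  minor_row i (inord (m - k)) = rshift N k.
Proof.
rewrite /minor_row inordK; last by lia.
rewrite leq_subr subKn //; congr (rshift N _).
by apply/val_inj; rewrite /= inordK.
Qed.

Lemma level_minor_row i a : (level (minor_row i a) <= m)%N.
Proof.
rewrite /minor_row; case: (leqP a m) => am; last by rewrite levell.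
by rewrite levelr inordK ?leq_subr //; lia.
Qed.

(** All indices of level below m are among the chosen rows, while the two remaining rows have level
    m. An element of mneg maps the chosen rows to combinations of rows of level below m, whence the
    stability of their span. *)
Lemma sum_minor_row (V : zmodType) i (G : 'I_n -> V) :
  (forall d, (m <= level d)%N -> G d = 0) -> \sum_d G d = \sum_a G (minor_row i a).
Proof.
move=> G0; have -> : \sum_d G d = \sum_d \sum_a (if minor_row i a == d then G d else 0).
  apply: eq_bigr => d _; have [md|dm] := leqP m (level d).
    by rewrite G0 // big1 // => a _; case: ifP.
  have [k dk] : exists k : 'I_q, d = rshift N k.
    by move: dm; case: (split_ordP d) => k ->; [rewrite levell ltnn | exists k].
  have km : (k < m)%N by move: dm; rewrite dk levelr.
  rewrite (bigD1 (inord (m - k))) //= minor_row_low ?(ltnW km) // -dk eqxx big1 ?addr0 // => a ak.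
  case: eqP => // H; case/eqP: ak; apply/val_inj; rewrite /= inordK; last by lia.
  move: H; rewrite /minor_row dk; case: (leqP a m) => am.
    by move/rshift_inj/(congr1 val); rewrite /= inordK //; lia.
  by move/eqP; rewrite eq_lrshift.
rewrite exchange_big; apply: eq_bigr => a _ /=.
rewrite (bigD1 (minor_row i a)) //= eqxx big1 ?addr0 // => d da.
by rewrite eq_sym (negPf da).
Qed.

Lemma em_level a b : e a b != 0 -> level b = (level a).+1.
Proof.
rewrite em_shift /low_block; case: (split_ordP a) => k ->; case: (split_ordP b) => l ->;
  rewrite ?block_mxEul ?block_mxEur ?block_mxEdl ?block_mxEdr ?mxE ?eqxx // !levelr.
by have [//|_] := eqVneq (l : nat) k.+1; rewrite mul0r eqxx.
Qed.

Lemma fm_level a b : f a b != 0 -> level a = (level b).+1.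
Proof.
rewrite fm_low_block /low_block; case: (split_ordP a) => k ->; case: (split_ordP b) => l ->;
  rewrite ?block_mxEul ?block_mxEur ?block_mxEdl ?block_mxEdr ?mxE ?eqxx // !levelr.
by have [//|_] := eqVneq (k : nat) l.+1; rewrite mul0r eqxx.
Qed.

Lemma low_blockE (d : 'M[C]_q) k l : low_block N d (rshift N k) (rshift N l) = d k l.
Proof. by rewrite /low_block block_mxEdr. Qed.

Lemma em_exp_last (k : 'I_q) j : (0 < j)%N -> (k + j = 2 * m)%N -> (e ^+ j) (rshift N k) last_idx != 0.
Proof.
move=> j0 kj; rewrite em_shift low_block_exp // low_blockE shift_mx_exp /= kj eqxx mul1r.
by rewrite prodf_seq_neq0; apply/allP => i _; rewrite signr_eq0.
Qed.

Lemma fm_exp_level j a b : (f ^+ j) a b != 0 -> level a = (level b + j)%N.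
Proof.
move=> H; apply: (@expr_shift _ _ (@level N m) f^T).
  by move=> c d; rewrite mxE; apply: fm_level.
by rewrite -trmx_exp mxE.
Qed.

Lemma slice_eltEr a v (c : 'rV[C]_m) i (k : 'I_q) :
  slice_elt a v c (lshift q i) (rshift N k) = v i 0 * (k == ord0)%:R.
Proof.
rewrite /slice_elt mxE block_mxEur mxE big_ord1 mxE eqxx /= summxE big1 ?addr0 // => l _.
rewrite mxE fm_low_block low_block_exp; last by have := ltn_ord l; lia.
by rewrite /low_block block_mxEur mxE mulr0.
Qed.

Lemma slice_elt_level a v (c : 'rV[C]_m) (x y : 'I_n) : slice_elt a v c x y != 0 -> (level y <= level x)%N.
Proof.
rewrite /slice_elt mxE summxE.
have H : \sum_(k < m) (c 0 k *: f ^+ (2 * (m - k)).-1) x y != 0 -> (level y <= level x)%N.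
  apply: contraNT; rewrite -ltnNge => yx; apply/eqP; rewrite big1 // => k _; rewrite mxE.
  have [->|/fm_exp_level H] := eqVneq ((f ^+ (2 * (m - k)).-1) x y) 0; first by rewrite mulr0.
  by move: yx; rewrite H; lia.
set B := block_mx _ _ _ _; have [->|nz] := eqVneq (B x y) 0; first by rewrite add0r; apply: H.
move=> _; move: nz; rewrite /B; case: (split_ordP x) => i ->; case: (split_ordP y) => k ->;
  rewrite ?block_mxEul ?block_mxEur ?block_mxEdl ?block_mxEdr ?levell ?levelr //.
- rewrite mxE big_ord1 [delta_mx _ _ _ _]mxE eqxx /=; have [-> _|] := eqVneq k ord0; first by [].
  by rewrite mulr0 eqxx.
- rewrite !mxE big_ord1 [delta_mx _ _ _ _]mxE eqxx andbT.
  have [-> _|] := eqVneq i ord_max; first by rewrite /=; lia.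
  by rewrite mul0r oppr0 eqxx.
by rewrite mxE eqxx.
Qed.

Lemma kerf_level Y (x y : 'I_n) : Y \in kerf C N m -> Y x y != 0 -> (level y <= level x)%N.
Proof. by move=> /kerfP[a [v [c [_ ->]]]]; apply: slice_elt_level. Qed.

Lemma slice_hessenberg Y : Y \in kerf C N m -> hessenberg (@level N m) (e + Y).
Proof.
move=> Yk x y; rewrite mxE; have [->|/em_level ->] := eqVneq (e x y) 0; last by [].
by rewrite add0r => /(kerf_level Yk) /leqW.
Qed.

Lemma slice_top Y (x y : 'I_n) j : Y \in kerf C N m -> level y = (level x + j)%N ->
  ((e + Y) ^+ j) x y = (e ^+ j) x y.
Proof.
move=> Yk; apply: hessenberg_top.
- exact: slice_hessenberg.
- by move=> a b /em_level ->.
move=> a b ab; rewrite mxE; have [->|/(kerf_level Yk)] := eqVneq (Y a b) 0; first by rewrite addr0.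
by rewrite ab ltnn.
Qed.

(* The level at which the rows of V_N stand below the row N + 1. *)
Definition level_V (a : 'I_n) : nat := match split a with inl _ => 0 | inr k => k.+1 end.

Lemma level_Vl (i : 'I_N) : level_V (lshift q i) = 0%N.
Proof. by rewrite /level_V (unsplitK (inl i)). Qed.

Lemma level_Vr (k : 'I_q) : level_V (rshift N k) = k.+1.
Proof. by rewrite /level_V (unsplitK (inr k)). Qed.

Lemma slice_hessenberg_V Y : Y \in kerf C N m -> hessenberg level_V (e + Y).
Proof.
move=> Yk x y; case: (split_ordP x) => i xE; case: (split_ordP y) => k yE; rewrite ?xE ?yE ?level_Vl ?level_Vr //.
- rewrite mxE em_shift /low_block block_mxEur mxE add0r.
  move: Yk => /kerfP[a [v [c [_ ->]]]]; rewrite slice_eltEr.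
  by have [->|] := eqVneq k ord0; rewrite ?mulr0 ?eqxx.
by move/(slice_hessenberg Yk); rewrite !levelr ltnS.
Qed.

Definition minor_const : C :=
  (\prod_(a < m.+1) (e ^+ (m + a)) (rshift N (inord (m - a))) last_idx)
  * (e ^+ (2 * m)) (rshift N ord0) last_idx.

Lemma minor_const_neq0 : minor_const != 0.
Proof.
rewrite mulf_neq0 ?em_exp_last //=; try lia.
apply/prodf_neq0 => a _; apply: em_exp_last; first by lia.
by rewrite inordK; have := ltn_ord a; lia.
Qed.

(** A row of level m - a needs m + a steps to reach the last column, so the matrix is upper
    triangular with powers of e on the diagonal. For the row i of V_N this count uses [level_V]: it
    is joined to the lower block only through v_i in column N + 1, and needs 2m + 1 steps. *)
Lemma det_minor_mx_slice a v (c : 'rV[C]_m) i : a \in so C N ->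
  \det (minor_mx (e + slice_elt a v c) i) = minor_const * v i 0.
Proof.
move=> aso; set Y := slice_elt a v c; have Yk : Y \in kerf C N m by apply: slice_elt_kerf.
have row_low (x : 'I_m.+1) : minor_row i (widen_ord (leqnSn _) x) = rshift N (inord (m - x)).
  by rewrite /minor_row /= -ltnS ltn_ord.
have row_top : minor_row i ord_max = lshift q i by rewrite /minor_row /= ltnn.
rewrite -det_tr det_trig; last first.
  apply/is_trig_mxP => j x jx; rewrite !mxE.
  have [xm|xm] := leqP x m.
    rewrite (hessenberg_exp (slice_hessenberg Yk)) // level_last /minor_row xm levelr inordK; lia.
  have xE : x = ord_max by apply/val_inj; have := ltn_ord x; rewrite /=; lia.
  rewrite xE row_top (hessenberg_exp (slice_hessenberg_V Yk)) // level_Vl level_Vr /=.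
  by move: jx; rewrite xE /=; lia.
rewrite big_ord_recr /= /minor_const -mulrA; congr (_ * _).
  apply: eq_bigr => x _; rewrite !mxE /= row_low slice_top // level_last levelr inordK; have := ltn_ord x; lia.
rewrite !mxE row_top /= (_ : m + m.+1 = (2 * m).+1)%N; last by lia.
rewrite exprS -[(e + Y) * _]/((e + Y) *m _) mxE big_split_ord /= big1 => [|k _]; last first.
  by rewrite (hessenberg_exp (slice_hessenberg_V Yk)) ?mulr0 // level_Vl level_Vr.
rewrite add0r (bigD1 ord0) //= big1 => [|k k0]; rewrite mxE em_shift /low_block block_mxEur mxE add0r slice_eltEr.
  by rewrite eqxx mulr1 addr0 slice_top // ?level_last ?levelr // mulrC.
by rewrite (negPf k0) mulr0 mul0r.
Qed.

Lemma hamilton_minor (r : C) xi i : kappa N m r != 0 -> xi \in mneg C N m ->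
  hamilton xi (\det (minor_mx (gpoint N m r) i)) = 0.
Proof.
move=> kappa0 /mnegP[xig xineg].
pose L : 'M[Sg C N m]_m.+2 := \matrix_(a, b) (- xi (minor_row i a) (minor_row i b))%:MP.
have trL : \tr L = 0.
  rewrite /mxtrace big1 // => a _; rewrite mxE; apply/eqP; rewrite mpolyC_eq0 oppr_eq0.
  by apply: contraT => /xineg; rewrite ltnn.
apply: (@derivation_det_traceless _ _ idfun (hamilton xi) _ _ _ L trL); first exact: hamiltonM.
apply/matrixP => a j; rewrite [LHS]mxE.
have -> : map_mx idfun (minor_mx (gpoint N m r) i) = minor_mx (gpoint N m r) i by apply: map_mx_id.
rewrite [minor_mx _ _ _ _]mxE; set k := (m + j)%N.
have /matrixP/(_ (minor_row i a) last_idx) := hamilton_gpoint_exp kappa0 k xig.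
rewrite [LHS]mxE => H; apply: (etrans H); rewrite {H} mxE [X in X + _]mxE big1 => [|c _]; last first.
  have [H|/xineg] := eqVneq (xi c last_idx) 0; first by rewrite [map_mx _ _ _ _]mxE H mpolyC0 mulr0.
  by rewrite level_last; have := level_lt c; lia.
rewrite add0r mxE [X in - X]mxE -sumrN [LHS](sum_minor_row i) => [|d md].
  by rewrite [RHS]mxE; apply: eq_bigr => b _; rewrite [map_mx _ _ _ _]mxE [L _ _]mxE [minor_mx _ _ _ _]mxE mpolyCN mulNr /k.
have [H|/xineg] := eqVneq (xi (minor_row i a) d) 0.
  by rewrite [map_mx _ _ _ _]mxE H mpolyC0 mul0r oppr0.
by have := level_minor_row i a; lia.
Qed.

End VectorLift.

(** * Gradients of invariant functions *)

Section Transversality.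
Context (C : numClosedFieldType) (N m : nat) (r : C).
Local Notation q := (2 * m).+1.
Local Notation n := (N + q)%N.
Local Notation g := (gso C N m).
Local Notation e := (em C N m).
Local Notation f := (fm C N m).
Local Notation zc := (zcent C N m).
Local Notation kf := (kerf C N m).
Local Notation mn := (mneg C N m).
Local Notation Sg := (Sg C N m).
Local Notation Sz := (Sz C N m).
Local Notation kappa := (kappa N m r).
Local Notation evg := (@evg C N m r).
Local Notation evz := (@evz C N m r).
Local Notation gradg := (@gradg C N m r).
Implicit Types (X Y Z : 'M[C]_n) (p : Sg).
Hypothesis m0 : (0 < m)%N.
Hypothesis kappa0 : kappa != 0.

Let JJ := Jform_sq C N m.

Lemma lie_entry X Y a b :
  lie X Y a b = \sum_c X a c * Y c b - \sum_c Y a c * X c b.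
Proof. by rewrite /lie !mxE. Qed.

Lemma gradedE x y X a b : graded x y X a b = X a b *+ (level a + x == level b + y)%N.
Proof. by rewrite mxE. Qed.

Lemma mneg_gso xi : xi \in mn -> xi \in g.
Proof. by case/mnegP. Qed.

Lemma trace_mneg_kerf xi Y : xi \in mn -> Y \in kf -> \tr (xi *m Y) = 0.
Proof.
move=> /mnegP[_ xin] Yk; rewrite /mxtrace big1 // => a _; rewrite mxE big1 // => b _.
have [->|/xin ab] := eqVneq (xi a b) 0; first by rewrite mul0r.
have [->|/(kerf_level m0 Yk)] := eqVneq (Y b a) 0; first by rewrite mulr0.
by rewrite leqNgt ab.
Qed.

Lemma evg_idealI p Y : idealI r p -> Y \in kf -> evg (e + Y) p = 0.
Proof.
move=> [l lm ->] Yk; rewrite rmorph_sum big_seq big1 //= => t /lm tm.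
have tg := mneg_gso tm; rewrite rmorphM rmorphB /= evg_symv // [evg _ _%:MP]mevalC.
rewrite /chi form_trace ?em_gso // /trform mulmxDr [\tr (_ + _)]linearD /= (trace_mneg_kerf tm Yk) addr0.
by rewrite [\tr (e *m _)]mxtrace_mulC subrr mulr0.
Qed.

Lemma invariant_good p Y xi : invariant_mod_I r p -> Y \in kf -> xi \in mn ->
  \tr (lie xi (gradg (e + Y) p) *m (e + Y)) = 0.
Proof.
move=> pinv Yk xim; have xig := mneg_gso xim.
have Xg : e + Y \in g by rewrite memvD ?em_gso ?kerf_gso.
have /eqP := evg_idealI (pinv _ xim) Yk.
by rewrite evg_bracket // gradg_symv // mulf_eq0 (negPf kappa0) => /eqP.
Qed.

Lemma graded_kerf d Y : Y \in kf -> graded 0 d Y \in kf.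
Proof.
rewrite memv_cap => /andP[Yg]; rewrite memv_ker adE => /eqP fY.
rewrite memv_cap graded_gso //= memv_ker adE; apply/eqP.
have -> : lie f (graded 0 d Y) = graded 0 d.+1 (lie f Y); last first.
  by rewrite fY; apply/matrixP => a b; rewrite gradedE !mxE mul0rn.
apply/matrixP => a b; rewrite gradedE !lie_entry mulrnBl -!sumrMnl; congr (_ - _); apply: eq_bigr => c _; rewrite gradedE.
  have [->|/fm_level H] := eqVneq (f a c) 0; first by rewrite !mul0r mul0rn.
  by rewrite mulrnAr; congr (_ *+ nat_of_bool _); lia.
have [->|/fm_level H] := eqVneq (f c b) 0; first by rewrite !mulr0 mul0rn.
by rewrite mulrnAl; congr (_ *+ nat_of_bool _); lia.
Qed.

Lemma mxtrace_graded d X Y : \tr (graded d 0 X *m Y) = \tr (X *m graded 0 d Y).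
Proof.
apply: eq_bigr => a _; rewrite !mxE; apply: eq_bigr => b _; rewrite !mxE.
by rewrite mulrnAl mulrnAr; congr (_ *+ nat_of_bool _); lia.
Qed.

(* The component of top nonnegative degree of [del] commutes with [e] and pairs
   to zero with Ker (ad f). *)
Lemma normal_mneg Y del : Y \in kf -> del \in g ->
  (forall Y', Y' \in kf -> \tr (del *m Y') = 0) ->
  (forall xi, xi \in mn -> \tr (lie xi del *m (e + Y)) = 0) -> del \in mn.
Proof.
move=> Yk delg del_kf del_mn.
have Yl (a b : 'I_n) : (level a < level b)%N -> Y a b = 0.
  by move=> ab; have [//|/(kerf_level m0 Yk)] := eqVneq (Y a b) 0; rewrite leqNgt ab.
suff H D : (forall a b, del a b != 0 -> (level b < level a + D)%N) -> del \in mn.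
  by apply: (H q) => a b _; have := level_lt b; lia.
(* D is a strict bound for level b - level a on the nonzero entries of [del]. Each step removes the
   component of degree D, and D = 0 is membership in mneg. *)
elim: D => [|D IHD] delD.
  by apply/mnegP; split=> // a b /delD; rewrite addn0.
apply: IHD => a b ab; have := delD a b ab; rewrite addnS ltnS leq_eqVlt => /orP[/eqP abD|//].
pose dD := graded D 0 del.
suff dD0 : dD = 0.
  move/matrixP: dD0 => /(_ a b); rewrite !mxE addn0 abD eqxx mulr1n => H.
  by rewrite H eqxx in ab.
have dDg : dD \in g by apply: graded_gso.
suff dDz : dD \in zc.
  apply: (trace_zcent_kerf_nondegl m0 dDz) => Y' Yk'.
  exact: etrans (mxtrace_graded _ _ _) (del_kf _ (graded_kerf D Yk')).
(* To see that [e, dD] is orthogonal to g, only the component of Z of degree -(D + 1) counts, and it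
   lies in mneg. Paired with it, [e + Y, del] reduces to [e, dD], because Y and the lower components
   of [del] have too small a degree. *)
rewrite memv_cap dDg memv_ker adE; apply/eqP/trace_nondeg => [|Z Zg].
  by apply: lie_mem => //; apply: em_gso.
pose xi := graded 0 D.+1 Z.
have xim : xi \in mn.
  apply/mnegP; split=> [|c d]; first exact: graded_gso.
  rewrite /xi gradedE addn0; have [-> _|_] := eqVneq (level c) (level d + D.+1)%N; last by rewrite mulr0n eqxx.
  by rewrite addnS ltnS leq_addr.
have := del_mn _ xim; rewrite mxtrace_lie mxtrace_mulC => /eqP.
have -> : lie del (e + Y) = - lie (e + Y) del by rewrite /lie opprB.
rewrite mulNmx linearN oppr_eq0 /= => /eqP <-; apply: eq_bigr => c _; rewrite ![(_ *m _ : 'M_n) c c]mxE.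
apply: eq_bigr => d _; rewrite [xi _ _]mxE addn0.
have eE (x y : 'I_n) : level y != (level x).+1 -> e x y = 0.
  by apply: contraNeq => /em_level ->.
have delE (x y : 'I_n) : (level x + D < level y)%N -> del x y = 0.
  by move=> xy; have [//|/delD] := eqVneq (del x y) 0; lia.
have dDE (x y : 'I_n) : dD x y = del x y *+ (level x + D == level y)%N by rewrite mxE addn0.
have [cd|cd] := eqVneq (level d) (level c + D.+1)%N.
  rewrite mulr1n; congr (_ * _); rewrite !lie_entry.
  congr (_ - _); apply: eq_bigr => x _; rewrite dDE [(e + Y) _ _]mxE.
    have [xc|xc|xc] := ltngtP (level x) (level c).+1.
    - by rewrite eE ?mul0r ?delE ?mulr0 //; lia.
    - by rewrite eE ?Yl ?addr0 ?mul0r //; lia.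
    by rewrite Yl ?addr0 ?xc; [rewrite (_ : _ == _) ?mulr1n //; lia | lia].
  have [xc|xc|xc] := ltngtP (level d) (level x).+1.
  - by rewrite delE ?mul0rn ?mul0r //; lia.
  - by rewrite eE ?Yl ?addr0 ?mulr0 //; lia.
  by rewrite Yl ?addr0; [rewrite (_ : _ == _) ?mulr1n //; lia | lia].
rewrite mulr0n mulr0 lie_entry.
rewrite !big1 ?subrr ?mul0r // => x _; rewrite dDE.
  have [xd|xd] := eqVneq (level d) (level x).+1; last by rewrite eE ?mulr0.
  by rewrite (_ : _ == _ = false) ?mul0r //; lia.
have [xc|xc] := eqVneq (level x) (level c).+1; last by rewrite eE ?mul0r.
by rewrite (_ : _ == _ = false) ?mulr0 //; lia.
Qed.

(** By [normal_mneg] the difference u - u' lies in mneg, and the condition on t says that t has zero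
    bracket with mneg at this point. *)
Lemma bracket_unique Y u u' t : Y \in kf -> u \in g -> u' \in g ->
  (forall Y', Y' \in kf -> \tr (u *m Y') = \tr (u' *m Y')) ->
  (forall xi, xi \in mn -> \tr (lie xi u *m (e + Y)) = 0) ->
  (forall xi, xi \in mn -> \tr (lie xi u' *m (e + Y)) = 0) ->
  (forall xi, xi \in mn -> \tr (lie xi t *m (e + Y)) = 0) ->
  \tr (lie u t *m (e + Y)) = \tr (lie u' t *m (e + Y)).
Proof.
have lieBr (x y z : 'M[C]_n) : lie x (y - z) = lie x y - lie x z by rewrite -!adE linearB.
have lieN (x y : 'M[C]_n) : lie x y = - lie y x by rewrite /lie opprB.
have lieBl (x y z : 'M[C]_n) : lie (x - y) z = lie x z - lie y z.
  by rewrite lieN lieBr opprB (lieN x) (lieN y) opprK addrC.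
move=> Yk ug ug' uu' ux ux' tx; apply/eqP; rewrite -subr_eq0 -linearB /= -mulmxBl -lieBl.
apply/eqP/tx/(normal_mneg Yk) => [|Y' Yk'|xi xim]; first by rewrite memvB.
  by rewrite mulmxBl linearB /= uu' // subrr.
by rewrite lieBr mulmxBl linearB /= ux // ux' // subrr.
Qed.

End Transversality.

Section SliceGradient.
Context (C : numClosedFieldType) (N m : nat) (r : C).
Local Notation q := (2 * m).+1.
Local Notation n := (N + q)%N.
Local Notation g := (gso C N m).
Local Notation e := (em C N m).
Local Notation zc := (zcent C N m).
Local Notation kf := (kerf C N m).
Local Notation Sg := (Sg C N m).
Local Notation Sz := (Sz C N m).
Local Notation kappa := (kappa N m r).
Local Notation evg := (@evg C N m r).
Local Notation evz := (@evz C N m r).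
Local Notation gradg := (@gradg C N m r).
Implicit Types (Y Z : 'M[C]_n) (p : Sg).
Hypothesis m0 : (0 < m)%N.
Hypothesis kappa0 : kappa != 0.

Definition gradz Y (F : Sz) : 'M[C]_n := \sum_i evz Y F^`M(i) *: (vbasis zc)`_i.

Lemma gradz_is_linear Y : linear (gradz Y).
Proof.
move=> a p p'; rewrite /gradz scaler_sumr -big_split; apply: eq_bigr => i _ /=.
by rewrite linearP /= linearP /= scalerDl scalerA.
Qed.

HB.instance Definition _ Y := GRing.isLinear.Build C Sz 'M[C]_n _ (gradz Y) (gradz_is_linear Y).

Lemma gradzM Y F F' : gradz Y (F * F') = evz Y F' *: gradz Y F + evz Y F *: gradz Y F'.
Proof.
rewrite /gradz !scaler_sumr -big_split; apply: eq_bigr => i _ /=.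
by rewrite mderivM rmorphD !rmorphM /= !scalerA -scalerDl mulrC.
Qed.

Lemma mxtrace_gradzM Y F F' Z : \tr (gradz Y (F * F') *m Z) =
  evz Y F' * \tr (gradz Y F *m Z) + evz Y F * \tr (gradz Y F' *m Z).
Proof. by rewrite gradzM mulmxDl -!scalemxAl mxtraceD !mxtraceZ. Qed.

Lemma gradzC Y c : gradz Y c%:MP = 0.
Proof. by rewrite /gradz big1 // => i _; rewrite mderivC linear0 scale0r. Qed.

Lemma gradz_symv Y u : u \in zc -> gradz Y (symv zc u) = u.
Proof.
move=> uz; rewrite [RHS](coord_vbasis uz); apply: eq_bigr => i _.
by rewrite mderiv_symv [evz _ _]mevalC.
Qed.

(** Both sides are derivations of p along evaluation at e + Y, and they agree on linear functions by
    the choice of [slice_linear]. *)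
Lemma gradg_restrict Y Y' p : Y \in kf -> Y' \in kf ->
  \tr (gradg (e + Y) p *m Y') = \tr (gradz Y (Defs.restrict r p) *m Y').
Proof.
move=> Yk Yk'; pose D p := \tr (gradz Y (Defs.restrict r p) *m Y').
have restrictM p1 p2 : Defs.restrict r (p1 * p2) = Defs.restrict r p1 * Defs.restrict r p2 by exact: rmorphM.
have Dadd : additive D.
  by move=> p1 p2; rewrite /D /Defs.restrict rmorphB /= linearB mulmxBl linearB.
pose Da : {additive Sg -> C} := HB.pack D (GRing.isAdditive.Build Sg C D Dadd).
have DM p1 p2 : Da (p1 * p2) = Da p1 * evg (e + Y) p2 + evg (e + Y) p1 * Da p2.
  have DE := mxtrace_gradzM Y (Defs.restrict r p1) (Defs.restrict r p2) Y'.
  rewrite -restrictM in DE; apply: etrans DE _.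
  by rewrite !(evz_restrict m0 kappa0 _ Yk); congr (_ + _); apply: mulrC.
have DC c : Da c%:MP = 0.
  by have DE : D c%:MP = 0 by rewrite /D /Defs.restrict comp_mpolyC gradzC mul0mx mxtrace0.
rewrite -[RHS]/(Da p) (derivation_mpoly DM DC) /gradg mulmx_suml linear_sum; apply: eq_bigr => i _ /=.
rewrite -scalemxAl linearZ /=; congr (_ * _).
rewrite /D /Defs.restrict comp_mpolyXU nth_mktuple linearD /= gradzC add0r.
rewrite /slice_linear gradz_symv ?riesz_mem //.
have := @evz_slice_linear C N m r m0 kappa0 (trform kappa (vbasis g)`_i) (Defs.form r (vbasis g)`_i) Y' Yk'.
rewrite /slice_linear evz_symv ?riesz_mem // => H.
apply: (mulfI kappa0); rewrite H => [|w /kerf_gso wg]; first by rewrite /trform mxtrace_mulC.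
have bg : (vbasis g)`_i \in g by rewrite vbasis_mem // mem_nth // size_tuple.
by rewrite (form_trace r m0 bg wg) [RHS]trformC.
Qed.

End SliceGradient.

(** * Gradients of the vector invariants *)

Section VectorGradient.
Context (C : numClosedFieldType) (N m : nat).
Local Notation q := (2 * m).+1.
Local Notation n := (N + q)%N.
Local Notation g := (gso C N m).
Local Notation e := (em C N m).
Local Notation kf := (kerf C N m).
Local Notation mn := (mneg C N m).
Implicit Types (X Y Z : 'M[C]_n) (x y : 'cV[C]_N).
Hypothesis m0 : (0 < m)%N.

Let JJ := Jform_sq C N m.

Section Point.
Context (a : 'M[C]_N) (v : 'cV[C]_N) (c : 'rV[C]_m).
Hypothesis aso : a \in so C N.
Let Y := slice_elt a v c.
Let X := e + Y.
Let d : 'M[C]_q := drsubmx X.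
Local Notation del k := (det1X d)`_k.

Let Yk : Y \in kf.
Proof. exact: slice_elt_kerf. Qed.

Let Xg : X \in g.
Proof. by rewrite memvD ?em_gso // (kerf_gso Yk). Qed.

Let D0 : 'M[C]_q := shift_mx m (al_e C m) + \sum_(k < m) c 0 k *: ((shift_mx m (al_f C m))^T) ^+ (2 * (m - k)).-1.

Let slice_blockD : X = block_mx a (v *m delta_mx 0 ord0) (- (delta_mx ord_max 0 *m v^T)) D0.
Proof.
have low_sum (F : 'I_m -> 'M[C]_q) : low_block N (\sum_k F k) = \sum_k low_block N (F k).
  rewrite /low_block; elim/big_ind2: _ => [|x1 x2 y1 y2 <- <-|//]; first by rewrite block_mx_const.
  by rewrite add_block_mx !addr0.
have fE : \sum_(k < m) c 0 k *: fm C N m ^+ (2 * (m - k)).-1 =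
    low_block N (\sum_(k < m) c 0 k *: ((shift_mx m (al_f C m))^T) ^+ (2 * (m - k)).-1).
  rewrite low_sum; apply: eq_bigr => k _; rewrite fm_low_block low_block_exp; last by have := ltn_ord k; lia.
  by rewrite /low_block scale_block_mx !scaler0.
rewrite /X /Y /slice_elt fE em_shift /low_block addrCA !add_block_mx !addr0 !add0r.
by congr block_mx.
Qed.

Lemma slice_block : X = block_mx a (v *m delta_mx 0 ord0) (- (delta_mx ord_max 0 *m v^T)) d.
Proof. by rewrite [RHS](_ : _ = X) // /d slice_blockD block_mxKdr. Qed.

Let dE k l : d k l = X (rshift N k) (rshift N l).
Proof. by rewrite /d !mxE. Qed.

(** Reaching the last column from row 0 takes 2m steps along e, the last m of which have weight
    -1. *)
Lemma slice_low_exp j : (j <= 2 * m)%N -> (d ^+ j) ord0 ord_max = if j == (2 * m)%N then (-1) ^+ m else 0.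
Proof.
have dh : hessenberg (fun k : 'I_q => k : nat) d.
  by move=> k l; rewrite dE => /(slice_hessenberg m0 Yk); rewrite !levelr.
move=> jm; have [->|jn] := eqVneq j (2 * m)%N; last first.
  by rewrite (hessenberg_exp dh) //= add0n ltn_neqAle jn.
rewrite (@hessenberg_top _ _ (fun k : 'I_q => k : nat) d (shift_mx m (al_e C m))) //.
- rewrite shift_mx_exp /= eqxx mul1r add0n (big_cat_nat _ (n := m)) //=; last by lia.
  rewrite big_nat big1 => [|i /andP[_ im]]; last by rewrite /al_e leqNgt im.
  rewrite mul1r (eq_big_nat _ _ (F2 := fun=> -1)) => [|i /andP[im _]]; last by rewrite /al_e im.
  by rewrite prodr_const_nat; congr (_ ^+ _); lia.
- move=> k l; rewrite mxE; have [-> //|_] := eqVneq (l : nat) k.+1; by rewrite mul0r eqxx.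
move=> k l kl; rewrite dE /X mxE em_shift low_blockE.
have [->|/(kerf_level m0 Yk)] := eqVneq (Y (rshift N k) (rshift N l)) 0; first by rewrite addr0.
by rewrite !levelr kl ltnn.
Qed.

Lemma adj_coef_corner k : (k <= 2 * m)%N ->
  (adj_coef d k) ord0 ord_max = if k == (2 * m)%N then (-1) ^+ m else 0.
Proof.
have oppX j : ((- d) ^+ j) ord0 ord_max = (-1) ^+ j * (d ^+ j) ord0 ord_max.
  by rewrite [(- d) ^+ _]exprNn -signr_odd -[in RHS]signr_odd; case: odd; rewrite ?expr1 ?expr0 ?mulN1r ?mul1r ?mxE.
move=> km; rewrite adj_coefE summxE big_ord_recl /= det1X_0 scale1r subn0 oppX slice_low_exp //.
rewrite big1 => [|i _]; last first.
  by rewrite mxE oppX slice_low_exp /bump /=; [rewrite ltn_eqF ?mulr0 //; lia | lia].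
rewrite addr0; case: eqP => [->|_]; last by rewrite mulr0.
by rewrite -signr_odd mul2n odd_double mul1r.
Qed.

(* The solution G of d G - G a = e_last (spin x)^T, found by the Horner scheme. *)
Definition grad_low x : 'M[C]_(q, N) :=
  \sum_(k < q) adj_coef d (2 * m - k) *m delta_mx ord_max 0 *m (a ^+ k *m x)^T.

(** The polynomial det (lambda + d) in lambda, evaluated at a and applied to x. *)
Definition spin x : 'cV[C]_N := \sum_(k < q.+1) del (q - k) *: (a ^+ k *m x).

(** [adj_coefSl] rewrites d times a coefficient of the adjugate by the next one, and a^T = - a turns
    multiplication by a into a shift of k. The terms Q telescope, and the ends are known from
    [adj_coef_top] and [adj_coef0]. *)
Lemma grad_low_commutator x :
  d *m grad_low x - grad_low x *m a = delta_mx ord_max 0 *m (spin x)^T.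
Proof.
pose Q k := adj_coef d (q - k) *m delta_mx ord_max 0 *m (a ^+ k *m x)^T.
pose S k := del (q - k) *: (delta_mx ord_max 0 *m (a ^+ k *m x)^T : 'M[C]_(q, N)).
have -> : d *m grad_low x = \sum_(k < q) (S k - Q k).
  rewrite /grad_low mulmx_sumr; apply: eq_bigr => k _.
  have kq : (q - k = (2 * m - k).+1)%N by rewrite subSn // -ltnS.
  rewrite /S /Q kq adj_coefSl !mulmxBl mul_scalar_mx -scalemxAl opprB addrCA subrr addr0 !mulmxA.
  by [].
have -> : grad_low x *m a = - \sum_(k < q) Q k.+1.
  rewrite /grad_low mulmx_suml -sumrN; apply: eq_bigr => k _.
  rewrite /Q subSS exprS -[a * _]/(a *m _) -[a *m _ *m x]mulmxA [(a *m _)^T]trmx_mul.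
  by rewrite (elimT (mem_soP a) aso) mulmxN mulmxN opprK !mulmxA.
rewrite opprK -big_split /=.
have -> : \sum_(k < q) (S k - Q k + Q k.+1) = \sum_(k < q) S k + (Q q - Q 0%N).
  rewrite -(big_mkord xpredT (fun k => S k - Q k + Q k.+1)) -(big_mkord xpredT S).
  rewrite -telescope_sumr // -big_split; apply: eq_bigr => k _ /=.
  by rewrite -addrA [- Q k + _]addrC.
rewrite {2}/Q /Q subn0 subnn adj_coef_top adj_coef0 !mul0mx subr0 mul1mx.
rewrite /spin linear_sum mulmx_sumr [RHS]big_ord_recr /= (subnn q) det1X_0 linearZ /= scale1r; congr (_ + _).
by apply: eq_bigr => k _; rewrite linearZ /= -scalemxAr.
Qed.

Lemma grad_low_row0 x i : grad_low x ord0 i = (-1) ^+ m * x i 0.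
Proof.
have colE (A : 'M[C]_q) (z : 'cV[C]_N) : (A *m delta_mx ord_max 0 *m z^T) ord0 i = A ord0 ord_max * z i 0.
  rewrite mxE big_ord1 !mxE (bigD1 ord_max) //= big1 => [|k kmax]; rewrite mxE.
    by rewrite !eqxx mulr1 addr0.
  by rewrite (negPf kmax) mulr0.
rewrite /grad_low summxE (bigD1 ord0) //= big1 => [|k k0]; rewrite colE adj_coef_corner ?leq_subr //.
  by rewrite subn0 eqxx addr0 expr0 mul1mx.
rewrite ltn_eqF ?mul0r //; move: k0; rewrite -val_eqE /=; lia.
Qed.

(* The gradient at [X], modulo mneg, of an invariant function restricting to the
   element iotabar (0, x, 0). *)
Definition vgrad x : 'M[C]_n :=
  block_mx 0 (\matrix_(i, k) ((-1) ^+ m * grad_low x (rev_ord k) i)) (- ((-1) ^+ m *: grad_low x)) 0.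

Lemma vgrad_gso x : vgrad x \in g.
Proof.
apply/gsoP => i j; rewrite /vgrad.
by case: (split_ordP i) => k ->; case: (split_ordP j) => l ->; rewrite ?inv_idxl ?inv_idxr
  ?block_mxEul ?block_mxEur ?block_mxEdl ?block_mxEdr ?mxE ?opprK ?oppr0 ?rev_ordK.
Qed.

Lemma mxtrace_offdiag b b' Z : block_mx 0 b b' 0 \in g -> Z \in g ->
  \tr (block_mx 0 b b' 0 *m Z) = 2 * \tr (b *m dlsubmx Z).
Proof.
move=> /gsoP Pg /gsoP Zg; rewrite -{1}[Z]submxK mulmx_block mxtrace_block !mul0mx add0r addr0.
rewrite mulr_natl mulr2n; congr (_ + _).
rewrite mxtrace_mulC; apply: eq_bigr => i _; rewrite !mxE (reindex_inj rev_ord_inj).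
apply: eq_bigr => k _; rewrite !mxE.
have := Pg (lshift q i) (rshift N k); rewrite inv_idxl inv_idxr block_mxEur block_mxEdl => ->.
by rewrite Zg inv_idxl inv_idxr rev_ordK !mulNr mulrC.
Qed.

Lemma mxtrace_offdiag_slice b b' a' v' (c' : 'rV[C]_m) : block_mx 0 b b' 0 \in g -> a' \in so C N ->
  \tr (block_mx 0 b b' 0 *m slice_elt a' v' c') = - 2 * \sum_i b i ord_max * v' i 0.
Proof.
move=> Pg aso'.
have Sg' : slice_elt a' v' c' \in g by apply/kerf_gso/slice_elt_kerf.
rewrite mxtrace_offdiag // mulNr -mulrN; congr (_ * _).
have dlE (k : 'I_q) i : dlsubmx (slice_elt a' v' c') k i = - (v' i 0 * (k == ord_max)%:R).
  rewrite [LHS]mxE [LHS]mxE (elimT (gsoP _) Sg') inv_idxl inv_idxr slice_eltEr //.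
  by rewrite -(inj_eq rev_ord_inj) rev_ordK (_ : rev_ord ord0 = ord_max) //; apply/val_inj; rewrite /= subn1.
rewrite -sumrN; apply: eq_bigr => i _; rewrite [LHS]mxE (bigD1 ord_max) //= big1 => [|k kmax]; rewrite dlE.
  by rewrite eqxx mulr1 mulrN addr0.
by rewrite (negPf kmax) mulr0 oppr0 mulr0.
Qed.

Lemma vgrad_kerf x Y' : Y' \in kf -> \tr (vgrad x *m Y') = \tr (head_part m 0 x *m Y').
Proof.
move=> /kerfP[a' [v' [c' [aso' ->]]]].
rewrite !mxtrace_offdiag_slice ?vgrad_gso ?head_part_gso ?mem0v //; congr (_ * _).
apply: eq_bigr => i _; congr (_ * _); rewrite !mxE big_ord1 mxE !eqxx mulr1.
rewrite (_ : rev_ord ord_max = ord0); last by apply/val_inj; rewrite /= subnn.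
by rewrite grad_low_row0 mulrA -expr2 sqrr_sign mul1r.
Qed.

Lemma lie_vgrad_dl x : dlsubmx (lie X (vgrad x)) = - ((-1) ^+ m *: (delta_mx ord_max 0 *m (spin x)^T)).
Proof.
rewrite /lie slice_block /vgrad !mulmx_block opp_block_mx add_block_mx block_mxKdl.
rewrite mulmx0 add0r mul0mx addr0 mulmxN mulNmx -scalemxAl -scalemxAr opprK -scalerN -scalerN -scalerDr.
by rewrite -grad_low_commutator scalerN -scalerN opprB addrC.
Qed.

Lemma lie_vgrad_dr x (k l : 'I_q) : k != ord_max -> l != ord0 ->
  lie X (vgrad x) (rshift N k) (rshift N l) = 0.
Proof.
move=> kmax l0; rewrite /lie slice_block /vgrad !mulmx_block opp_block_mx add_block_mx block_mxEdr.
rewrite !mulmx0 mul0mx !addr0 !mulNmx opprK.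
have row0 (z : 'cV[C]_N) (B : 'M[C]_(N, q)) : (delta_mx ord_max 0 *m z^T *m B) k l = 0.
  by rewrite -mulmxA mxE big_ord1 [delta_mx _ _ _ _]mxE (negPf kmax) mul0r.
have col0 (z : 'cV[C]_N) (B : 'M[C]_(q, N)) : (B *m (z *m delta_mx 0 ord0)) k l = 0.
  by rewrite mulmxA mxE big_ord1 [delta_mx _ _ _ _]mxE (negPf l0) andbF mulr0.
by rewrite [LHS]mxE [X in X + _]mxE row0 col0 oppr0 addr0.
Qed.

(** Outside the upper left block, [X, vgrad x] is supported in the last row and in column N + 1. In
    the trace these positions, and those of the upper left block, only meet entries of xi that
    vanish because xi strictly lowers the level. *)
Lemma vgrad_good x xi : xi \in mn -> \tr (lie xi (vgrad x) *m X) = 0.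
Proof.
move=> /mnegP[xig xin]; have Lg : lie X (vgrad x) \in g by apply: lie_mem => //; apply: vgrad_gso.
rewrite mxtrace_lie (_ : lie (vgrad x) X = - lie X (vgrad x)); last by rewrite /lie opprB.
rewrite mulmxN linearN /= /mxtrace big1 ?oppr0 // => s _; rewrite mxE big1 // => t _.
have [->|/xin ts] := eqVneq (xi s t) 0; first by rewrite mul0r.
have dl0 k i : k != ord_max -> lie X (vgrad x) (rshift N k) (lshift q i) = 0.
  move=> kmax; have := lie_vgrad_dl x; move/matrixP/(_ k i).
  by rewrite [LHS]mxE [LHS]mxE => ->; rewrite !mxE big_ord1 mxE (negPf kmax) mul0r mulr0 oppr0.
suff -> : lie X (vgrad x) t s = 0 by rewrite mulr0.
move: ts; case: (split_ordP s) => k ->; case: (split_ordP t) => l ->; rewrite ?levell ?levelr ?ltnn //.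
- by move=> lm; apply: dl0; rewrite -val_eqE /=; lia.
- move=> mk; rewrite (elimT (gsoP _) Lg) inv_idxl inv_idxr dl0 ?oppr0 // -val_eqE /=; lia.
by move=> lk; apply: lie_vgrad_dr; rewrite -val_eqE /=; have := ltn_ord k; lia.
Qed.

(** By invariance this is the trace of [vgrad y] with [X, vgrad x], whose lower left block is one
    row, proportional to [spin x]; it meets only the row 0 of [grad_low y], which is y up to
    sign. *)
Lemma vgrad_bracket x y : \tr (lie (vgrad x) (vgrad y) *m X) = - 2 * (-1) ^+ m * dotp (spin x) y.
Proof.
have Lg : lie X (vgrad x) \in g by apply: lie_mem => //; apply: vgrad_gso.
rewrite mxtrace_mulC -mxtrace_lie mxtrace_mulC mxtrace_offdiag ?vgrad_gso // lie_vgrad_dl.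
rewrite !mulNr -[RHS]mulrN -mulrA; congr (_ * _).
rewrite /dotp mulrN mulr_sumr -sumrN; apply: eq_bigr => i _; rewrite mxE (bigD1 ord_max) //= big1 => [|k kmax].
  rewrite !mxE big_ord1 !mxE !eqxx mul1r addr0 (_ : rev_ord ord_max = ord0); last by apply/val_inj; rewrite /= subnn.
  rewrite grad_low_row0 mulrA -expr2 sqrr_sign mul1r; ring.
by rewrite !mxE big_ord1 !mxE (negPf kmax) mul0r mulr0 oppr0 mulr0.
Qed.

Lemma det1X_slice_low_odd i : odd i -> del i = 0.
Proof.
have two_reg (z : C) : z *+ 2 = 0 -> z = 0.
  by move/eqP; rewrite mulrn_eq0 /= => /eqP.
move=> oi; pose Jd : 'M[C]_q := \matrix_(k, l) (l == rev_ord k)%:R.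
have JdE (A : 'M[C]_q) k l : (Jd *m A) k l = A (rev_ord k) l.
  by rewrite mxE (bigD1 (rev_ord k)) //= big1 => [|t /negPf tk]; rewrite mxE ?eqxx ?tk ?mul1r ?addr0 ?mul0r.
have JdEr (A : 'M[C]_q) k l : (A *m Jd) k l = A k (rev_ord l).
  rewrite mxE (bigD1 (rev_ord l)) //= big1 => [|t /negPf tk]; rewrite mxE ?rev_ordK ?eqxx ?mulr1 ?addr0 //.
  by rewrite -[t]rev_ordK (inj_eq rev_ord_inj) in tk *; rewrite eq_sym rev_ordK in tk *; rewrite tk mulr0.
apply: (det1X_odd (J := Jd) two_reg _ _ oi).
  by apply/matrixP => k l; rewrite JdE !mxE rev_ordK eq_sym.
apply/matrixP => k l; rewrite mxE JdE JdEr [_^T _ _]mxE !dE (elimT (gsoP _) Xg) !inv_idxr rev_ordK addNr.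
by rewrite mxE.
Qed.

(** The size q is odd and det (1 + td) is even in t, so only odd powers of a remain; these are skew,
    whence the sign. *)
Lemma spinE x y : dotp (spin x) y =
  - \sum_(i < m.+1) del (2 * i) * \sum_k \sum_l x k 0 * y l 0 * (a ^+ (2 * (m - i)).+1) k l.
Proof.
pose G k := \sum_i \sum_l x i 0 * y l 0 * (a ^+ k) i l.
have aT k : (a ^+ k)^T = (-1) ^+ k *: a ^+ k.
  elim: k => [|k IHk]; first by rewrite !expr0 trmx1 scale1r.
  rewrite exprSr -[_ * a]/(_ *m a) trmx_mul IHk (elimT (mem_soP a) aso) mulNmx -scalemxAr exprS mulN1r scaleNr.
  by rewrite -[a *m _]exprS exprSr.
have dotG k : dotp (a ^+ k *m x) y = (-1) ^+ k * G k.
  rewrite /dotp /G mulr_sumr.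
  under eq_bigr => i _ do rewrite mxE mulr_suml.
  rewrite exchange_big; apply: eq_bigr => j _ /=; rewrite mulr_sumr; apply: eq_bigr => i _.
  move/matrixP: (aT k) => /(_ j i); rewrite !mxE => ->; ring.
(* The factor [*+ (k <= q)] makes the summand vanish for even k beyond q, as [sum_odd] requires:
   there q - k is truncated to 0, where the coefficient is 1. *)
have -> : dotp (spin x) y = \sum_(k < q.+1) del (q - k) * dotp (a ^+ k *m x) y *+ (k <= q).
  rewrite /dotp /spin; under eq_bigr => i _ do rewrite summxE mulr_suml.
  rewrite exchange_big; apply: eq_bigr => k _ /=.
  by rewrite -ltnS ltn_ord mulr1n mulr_sumr; apply: eq_bigr => i _; rewrite mxE mulrA.
rewrite big_ord_recr /= (subnn q) det1X_0 mul1r leqnn mulr1n.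
rewrite (@sum_odd _ m (fun k => del (q - k) * dotp (a ^+ k *m x) y *+ (k <= q))) => [|j jo]; last first.
  by have [jq|jq] := leqP j q; rewrite ?mulr0n // det1X_slice_low_odd ?mul0r ?mul0rn // oddB //= oddM /= jo.
rewrite big_ord_recl muln0 det1X_0 mul1r subn0 opprD addrC; congr (_ + _).
  by rewrite dotG -signr_odd /= oddM /= expr1 mulN1r.
rewrite -sumrN; apply: eq_bigr => k _; have km := ltn_ord k; rewrite lift0.
rewrite dotG (_ : (2 * (m - k)).-1 = (2 * (m - k.+1)).+1)%N; last by lia.
have -> : (q - (2 * (m - k.+1)).+1 = 2 * k.+1)%N by lia.
have -> : ((2 * (m - k.+1)).+1 <= q)%N by lia.
by rewrite -signr_odd /= oddM expr1 mulN1r mulrN mulr1n.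
Qed.

End Point.
End VectorGradient.

(** * The Poisson morphism *)

Section Embedding.
Context (C : numClosedFieldType) (N m : nat) (r cV : C).
Local Notation q := (2 * m).+1.
Local Notation n := (N + q)%N.
Local Notation g := (gso C N m).
Local Notation e := (em C N m).
Local Notation zc := (zcent C N m).
Local Notation kf := (kerf C N m).
Local Notation mn := (mneg C N m).
Local Notation Sg := (Sg C N m).
Local Notation Sz := (Sz C N m).
Local Notation W := (W C N m).
Local Notation Hcl := (Hcl C N m).
Local Notation kappa := (kappa N m r).
Local Notation evg := (@evg C N m r).
Local Notation evz := (@evz C N m r).
Local Notation gradg := (@gradg C N m r).
Local Notation gpoint := (gpoint N m r).
Implicit Types (X Y Z : 'M[C]_n) (p : Sg) (w : W) (a b : Hcl) (x y : 'cV[C]_N).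
Hypothesis m0 : (0 < m)%N.
Hypothesis kappa0 : kappa != 0.

Let JJ := Jform_sq C N m.

Lemma idealI0 : @idealI C N m r 0.
Proof. by exists [::] => //; rewrite big_nil. Qed.

Lemma idealI_gen p xi : xi \in mn -> idealI r (p * (symv g xi - (chi r xi)%:MP)).
Proof.
move=> xim; exists [:: (p, xi)]; last by rewrite big_seq1.
by move=> t; rewrite inE => /eqP ->.
Qed.

Lemma idealID p p' : idealI r p -> idealI r p' -> idealI r (p + p').
Proof.
move=> [l lm ->] [l' lm' ->]; exists (l ++ l'); last by rewrite big_cat.
by move=> t; rewrite mem_cat => /orP[/lm|/lm'].
Qed.

Lemma idealIMl p p' : idealI r p' -> idealI r (p * p').
Proof.
move=> [l lm ->]; rewrite mulr_sumr; elim: l lm => [|t l IHl] lm; first by rewrite big_nil; apply: idealI0.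
have tm : t.2 \in mn by apply: lm; rewrite mem_head.
have lm' : {in l, forall u, u.2 \in mn} by move=> u ul; apply: lm; rewrite inE ul orbT.
rewrite big_cons; apply: idealID (IHl lm'); have := idealI_gen (p * t.1) tm.
by move: (symv g _ - _) => z; rewrite -mulrA.
Qed.

Definition minor_comb x : Sg := \sum_i x i 0 *: \det (minor_mx gpoint i).

Definition casimir_comb (c : 'rV[C]_m) : Sg :=
  \sum_(k < m) c 0 k *: ((-1) ^+ (m - k) *: (det1X gpoint)`_(2 * (m - k))).

(* An invariant function on g whose restriction to the slice is the image of [w] *)
Definition gen_lift w : Sg :=
  symv g (head_part m (vsval w.1.1) 0)
  + (cV * (- 2 * kappa) / minor_const C N m) *: minor_comb w.1.2
  + casimir_comb w.2.

Lemma head_part_linear (t : C) A x A' x' :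
  head_part m (t *: A + A') (t *: x + x') = t *: head_part m A x + head_part m A' x'.
Proof.
rewrite /head_part mulmxDl -scalemxAl linearP /= mulmxDr -scalemxAr opprD -scalerN.
by rewrite scale_block_mx add_block_mx scaler0 addr0.
Qed.

Lemma gen_lift_is_linear : linear gen_lift.
Proof.
move=> t [[A x] c] [[A' x'] c'].
rewrite -[t *: _ + _]/((t *: A + A', t *: x + x', t *: c + c') : W) /gen_lift /=.
rewrite -{1}[0](scaler0 _ t) -{1}[t *: 0]addr0 head_part_linear linearP /=.
have mE : minor_comb (t *: x + x') = t *: minor_comb x + minor_comb x'.
  rewrite /minor_comb scaler_sumr -big_split; apply: eq_bigr => i _ /=.
  by rewrite !mxE scalerDl scalerA.
have cE : casimir_comb (t *: c + c') = t *: casimir_comb c + casimir_comb c'.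
  rewrite /casimir_comb scaler_sumr -big_split; apply: eq_bigr => i _ /=.
  by rewrite (_ : (t *: c + c') 0 i = t * c 0 i + c' 0 i) ?scalerDl ?scalerA //; rewrite !mxE.
rewrite mE cE !scalerDr !scalerA [t * _]mulrC.
by rewrite [RHS]addrACA; congr (_ + _); rewrite [RHS]addrACA.
Qed.

HB.instance Definition _ := GRing.isLinear.Build C W Sg _ gen_lift gen_lift_is_linear.

Lemma hamilton_minor_comb xi x : xi \in mn -> hamilton xi (minor_comb x) = 0.
Proof.
move=> xim; rewrite /minor_comb linear_sum big1 // => i _.
by rewrite linearZ /= hamilton_minor ?scaler0.
Qed.

Lemma hamilton_casimir_comb xi c : xi \in g -> hamilton xi (casimir_comb c) = 0.
Proof.
move=> xig; rewrite /casimir_comb linear_sum big1 // => i _.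
by rewrite !linearZ /= hamilton_casimir ?scaler0.
Qed.

Lemma head_part_em A : lie (head_part m A 0) e = 0.
Proof.
rewrite /head_part mul0mx trmx0 mulmx0 oppr0 /lie /em !mulmx_block.
by rewrite !(mul0mx, mulmx0, addr0) opp_block_mx add_block_mx !oppr0 !addr0 block_mx_const.
Qed.

Lemma lie_mneg_head A xi : A \in so C N -> xi \in mn -> lie xi (head_part m A 0) \in mn.
Proof.
move=> aso xim; have xig := mneg_gso xim; have hg := head_part_gso m 0 aso.
apply/mnegP; split=> [|k l]; first exact: lie_mem.
have hl s t : head_part m A 0 s t != 0 -> level s = level t.
  rewrite /head_part mul0mx trmx0 mulmx0 oppr0.
  case: (split_ordP s) => i ->; case: (split_ordP t) => j ->; rewrite ?levell //.
  - by rewrite block_mxEur mxE eqxx.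
  - by rewrite block_mxEdl mxE eqxx.
  by rewrite block_mxEdr mxE eqxx.
have xin s t : xi s t != 0 -> (level t < level s)%N by case/mnegP: xim => _; apply.
apply: contraR; rewrite -leqNgt => lk; rewrite lie_entry !big1 ?subrr // => u _.
  have [->|/hl hkl] := eqVneq (head_part m A 0 k u) 0; first by rewrite mul0r.
  by have [->|/xin] := eqVneq (xi u l) 0; rewrite ?mulr0 // -hkl ltnNge lk.
have [->|/hl hkl] := eqVneq (head_part m A 0 u l) 0; first by rewrite mulr0.
by have [->|/xin] := eqVneq (xi k u) 0; rewrite ?mul0r // hkl ltnNge lk.
Qed.

(** Unlike for minors and Casimirs, the bracket is only zero modulo I: [xi, A] stays in mneg because
    A has degree 0, and chi vanishes on it because A commutes with e. *)
Lemma hamilton_head A xi : A \in so C N -> xi \in mn -> idealI r (hamilton xi (symv g (head_part m A 0))).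
Proof.
move=> aso xim; have xig := mneg_gso xim; have hg := head_part_gso m 0 aso.
rewrite (hamilton_symv kappa0) //; have Lm := lie_mneg_head aso xim.
have chi0 : chi r (lie xi (head_part m A 0)) = 0.
  rewrite /chi form_trace ?em_gso ?lie_mem // /trform mxtrace_mulC mxtrace_lie head_part_em.
  by rewrite mulmx0 mxtrace0 mulr0.
by have := idealI_gen 1 Lm; rewrite mul1r chi0 subr0.
Qed.

Lemma gen_lift_invariant w : invariant_mod_I r (gen_lift w).
Proof.
move=> xi xim; rewrite -/(hamilton xi (gen_lift w)) /gen_lift !linearD /= (hamilton_casimir_comb _ (mneg_gso xim)).
rewrite linearZ /= hamilton_minor_comb // scaler0 !addr0.
by apply: hamilton_head => //; apply: subvsP.
Qed.

Definition alg_lift a : Sg := a \mPo [tuple gen_lift (vbasis {: W})`_i | i < \dim {: W}].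

HB.instance Definition _ := GRing.LRMorphism.copy alg_lift
  (comp_mpoly [tuple gen_lift (vbasis {: W})`_i | i < \dim {: W}]).

Definition Th a : Sz := a \mPo [tuple Defs.restrict r (gen_lift (vbasis {: W})`_i) | i < \dim {: W}].

HB.instance Definition _ := GRing.LRMorphism.copy Th
  (comp_mpoly [tuple Defs.restrict r (gen_lift (vbasis {: W})`_i) | i < \dim {: W}]).

Lemma alg_lift_symv w : alg_lift (symv fullv w) = gen_lift w.
Proof.
rewrite [in RHS](coord_vbasis (memvf w)) /symv !linear_sum; apply: eq_bigr => i _ /=.
by rewrite !linearZ /= /alg_lift comp_mpolyXU nth_mktuple.
Qed.

Lemma restrict_alg_lift a : Defs.restrict r (alg_lift a) = Th a.
Proof.
apply/eqP; rewrite -subr_eq0; apply/eqP; apply: (slice_separation m0 kappa0) => Y Yk.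
rewrite rmorphB /= (evz_restrict m0 kappa0) // /evg /evz /symev /alg_lift /Th !comp_mpoly_meval.
apply/eqP; rewrite subr_eq0; apply/eqP; apply: meval_eq => i; rewrite !tnth_mktuple.
by rewrite -[RHS]/(evz Y _) (evz_restrict m0 kappa0).
Qed.

Lemma evz_Th Y a : Y \in kf -> evz Y (Th a) = evg (e + Y) (alg_lift a).
Proof. by move=> Yk; rewrite -restrict_alg_lift (evz_restrict m0 kappa0). Qed.

(** The Hamiltonian field is a derivation and I an ideal, so invariance modulo I passes from the
    generators to all polynomials in them. *)
Lemma alg_lift_invariant a : invariant_mod_I r (alg_lift a).
Proof.
move=> xi xim; rewrite -/(hamilton xi (alg_lift a)).
have DM a1 a2 : (hamilton xi \o alg_lift) (a1 * a2) =
    (hamilton xi \o alg_lift) a1 * alg_lift a2 + alg_lift a1 * (hamilton xi \o alg_lift) a2.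
  by rewrite /= rmorphM hamiltonM.
have DC c : (hamilton xi \o alg_lift) c%:MP = 0.
  rewrite /= /alg_lift comp_mpolyC -[_%:MP]mulr1 mul_mpolyC linearZ /=.
  by rewrite (@derivation1 _ _ idfun (hamilton xi)) ?scaler0 //; apply: hamiltonM.
have := derivation_mpoly DM DC a; rewrite /= => ->.
elim/big_ind: _ => [|p1 p2|i _]; [exact: idealI0|exact: idealID|].
apply: idealIMl; rewrite /alg_lift comp_mpolyXU nth_mktuple.
exact: gen_lift_invariant.
Qed.

Lemma gen_lift_split A x (c : 'rV[C]_m) :
  gen_lift (A, x, c) = gen_lift ((A, 0, 0) : W) + gen_lift ((0, x, 0) : W) + gen_lift ((0, 0, c) : W).
Proof.
have liftD w w' : gen_lift (w + w') = gen_lift w + gen_lift w' by exact: linearD.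
by rewrite -!liftD -[RHS]/(gen_lift ((A + 0 + 0, 0 + x + 0, 0 + 0 + c) : W)) !addr0 !add0r.
Qed.

Lemma head_part_zcent A x : A \in so C N -> head_part m A x \in zc.
Proof.
move=> Aso; apply/zcentP; exists (vsproj (so C N) A, x, 0).
by rewrite iotabarE /= vsprojK // big1 ?addr0 // => k _; rewrite mxE scale0r.
Qed.

Lemma mxtrace_head_part_slice A x (a : 'M[C]_N) (v : 'cV[C]_N) (c : 'rV[C]_m) :
  \tr (head_part m A x *m slice_elt a v c) = \tr (A *m a) - 2 * dotp x v.
Proof.
have := pairing_slice m0 A x 0 a v c; rewrite big1 ?addr0 => [->|k _]; last by rewrite mxE scale0r.
by rewrite big1 ?addr0 // => k _; rewrite mxE !mul0r.
Qed.

Lemma mxtrace_head_part_em A : \tr (head_part m A 0 *m e) = 0.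
Proof.
rewrite /head_part mul0mx trmx0 mulmx0 oppr0 /em mulmx_block.
by rewrite !(mul0mx, mulmx0, addr0) block_mx_const mxtrace0.
Qed.

Lemma gen_lift_head A : gen_lift ((A, 0, 0) : W) = symv g (head_part m (vsval A) 0).
Proof.
rewrite /gen_lift /minor_comb /casimir_comb /= !big1 ?scaler0 ?addr0 // => k _; first by rewrite mxE scale0r.
by rewrite mxE scale0r.
Qed.

(** The pairing of x with the slice is - 2 (x, v), while the minors give [minor_const] times v_i;
    this ratio is the constant in [gen_lift]. *)
Lemma evg_lift_vector Y x : Y \in kf ->
  evg (e + Y) (gen_lift ((0, x, 0) : W)) = cV * (kappa * \tr (head_part m 0 x *m Y)).
Proof.
move=> /kerfP[a [v [c [aso ->]]]]; rewrite mxtrace_head_part_slice mul0mx mxtrace0 sub0r.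
have minorE i : evg (e + slice_elt a v c) (\det (minor_mx gpoint i)) = minor_const C N m * v i 0.
  rewrite -det_map_mx map_minor_mx evg_gpoint ?det_minor_mx_slice // memvD ?em_gso //.
  exact/kerf_gso/slice_elt_kerf.
rewrite /gen_lift /= /casimir_comb [\sum_k _]big1 => [|k _]; last by rewrite mxE scale0r.
rewrite addr0 (_ : head_part m 0 0 = 0); last first.
  by rewrite /head_part mul0mx trmx0 mulmx0 oppr0 block_mx_const.
rewrite linear0 add0r linearZ /= /minor_comb linear_sum /=.
under eq_bigr => i _ do rewrite linearZ /= minorE mulrCA.
rewrite -mulr_sumr mulrA divfK ?minor_const_neq0 //.
by rewrite /dotp -/(dotp x v); ring.
Qed.

Lemma evg_lift_casimir Y c : Y \in kf ->
  evg (e + Y) (gen_lift ((0, 0, c) : W)) =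
  \sum_(k < m) c 0 k * ((-1) ^+ (m - k) * (det1X (e + Y))`_(2 * (m - k))).
Proof.
move=> Yk; have Xg : e + Y \in g by rewrite memvD ?em_gso ?kerf_gso.
rewrite /gen_lift /= /minor_comb [\sum_i _]big1 => [|k _]; last by rewrite mxE scale0r.
rewrite scaler0 addr0 (_ : head_part m 0 0 = 0); last first.
  by rewrite /head_part mul0mx trmx0 mulmx0 oppr0 block_mx_const.
rewrite linear0 add0r /casimir_comb linear_sum /=; apply: eq_bigr => k _.
by rewrite !linearZ /= coef_det1X_map evg_gpoint.
Qed.

Lemma Th_symv w : Th (symv fullv w) = Defs.restrict r (gen_lift w).
Proof. by rewrite -restrict_alg_lift alg_lift_symv. Qed.

Lemma Th_Hso A : Th (Hso m A) = symv zc (head_part m (vsval A) 0).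
Proof.
have hz : head_part m (vsval A) 0 \in zc by apply/head_part_zcent/subvsP.
apply/eqP; rewrite -subr_eq0; apply/eqP; apply: (slice_separation m0 kappa0) => Y Yk.
rewrite rmorphB /= Th_symv (evz_restrict m0 kappa0) // gen_lift_head evz_symv // evg_symv ?zcent_gso //.
by rewrite mulmxDr linearD /= mxtrace_head_part_em add0r subrr.
Qed.

Lemma Th_HV x : Th (HV m x) = cV *: symv zc (head_part m 0 x).
Proof.
have hz : head_part m 0 x \in zc by apply/head_part_zcent/mem0v.
apply/eqP; rewrite -subr_eq0; apply/eqP; apply: (slice_separation m0 kappa0) => Y Yk.
rewrite rmorphB /= Th_symv (evz_restrict m0 kappa0) // evg_lift_vector //.
by rewrite linearZ /= evz_symv // subrr.
Qed.

Lemma Th_Hzeta k : Th (Hzeta C N k) = (-1) ^+ (m - k) *: Theta N m r k.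
Proof.
apply/eqP; rewrite -subr_eq0; apply/eqP; apply: (slice_separation m0 kappa0) => Y Yk.
rewrite rmorphB /= Th_symv (evz_restrict m0 kappa0) //; apply/eqP; rewrite subr_eq0; apply/eqP.
apply: etrans (evg_lift_casimir _ Yk) _.
rewrite linearZ /= (evz_Theta m0 kappa0) // (bigD1 k) //= [delta_mx _ _ _ _]mxE !eqxx mul1r big1 ?addr0 // => l lk.
by rewrite mxE (negPf lk) andbF mul0r.
Qed.

Section Brackets.
Context (Y : 'M[C]_n).
Hypothesis Yk : Y \in kf.
Let X := e + Y.

Let Xg : X \in g.
Proof. by rewrite memvD ?em_gso ?kerf_gso. Qed.

Definition pb (u t : 'M[C]_n) : C := kappa * \tr (lie u t *m X).

Lemma pbC u t : pb u t = - pb t u.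
Proof.
by rewrite /pb -mulrN -linearN -mulNmx; congr (_ * \tr (_ *m _)); rewrite /lie opprB.
Qed.

Lemma pb_is_linear t : linear_for *%R (pb t).
Proof.
move=> k u u'; have lieD : lie t (k *: u + u') = k *: lie t u + lie t u'.
  by rewrite /lie mulmxDr mulmxDl opprD addrACA -scalemxAl -scalemxAr scalerBr.
by rewrite /pb lieD mulmxDl -scalemxAl linearP mulrDr mulrCA.
Qed.

HB.instance Definition _ t := GRing.isLinear.Build C 'M[C]_n C _ (pb t) (pb_is_linear t).

Lemma pb_casimir t c : t \in g -> pb t (gradg X (gen_lift ((0, 0, c) : W))) = 0.
Proof.
move=> tg; rewrite /pb -evg_hamilton // /gen_lift /= (_ : head_part m 0 0 = 0); last first.
  by rewrite /head_part mul0mx trmx0 mulmx0 oppr0 block_mx_const.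
rewrite linear0 add0r /minor_comb big1 => [|i _]; last by rewrite mxE scale0r.
by rewrite scaler0 add0r hamilton_casimir_comb ?linear0.
Qed.

Lemma good_lift w xi : xi \in mn -> \tr (lie xi (gradg X (gen_lift w)) *m X) = 0.
Proof. by move=> xim; apply: (invariant_good m0 kappa0 (gen_lift_invariant w)). Qed.

Lemma gradg_lift_head A : gradg X (gen_lift ((A, 0, 0) : W)) = head_part m (vsval A) 0.
Proof. by rewrite gen_lift_head gradg_symv //; apply/head_part_gso/subvsP. Qed.

Lemma gradg_lift_vector x Y' : Y' \in kf ->
  \tr (gradg X (gen_lift ((0, x, 0) : W)) *m Y') = cV * \tr (head_part m 0 x *m Y').
Proof.
move=> Yk'; rewrite (gradg_restrict m0 kappa0) // -Th_symv -[symv _ _]/(HV m x) Th_HV.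
by rewrite linearZ /= gradz_symv ?head_part_zcent ?mem0v // -scalemxAl mxtraceZ.
Qed.

(** A commutes with e and f, so [X, A] = [Y, A] lies again in Ker (ad f) and t may be replaced by
    t'. *)
Lemma pb_head A t t' : t \in g -> (forall Y', Y' \in kf -> \tr (t *m Y') = \tr (t' *m Y')) ->
  A \in so C N -> pb (head_part m A 0) t = kappa * \tr (lie (head_part m A 0) t' *m Y).
Proof.
move=> tg tt Aso; rewrite /pb; congr (_ * _).
have cyc (u s Z : 'M[C]_n) : \tr (lie u s *m Z) = \tr (s *m lie Z u).
  by rewrite mxtrace_mulC -mxtrace_lie mxtrace_mulC.
have LX : lie X (head_part m A 0) = lie Y (head_part m A 0).
  have := head_part_em A; rewrite /X /lie mulmxDl mulmxDr => /eqP; rewrite subr_eq0 => /eqP ->.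
  by rewrite opprD addrACA subrr add0r.
rewrite !cyc LX tt //.
have hg := head_part_gso m 0 Aso.
have kfE Z : (Z \in kf) = (Z \in g) && (lie (fm C N m) Z == 0) by rewrite memv_cap memv_ker adE.
move: Yk; rewrite !kfE => /andP[Yg /eqP fY]; rewrite lie_mem //=; have fh : lie (fm C N m) (head_part m A 0) = 0.
  rewrite /head_part mul0mx trmx0 mulmx0 oppr0 /lie /fm !mulmx_block.
  by rewrite !(mul0mx, mulmx0, addr0) opp_block_mx add_block_mx !oppr0 !addr0 block_mx_const.
have jacobi (F U V : 'M[C]_n) : lie F (lie U V) = lie (lie F U) V + lie U (lie F V).
  have cancel (s1 s2 s3 s4 s5 s6 : 'M[C]_n) :
      s1 - s2 - (s3 - s4) = s1 - s5 - (s6 - s4) + (s5 - s3 - (s2 - s6)).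
    by apply/matrixP => i j; rewrite !mxE; ring.
  by rewrite /lie !mulmxBr !mulmxBl !mulmxA; apply: cancel.
by rewrite jacobi fY fh /lie mulmx0 mul0mx mulmx0 mul0mx subrr addr0.
Qed.

Lemma lie_head A A' x : A \in so C N -> lie (head_part m A 0) (head_part m A' x) = head_part m (lie A A') (A *m x).
Proof.
move=> Aso; rewrite /head_part !mul0mx trmx0 mulmx0 oppr0 /lie !mulmx_block.
rewrite !(mul0mx, mulmx0, addr0, add0r) opp_block_mx add_block_mx !(oppr0, addr0, add0r) mulmxA.
by rewrite mulNmx opprK trmx_mul (elimT (mem_soP A) Aso) !mulmxN opprK mulmxA.
Qed.

End Brackets.

Section PointBracket.
Context (a : 'M[C]_N) (v : 'cV[C]_N) (c : 'rV[C]_m).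
Hypothesis aso : a \in so C N.
Let Y := slice_elt a v c.
Let X := e + Y.

Let Yk : Y \in kf.
Proof. exact: slice_elt_kerf. Qed.

Let vg := vgrad a v c.

(** The gradient of the lift of x and cV times [vgrad] have the same pairing with Ker (ad f), and
    both satisfy the condition of invariance: [bracket_unique] exchanges them. *)
Lemma pb_vector x t : (forall xi, xi \in mn -> \tr (lie xi t *m X) = 0) ->
  pb Y (gradg X (gen_lift ((0, x, 0) : W))) t = cV * pb Y (vg x) t.
Proof.
move=> tgood; rewrite mulrCA; congr (_ * _); rewrite -linearZ /= scalemxAl.
rewrite (_ : cV *: lie (vg x) t = lie (cV *: vg x) t); last first.
  by rewrite /lie -scalemxAl -scalemxAr scalerBr.
apply: (bracket_unique m0 kappa0 Yk) => //; first exact: gradg_mem.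
- by rewrite memvZ ?vgrad_gso.
- move=> Y' Yk'; apply: etrans (gradg_lift_vector Yk x Yk') _.
  by rewrite -scalemxAl mxtraceZ (vgrad_kerf m0 v c aso x Yk').
- by move=> xi xim; apply: good_lift.
move=> xi xim; have := vgrad_good m0 v c aso x xim; rewrite -/Y -/X -/vg => vgood.
by rewrite /lie -scalemxAl -scalemxAr -scalerBr -scalemxAl mxtraceZ vgood mulr0.
Qed.

Lemma pb_lift w w' :
  pb Y (gradg X (gen_lift w)) (gradg X (gen_lift w')) =
  kappa * \tr (head_part m (lie (vsval w.1.1) (vsval w'.1.1))
                (cV *: (vsval w.1.1 *m w'.1.2 - vsval w'.1.1 *m w.1.2)) *m Y)
  + cV ^+ 2 * pb Y (vg w.1.2) (vg w'.1.2).
Proof.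
case: w w' => [[A x] c1] [[A' x'] c1'] /=.
have gc t c2 : t \in g -> pb Y t (gradg X (gen_lift ((0, 0, c2) : W))) = 0 by apply: pb_casimir.
have pbDr u t1 t2 : pb Y u (t1 + t2) = pb Y u t1 + pb Y u t2 by exact: linearD.
have pbDl u1 u2 t : pb Y (u1 + u2) t = pb Y u1 t + pb Y u2 t by rewrite !(pbC _ _ t) pbDr opprD.
have headD (B : subvs_of (so C N)) y z : head_part m (vsval B) (y + z) = head_part m (vsval B) y + head_part m 0 z.
  have := head_part_linear 1 (vsval B) y 0 z; rewrite !scale1r => <-; by rewrite addr0.
have headZ y : head_part m 0 (cV *: y) = cV *: head_part m 0 y.
  have := head_part_linear cV 0 y 0 0; rewrite !addr0 scaler0 => ->.
  by rewrite [X in _ + X](_ : _ = 0) ?addr0 // /head_part mul0mx trmx0 mulmx0 oppr0 block_mx_const.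
pose gx y := gradg X (gen_lift ((0, y, 0) : W)).
have gxg y : gx y \in g by apply: gradg_mem.
have hg (B : subvs_of (so C N)) y : head_part m (vsval B) y \in g by apply/head_part_gso/subvsP.
have gxk y Y' : Y' \in kf -> \tr (gx y *m Y') = \tr (head_part m 0 (cV *: y) *m Y').
  by move=> Yk'; rewrite /gx gradg_lift_vector // headZ -scalemxAl mxtraceZ.
have pb_hx (B B' : subvs_of (so C N)) y : pb Y (head_part m (vsval B) 0) (head_part m (vsval B') 0 + gx y) =
    kappa * \tr (head_part m (lie (vsval B) (vsval B')) (cV *: (vsval B *m y)) *m Y).
  rewrite (@pb_head Y Yk (vsval B) _ (head_part m (vsval B') (cV *: y))) ?subvsP //.
  - by rewrite lie_head ?subvsP // -scalemxAr.
  - by rewrite memvD.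
  move=> Y' Yk'; rewrite mulmxDl linearD /= gxk // -linearD -mulmxDl /=.
  by rewrite -headD add0r.
have gradE (B : subvs_of (so C N)) (y : 'cV[C]_N) (b : 'rV[C]_m) : gradg X (gen_lift ((B, y, b) : W)) = head_part m (vsval B) 0 + gx y + gradg X (gen_lift ((0, 0, b) : W)).
  have gD p p' : gradg X (p + p') = gradg X p + gradg X p' by exact: linearD.
  rewrite gen_lift_split gD [in LHS]gD; congr (_ + _ + _); exact: gradg_lift_head.
rewrite (gradE A x c1) (gradE A' x' c1') pbDr gc ?addr0; last by rewrite !memvD ?gradg_mem.
rewrite pbDl [pb Y (gradg _ _) _]pbC gc ?oppr0 ?addr0 ?memvD // pbDl pb_hx pbDr.
have -> : pb Y (gx x) (gx x') = cV ^+ 2 * pb Y (vg x) (vg x').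
  rewrite pb_vector => [|xi xim]; last exact: good_lift.
  rewrite pbC pb_vector => [|xi xim]; last exact: vgrad_good.
  by rewrite -mulrN -pbC mulrA.
rewrite addrA; congr (_ + _).
have := pb_hx A' 0 x; rewrite (_ : head_part m (vsval 0) 0 = 0) ?add0r; last first.
  by rewrite /head_part mul0mx trmx0 mulmx0 oppr0 block_mx_const.
rewrite [pb Y (gx x) _]pbC => ->.
rewrite -mulrBr -linearB -mulmxBl /=; congr (_ * \tr (_ *m _)).
have := head_part_linear (-1) (lie (vsval A') 0) (cV *: (vsval A' *m x)) (lie (vsval A) (vsval A')) (cV *: (vsval A *m x')).
rewrite !scaleN1r [RHS in _ = RHS -> _]addrC => <-; congr head_part.
  by rewrite /lie mulmx0 mul0mx subrr oppr0 add0r.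
by rewrite scalerBr addrC.
Qed.

End PointBracket.

End Embedding.

Section Poisson.
Context (C : numClosedFieldType) (N m : nat) (r cV : C).
Local Notation q := (2 * m).+1.
Local Notation n := (N + q)%N.
Local Notation g := (gso C N m).
Local Notation e := (em C N m).
Local Notation kf := (kerf C N m).
Local Notation Sg := (Sg C N m).
Local Notation Sz := (Sz C N m).
Local Notation W := (W C N m).
Local Notation Hcl := (Hcl C N m).
Local Notation kappa := (kappa N m r).
Local Notation evg := (@evg C N m r).
Local Notation evz := (@evz C N m r).
Local Notation gradg := (@gradg C N m r).
Local Notation Th := (@Th C N m r cV).
Local Notation gen_lift := (@gen_lift C N m r cV).
Local Notation alg_lift := (@alg_lift C N m r cV).
Implicit Types (X Y : 'M[C]_n) (p : Sg) (w : W) (x y : 'cV[C]_N).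
Hypothesis m0 : (0 < m)%N.
Hypothesis kappa0 : kappa != 0.

(** The values are taken in the algebra [C^o], so that evaluation is an algebra morphism to which
    [map_gamma] applies. *)
Definition evh Y (p : Hcl) : C^o := evz Y (Th p).

Lemma evh_is_monoid_morphism Y : monoid_morphism (evh Y).
Proof. by split=> [|p p']; rewrite /evh ?rmorph1 ?rmorphM. Qed.

Lemma evh_is_linear Y : linear (evh Y).
Proof. by move=> k p p'; rewrite /evh !linearP. Qed.

HB.instance Definition _ Y := GRing.isLinear.Build C Hcl C^o _ (evh Y) (evh_is_linear Y).
HB.instance Definition _ Y := GRing.isMonoidMorphism.Build Hcl C^o (evh Y) (evh_is_monoid_morphism Y).

Lemma evh_Hso A Y : evh Y (Hso m A) = kappa * \tr (head_part m (vsval A) 0 *m Y).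
Proof. by rewrite /evh Th_Hso // evz_symv // head_part_zcent // subvsP. Qed.

Lemma evh_HV x Y : evh Y (HV m x) = cV * (kappa * \tr (head_part m 0 x *m Y)).
Proof. by rewrite /evh Th_HV // linearZ /= evz_symv // head_part_zcent // mem0v. Qed.

Lemma evh_Hzeta k Y : Y \in kf -> evh Y (Hzeta C N k) = (-1) ^+ (m - k) * (det1X (e + Y))`_(2 * (m - k)).
Proof. by move=> Yk; rewrite /evh Th_Hzeta // linearZ /= evz_Theta. Qed.

Lemma form_so_trace (A B : 'M[C]_N) : A \in so C N -> B \in so C N -> form_so m r A B = trform kappa B A.
Proof.
move=> Aso Bso; have hE D : head_part m D 0 = block_mx D 0 0 0.
  by rewrite /head_part mul0mx trmx0 mulmx0 oppr0.
rewrite /form_so -!hE form_trace ?head_part_gso // !hE /trform mulmx_block.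
by rewrite !(mul0mx, mulmx0, addr0) mxtrace_block mxtrace0 addr0.
Qed.

Lemma evh_so_point a v (c : 'rV[C]_m) : a \in so C N ->
  map_mx (evh (slice_elt a v c)) (so_point N m r) = a.
Proof.
move=> aso; apply/matrixP => i j; rewrite !mxE evh_Hso vsprojK ?riesz_mem // mxtrace_head_part_slice //.
rewrite dotpC dotp0 mulr0 subr0.
have lin : linear_for *%R (fun A : 'M[C]_N => A i j) by move=> k A B; rewrite !mxE.
pose phi : {scalar 'M[C]_N} := HB.pack (fun A : 'M[C]_N => A i j) (GRing.isLinear.Build _ _ _ _ _ lin).
have BT : {in so C N & so C N, forall u w : 'M[C]_N, form_so m r u w = trform kappa u w}.
  by move=> u w uso wso; rewrite form_so_trace // trformC.
have nd : {in so C N, forall w : 'M[C]_N, {in so C N, forall u : 'M[C]_N, trform kappa u w = 0} -> w = 0}.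
  move=> w wso w0; apply: so_trace_nondeg => // k l; have /eqP := w0 _ (delta_skew_so C k l).
  by rewrite /trform mulf_eq0 (negPf kappa0) => /eqP.
have := @rieszE C _ (so C N) (so C N) (fun u => trform kappa u) (trform_linear_r _) _ phi BT nd a aso.
by rewrite -[LHS]/(trform _ _ _) trformC.
Qed.

Hypothesis normV : 2 * kappa * cV ^+ 2 = 1.

Lemma det1X_slice_block a v (c : 'rV[C]_m) j : a \in so C N -> (j <= 2 * m)%N ->
  (det1X (e + slice_elt a v c))`_j = (det1X a * det1X (drsubmx (e + slice_elt a v c)))`_j.
Proof.
move=> aso jm; have Yk : slice_elt a v c \in kf by apply: slice_elt_kerf.
have XE := slice_block m0 v c aso.
have ulE : ulsubmx (e + slice_elt a v c) = a by rewrite {1}XE block_mxKul.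
rewrite (@det1X_corner C N m (e + slice_elt a v c) j _ _ _ jm) ?ulE //.
- move=> i k k0; rewrite XE block_mxEur mxE big_ord1 [X in _ * X]mxE.
  by rewrite (negPf k0) andbF mulr0.
- move=> i k k0; rewrite XE block_mxEdl mxE mxE big_ord1 [X in X * _]mxE.
  by rewrite (negPf k0) mul0r oppr0.
move=> k l kl; apply/eqP; apply: contraTT kl => /(slice_hessenberg m0 Yk).
by rewrite !levelr -leqNgt.
Qed.

(** [gamma_sum] for D = det (1 + td) and [spinE] yield the same sum. Its factor (-1)^m in
    [gamma_sum] equals 2 kappa cV^2 (-1)^m from the bracket by [normV]. *)
Lemma evh_gamma x y a v (c : 'rV[C]_m) : a \in so C N ->
  evh (slice_elt a v c) (\sum_(j < m) Hzeta C N j * gamma j x y (so_point N m r) + gamma m x y (so_point N m r)) =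
  cV ^+ 2 * pb r (slice_elt a v c) (vgrad a v c x) (vgrad a v c y).
Proof.
move=> aso; set Y := slice_elt a v c; have Yk : Y \in kf by apply: slice_elt_kerf.
pose D : {poly C^o} := det1X (drsubmx (e + Y)).
have corner j : (j <= 2 * m)%N -> (det1X (e + Y))`_j = (det1X (a : 'M[C^o]_N) * D)`_j.
  exact: det1X_slice_block.
rewrite linearD linear_sum /=.
have -> : \sum_(j < m) evh Y (Hzeta C N j * gamma j x y (so_point N m r)) =
   \sum_(j < m) (-1) ^+ (m - j) * (det1X (a : 'M[C^o]_N) * D)`_(2 * (m - j)) * gamma j x y (a : 'M[C^o]_N).
  apply: eq_bigr => j _; rewrite rmorphM /= evh_Hzeta // corner; last by have := ltn_ord j; lia.
  by rewrite map_gamma evh_so_point.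
rewrite map_gamma evh_so_point //.
have D0 : D`_0 = 1 by apply: det1X_0.
have Dodd i : odd i -> D`_i = 0 by apply: (det1X_slice_low_odd v c aso).
have aT : (a : 'M[C^o]_N)^T = - a by apply/mem_soP.
apply: etrans (@gamma_sum C N C^o m x y a D aT D0 Dodd) _.
rewrite /pb vgrad_bracket // spinE //.
have -> : cV ^+ 2 * (kappa * (- 2 * (-1) ^+ m * - \sum_(i < m.+1) (det1X (drsubmx (e + Y)))`_(2 * i) *
      \sum_k \sum_l x k 0 * y l 0 * (a ^+ (2 * (m - i)).+1) k l)) =
    2 * kappa * cV ^+ 2 * ((-1) ^+ m * \sum_(i < m.+1) (det1X (drsubmx (e + Y)))`_(2 * i) *
      \sum_k \sum_l x k 0 * y l 0 * (a ^+ (2 * (m - i)).+1) k l).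
  move: (\sum_(i < m.+1) _) ((-1) ^+ m) => z t; ring.
by rewrite normV mul1r.
Qed.
Lemma pb_gradg_lift w w' Y : Y \in kf ->
  pb r Y (gradg (e + Y) (gen_lift w)) (gradg (e + Y) (gen_lift w')) = evh Y (Hcl_gen r w w').
Proof.
move=> /kerfP[a [v [c [aso ->]]]]; rewrite pb_lift //.
case: w w' => [[A x] c1] [[A' x'] c1'] /=; rewrite -[in RHS]addrA [RHS]linearD /= evh_gamma //; congr (_ + _).
have LA : lie (vsval A) (vsval A') \in so C N.
  by apply: lie_mem; rewrite ?mul1mx //; apply: subvsP.
rewrite [RHS]linearD /= evh_Hso evh_HV vsprojK // !mxtrace_head_part_slice // mul0mx mxtrace0 (dotpC 0) dotp0.
rewrite [dotp (cV *: _) _](_ : _ = cV * dotp (vsval A *m x' - vsval A' *m x) v); first by ring.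
by rewrite /dotp mulr_sumr; apply: eq_bigr => i _; rewrite mxE mulrA.
Qed.

Lemma pb_alg_lift t a Y : Y \in kf -> pb r Y t (gradg (e + Y) (alg_lift a)) =
  \sum_i evh Y a^`M(i) * pb r Y t (gradg (e + Y) (gen_lift (vbasis {: W})`_i)).
Proof.
move=> Yk; pose D (p : Hcl) : C^o := pb r Y t (gradg (e + Y) (alg_lift p)).
have Dadd : additive D by move=> p1 p2; rewrite /D !linearB.
pose Da : {additive Hcl -> C^o} := HB.pack D (GRing.isAdditive.Build Hcl C^o D Dadd).
have DM (p1 p2 : Hcl) : Da (p1 * p2) = Da p1 * evh Y p2 + evh Y p1 * Da p2.
  have pbD (k1 k2 : C) u1 u2 : pb r Y t (k1 *: u1 + k2 *: u2) = k1 * pb r Y t u1 + k2 * pb r Y t u2.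
    by rewrite linearD /= !linearZ.
  have liftM : alg_lift (p1 * p2) = alg_lift p1 * alg_lift p2 by apply: rmorphM.
  have DE : pb r Y t (gradg (e + Y) (alg_lift (p1 * p2))) =
      evz Y (Th p2) * D p1 + evz Y (Th p1) * D p2.
    by rewrite liftM gradgM pbD !(evz_Th cV m0 kappa0 _ Yk).
  by apply: etrans DE _; congr (_ + _); apply: mulrC.
have DC k : Da k%:MP = 0.
  rewrite -[LHS]/(D _) /D -[_%:MP]mulr1 mul_mpolyC !linearZ /= rmorph1
    (_ : gradg _ 1 = 0) ?linear0 ?mulr0 //.
  by rewrite /gradg big1 // => i _; rewrite -mpolyC1 mderivC linear0 scale0r.
apply: etrans (derivation_mpoly DM DC a) _; apply: eq_bigr => i _; congr (_ * _).
by rewrite -[LHS]/(D _) /D -symv_vbasis alg_lift_symv.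
Qed.

Lemma evg_bracket_alg_lift a b Y : Y \in kf ->
  evg (e + Y) (bracket_g (alg_lift a) (alg_lift b)) = evh Y (bracket_H r a b).
Proof.
move=> Yk; have Xg : e + Y \in g by rewrite memvD ?em_gso ?kerf_gso.
rewrite evg_bracket // -[LHS]/(pb r Y _ _) pbC pb_alg_lift // /bracket_H /biderivation [RHS]linear_sum /= -sumrN.
apply: eq_bigr => i _; rewrite -mulrN -pbC pb_alg_lift // [RHS]linear_sum mulr_sumr /=; apply: eq_bigr => j _.
by rewrite mulrA !rmorphM /= pb_gradg_lift.
Qed.

(** Two invariant lifts of one function have gradients with equal pairing with Ker (ad f), by
    [gradg_restrict]. So [bracket_unique] trades f1 and f2 for the chosen lifts, one argument at a
    time. *)
Lemma slice_bracket_Th a b : slice_bracket r (Th a) (Th b) (Th (bracket_H r a b)).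
Proof.
split=> [||f1 f2 inv1 inv2 fa fb].
- by exists (alg_lift a); [apply: alg_lift_invariant|apply: restrict_alg_lift].
- by exists (alg_lift b); [apply: alg_lift_invariant|apply: restrict_alg_lift].
apply/eqP; rewrite -subr_eq0; apply/eqP; apply: (slice_separation m0 kappa0) => Y Yk.
rewrite rmorphB /= (evz_restrict m0 kappa0) //.
have Xg : e + Y \in g by rewrite memvD ?em_gso ?kerf_gso.
have grad_kerf (f : Sg) (p : Hcl) Y' : Defs.restrict r f = Th p -> Y' \in kf ->
    \tr (gradg (e + Y) f *m Y') = \tr (gradg (e + Y) (alg_lift p) *m Y').
  move=> fp Yk'; have Ef := gradg_restrict m0 kappa0 f Yk Yk'.
  have Ep := gradg_restrict m0 kappa0 (alg_lift p) Yk Yk'.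
  by rewrite fp in Ef; rewrite restrict_alg_lift // in Ep; apply: etrans Ef (esym Ep).
have good (f : Sg) xi : invariant_mod_I r f -> xi \in mneg C N m -> \tr (lie xi (gradg (e + Y) f) *m (e + Y)) = 0.
  by move=> ? ?; apply: (invariant_good m0 kappa0).
have replace (f : Sg) (p : Hcl) t : invariant_mod_I r f -> Defs.restrict r f = Th p ->
    (forall xi, xi \in mneg C N m -> \tr (lie xi t *m (e + Y)) = 0) ->
    pb r Y (gradg (e + Y) f) t = pb r Y (gradg (e + Y) (alg_lift p)) t.
  move=> finv fp tgood; congr (_ * _).
  apply: (bracket_unique m0 kappa0 Yk); [exact: gradg_mem|exact: gradg_mem| | | |exact: tgood].
  - by move=> Y' Yk'; apply: grad_kerf.
  - by move=> xi; apply: good.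
  by move=> xi; apply: good; apply: alg_lift_invariant.
rewrite evg_bracket // -[X in X - _]/(pb r Y _ _) (replace _ a) // => [|xi]; last exact: good.
rewrite pbC (replace _ b) // -?pbC => [|xi]; last by apply: good; apply: alg_lift_invariant.
rewrite -[X in _ - X]/(evh Y _) -evg_bracket_alg_lift // evg_bracket //.
exact: subrr.
Qed.

End Poisson.

(** * Bijectivity *)

Section Triangular.
Context (C : numClosedFieldType) (N m : nat).
Local Notation n := (N + (2 * m).+1)%N.
Local Notation e := (em C N m).
Hypothesis m0 : (0 < m)%N.
Local Notation top k := ((2 * (m - k)).-1).
Local Notation F l := (fm C N m ^+ top l).

(** The powers of f with l <= k descend at least 2 (m - k) - 1 levels and play the part of Z in
    [det1X_hessenberg]: they enter linearly, and the trace with a power of e keeps only l = k. A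
    general phi serves both points (T = C) and functions on the slice (T = [Sz]). *)
Lemma casimir_triangular (T : idomainType) (phi : {rmorphism C -> T}) (L : 'M[T]_n) (c : 'I_m -> T) (k : 'I_m) :
  (forall a b, L a b != 0 -> (level b <= level a)%N) ->
  (det1X (map_mx phi e + (L + \sum_l c l *: map_mx phi (F l))))`_(2 * (m - k)) =
  (det1X (map_mx phi e + (L + \sum_(l < m | (k < l)%N) c l *: map_mx phi (F l))))`_(2 * (m - k))
  - c k * phi (beta C N m (top k)).
Proof.
move=> Ll; have km := ltn_ord k.
have FE l a b : map_mx phi (F l) a b != 0 -> level a = (level b + top l)%N.
  by rewrite mxE fmorph_eq0 => /fm_exp_level.
have sumE (P : pred 'I_m) a b : (\sum_(l | P l) c l *: map_mx phi (F l)) a b != 0 ->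
    exists2 l, P l & level a = (level b + top l)%N.
  rewrite summxE => nz; have /existsP[l /andP[Pl]] : [exists l, P l && (map_mx phi (F l) a b != 0)].
    apply: contraNT nz; rewrite negb_exists => /forallP nz; rewrite big1 // => l Pl.
    by move: (nz l); rewrite Pl negbK => /eqP z; rewrite mxE z mulr0.
  by move=> /FE; exists l.
rewrite [\sum_l _ in LHS](bigID (fun l : 'I_m => (k < l)%N)) /=.
set S1 := \sum_(l < m | (k < l)%N) _; set S2 := \sum_(l < m | ~~ _) _.
have -> : map_mx phi e + (L + (S1 + S2)) = map_mx phi e + (L + S1) + S2 by rewrite !addrA.
rewrite (@det1X_hessenberg T n (@level N m) (2 * m).+1 (@level_lt N m)) ?muln_gt0 ?subn_gt0 //.
- apply: congr1; rewrite -signr_odd (_ : odd _ = true) ?expr1 ?mulN1r; last by lia.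
  apply: congr1; rewrite /S2 mulmx_sumr linear_sum (bigD1 k) /= -?leqNgt // big1 ?addr0 => [|l /andP[kl lk]].
    rewrite -scalemxAr mxtraceZ; congr (_ * _).
    by rewrite -map_mx_exp -map_mxM /= -trace_map_mx.
  rewrite -scalemxAr mxtraceZ -map_mx_exp -map_mxM /= trace_map_mx mxtrace_em_fm_neq ?rmorph0 ?mulr0 //.
  - by lia.
  - by have := ltn_ord l; lia.
  - by have := ltn_ord l; move: kl lk; rewrite -leqNgt -val_eqE /=; lia.
- by move=> a b; rewrite mxE fmorph_eq0 => /em_level.
- move=> a b; rewrite mxE; have [->|/Ll //] := eqVneq (L a b) 0; rewrite add0r.
  by move=> /sumE[l _ ->]; apply: leq_addr.
by move=> a b /sumE[l]; rewrite -leqNgt => kl ->; lia.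
Qed.

Lemma casimir_values (L : 'M[C]_n) (t : 'I_m -> C) :
  (forall a b, L a b != 0 -> (level b <= level a)%N) ->
  exists c : 'rV[C]_m, forall k : 'I_m, (det1X (e + (L + \sum_l c 0 l *: F l)))`_(2 * (m - k)) = t k.
Proof.
move=> Ll; have idE (A : 'M[C]_n) : map_mx idfun A = A by apply: map_mx_id.
have tri (c : 'I_m -> C) (k : 'I_m) :
    (det1X (e + (L + \sum_l c l *: F l)))`_(2 * (m - k)) =
    (det1X (e + (L + \sum_(l < m | (k < l)%N) c l *: F l)))`_(2 * (m - k)) - c k * beta C N m (top k).
  have := @casimir_triangular C idfun L c k Ll; rewrite !idE.
  by under eq_bigr do rewrite idE; under [in X in _ = X -> _]eq_bigr do rewrite idE.
suff H j : (j <= m)%N -> exists c : 'I_m -> C, forall k : 'I_m, (m - j <= k)%N ->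
    (det1X (e + (L + \sum_l c l *: F l)))`_(2 * (m - k)) = t k.
  have [c cP] := H m (leqnn _); exists (\row_l c l) => k.
  have -> : \sum_l (\row_l c l) 0 l *: F l = \sum_l c l *: F l by apply: eq_bigr => l _; rewrite mxE.
  by apply: cP; rewrite subnn.
elim: j => [_|j IHj jm]; first by exists (fun=> 0) => k; have := ltn_ord k; lia.
have [c cP] := IHj (ltnW jm).
have k0m : (m - j.+1 < m)%N by lia.
pose k0 := Ordinal k0m.
pose G k (c : 'I_m -> C) := (det1X (e + (L + \sum_(l < m | (k < l)%N) c l *: F l)))`_(2 * (m - k)).
(* This solves [tri] at k0, where G involves only the coordinates beyond k0, which keep their
   values. *)
pose c' (l : 'I_m) := if l == k0 then (G k0 c - t k0) / beta C N m (top k0) else c l.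
have GE (k : 'I_m) : (k0 <= k)%N -> G k c' = G k c.
  move=> kk; rewrite /G.
  have -> : \sum_(l < m | (k < l)%N) c' l *: F l = \sum_(l < m | (k < l)%N) c l *: F l; last by [].
  apply: eq_bigr => l kl; rewrite /c' (_ : (l == k0) = false) //.
  by apply/eqP => lk; move: kl; rewrite lk ltnNge kk.
exists c' => k kk; rewrite tri -/(G k c') GE //; have [->|nk] := eqVneq k k0.
  rewrite /c' eqxx divfK ?subKr //; apply: beta_neq0 => //.
  by rewrite /k0 /=; clear -jm; lia.
have kk' : (m - j <= k)%N by move: nk kk; rewrite -val_eqE /=; clear; lia.
by rewrite /c' (negPf nk) -(tri c k); apply: cP.
Qed.

End Triangular.

Section Bijectivity.
Context (C : numClosedFieldType) (N m : nat) (r cV : C).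
Local Notation q := (2 * m).+1.
Local Notation n := (N + q)%N.
Local Notation e := (em C N m).
Local Notation zc := (zcent C N m).
Local Notation kf := (kerf C N m).
Local Notation Sz := (Sz C N m).
Local Notation W := (W C N m).
Local Notation Hcl := (Hcl C N m).
Local Notation kappa := (kappa N m r).
Local Notation evz := (@evz C N m r).
Local Notation Th := (@Th C N m r cV).
Local Notation evh := (@evh C N m r cV).
Local Notation gen_lift := (@gen_lift C N m r cV).
Local Notation top k := ((2 * (m - k)).-1).
Local Notation F l := (fm C N m ^+ top l).
Implicit Types (Y Z : 'M[C]_n) (w : W) (x : 'cV[C]_N).
Hypothesis m0 : (0 < m)%N.
Hypothesis kappa0 : kappa != 0.
Hypothesis cV0 : cV != 0.

Let kcV0 : - 2 * (kappa * cV) != 0.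
Proof. by rewrite mulf_neq0 ?oppr_eq0 ?pnatr_eq0 // mulf_neq0. Qed.

Lemma W_generators (A : subvs_of (so C N)) x (c : 'rV[C]_m) :
  ((A, x, c) : W) = ((A, 0, 0) : W) + \sum_i x i 0 *: ((0, delta_mx i 0, 0) : W)
    + \sum_k c 0 k *: ((0, 0, delta_mx 0 k) : W).
Proof.
have -> : \sum_i x i 0 *: ((0, delta_mx i 0, 0) : W) = (0, x, 0).
  rewrite [in RHS](matrix_sum_delta x); under [in RHS]eq_bigr => i _ do rewrite big_ord1.
  apply/esym; elim/big_rec2: _ => [//|i y1 y2 _ <-].
  by rewrite -[RHS]/((x i 0 *: 0 + 0, x i 0 *: delta_mx i 0 + y2, x i 0 *: 0 + 0) : W) !scaler0 !addr0.
have -> : \sum_k c 0 k *: ((0, 0, delta_mx 0 k) : W) = (0, 0, c).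
  rewrite [in RHS](matrix_sum_delta c) big_ord1.
  apply/esym; elim/big_rec2: _ => [//|k y1 y2 _ <-].
  by rewrite -[RHS]/((c 0 k *: 0 + 0, c 0 k *: 0 + 0, c 0 k *: delta_mx 0 k + y2) : W) !scaler0 !addr0.
by rewrite -[RHS]/((A + 0 + 0, 0 + x + 0, 0 + 0 + c) : W) !addr0 !add0r.
Qed.

(** Every point of the spectrum of [Hcl] comes from the slice: a by duality, v by division, c by
    [casimir_values]. Hence an element of the kernel of Th vanishes at all points. *)
Lemma evh_point (lam : {scalar W}) : exists2 Y, Y \in kf & forall w, evh Y (symv fullv w) = lam w.
Proof.
pose lso (i : 'I_(\dim (so C N))) := lam ((vsproj (so C N) (vbasis (so C N))`_i, 0, 0) : W).
have [||a aso aE] := @dual_point C _ (so C N) (so C N) (fun u => trform kappa u) _ _ lso.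
- exact: trform_linear_r.
- move=> w wso w0; apply: so_trace_nondeg => // k l; have /eqP := w0 _ (delta_skew_so C k l).
  by rewrite /trform mulf_eq0 (negPf kappa0) mxtrace_mulC => /eqP.
pose v : 'cV[C]_N := \col_i (lam ((0, delta_mx i 0, 0) : W) / (- 2 * (kappa * cV))).
have Ll s t : (slice_elt a v 0 : 'M[C]_n) s t != 0 -> (level t <= level s)%N by apply: slice_elt_level.
have [c cE] := casimir_values m0 (fun k => (-1) ^+ (m - k) * lam ((0, 0, delta_mx 0 k) : W)) Ll.
have YE : slice_elt a v c = slice_elt a v 0 + \sum_l c 0 l *: F l.
  by rewrite /slice_elt [in RHS]big1 ?addr0 // => k _; rewrite mxE scale0r.
have Yk : slice_elt a v c \in kf by apply: slice_elt_kerf.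
exists (slice_elt a v c) => // -[[A x] b].
pose ev0 w : C := evh (slice_elt a v c) (symv fullv w).
have ev_lin : linear_for *%R ev0 by move=> k w w'; rewrite /ev0 !linearP.
pose ev : {scalar W} := HB.pack ev0 (GRing.isLinear.Build C W C *%R ev0 ev_lin).
have evZ (k : C) w : ev0 (k *: w) = k * ev0 w by rewrite /ev0 !linearZ.
rewrite -[LHS]/(ev _) W_generators !linearD !linear_sum /=.
congr (_ + _ + _).
- rewrite -[LHS]/(evh _ (Hso m A)) evh_Hso // mxtrace_head_part_slice // (dotpC 0) dotp0 mulr0 subr0.
  rewrite -[LHS]/(trform kappa a (vsval A)) -[A in RHS]vsvalK.
  pose L0 (B : 'M[C]_N) := lam ((vsproj (so C N) B, 0, 0) : W).
  have L_lin : linear_for *%R L0.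
    move=> k B B'; rewrite /L0 -linearZ -linearD /= linearP; congr (lam _).
    by rewrite -[RHS]/((k *: _ + _, k *: 0 + 0, k *: 0 + 0) : W) !scaler0 !addr0.
  pose L : {scalar 'M[C]_N} := HB.pack L0 (GRing.isLinear.Build C 'M[C]_N C *%R L0 L_lin).
  rewrite -[RHS]/(L (vsval A)) (coord_vbasis (subvsP A)) !linear_sum; apply: eq_bigr => i _.
  rewrite [LHS]linearZ [RHS]linearZ; congr (_ * _); apply: etrans (trformC _ _ _) (aE i).
- apply: eq_bigr => i _; rewrite linearZ /= evZ -[ev0 _]/(evh _ (HV m (delta_mx i 0))) evh_HV // mxtrace_head_part_slice //.
  rewrite mul0mx mxtrace0 sub0r dotpC dotp_deltar mxE; congr (_ * _).
  have swap t : cV * (kappa * - (2 * t)) = t * (- 2 * (kappa * cV)) by ring.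
  by rewrite swap divfK.
apply: eq_bigr => k _; rewrite linearZ /= evZ -[ev0 _]/(evh _ (Hzeta C N k)) evh_Hzeta //; congr (_ * _).
by rewrite YE cE mulrA -expr2 sqrr_sign mul1r.
Qed.

Lemma Th_inj : injective Th.
Proof.
apply: raddf_inj => p p0; apply: mpoly_vanish => v.
pose lam0 w := (symv fullv w).@[v].
have lam_lin : linear_for *%R lam0 by move=> k w w'; rewrite /lam0 linearP /= mevalD mevalZ.
pose lam : {scalar W} := HB.pack lam0 (GRing.isLinear.Build C W C *%R lam0 lam_lin).
have [Y Yk YE] := evh_point lam.
have : evh Y p = 0 by rewrite /evh p0 rmorph0.
move=> <-; rewrite /evh /evz /symev /Th comp_mpoly_meval; apply: meval_eq => i.
rewrite tnth_mktuple -[RHS]/(evz Y _) -Th_symv //; apply: etrans (esym (YE _)).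
by rewrite -[RHS]/(lam0 _) /lam0 symv_vbasis mevalXU.
Qed.

Definition vhat : 'cV[Hcl]_N := \col_i ((- 2 * (kappa * cV))^-1 *: HV m (delta_mx i 0)).

(* The tautological point of the slice, without [e] and the powers of [f] *)
Definition head_point : 'M[Hcl]_n :=
  block_mx (so_point N m r) (vhat *m delta_mx 0 ord0) (- (delta_mx ord_max 0 *m vhat^T)) 0.

(** The coordinate c_k as a function on the slice: e^(2(m-k)-1) pairs with Y to kappa beta c_k. *)
Definition fcoord (k : 'I_m) : Sz := (kappa * beta C N m (top k))^-1 *: symv zc (e ^+ top k).

Lemma evh_head_point a v (c : 'rV[C]_m) : a \in so C N ->
  map_mx (evh (slice_elt a v c)) head_point = slice_elt a v 0.
Proof.
move=> aso; have vE : map_mx (evh (slice_elt a v c)) vhat = v.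
  apply/colP => i; rewrite !mxE linearZ /= evh_HV // mxtrace_head_part_slice // mul0mx mxtrace0 sub0r.
  rewrite dotpC dotp_deltar.
  have swap t : cV * (kappa * - (2 * t)) = (- 2 * (kappa * cV)) * t by ring.
  by rewrite swap; apply: (mulKf kcV0).
rewrite /head_point map_block_mx evh_so_point // map_mxN !map_mxM /= -map_trmx vE !map_delta_mx map_mx0.
by rewrite /slice_elt big1 ?addr0 // => k _; rewrite mxE scale0r.
Qed.

Lemma em_exp_zcent (k : 'I_m) : e ^+ top k \in zc.
Proof.
apply/zcentP; exists (0, 0, delta_mx 0 k); rewrite iotabarE /= (bigD1 k) //= big1 => [|l lk].
  by rewrite mxE !eqxx scale1r addr0 /head_part mul0mx trmx0 mulmx0 oppr0 block_mx_const add0r.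
by rewrite mxE (negPf lk) andbF scale0r.
Qed.

Lemma evz_fcoord a v (c : 'rV[C]_m) k : a \in so C N -> evz (slice_elt a v c) (fcoord k) = c 0 k.
Proof.
move=> aso; rewrite linearZ /= evz_symv ?em_exp_zcent //.
have := pairing_slice m0 0 0 (delta_mx 0 k) a v c.
rewrite mul0mx mxtrace0 dotpC dotp0 mulr0 subrr add0r (bigD1 k) //= big1 => [|l lk]; last first.
  by rewrite mxE (negPf lk) andbF scale0r.
rewrite [delta_mx _ _ _ _]mxE !eqxx scale1r addr0 /head_part mul0mx trmx0 mulmx0 oppr0 block_mx_const add0r.
move=> ->; rewrite (bigD1 k) //= big1 => [|l lk]; last by rewrite mxE (negPf lk) andbF !mul0r.
rewrite [delta_mx _ _ _ _]mxE !eqxx mul1r addr0 [c 0 k * _]mulrC [kappa * (_ * _)]mulrA mulKf // mulf_neq0 //.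
by apply: beta_neq0 => //; have := ltn_ord k; lia.
Qed.

Lemma slice_pointE : slice_point N m r =
  map_mx (@mpolyC (\dim zc) C) e + (map_mx Th head_point + \sum_k fcoord k *: map_mx (@mpolyC (\dim zc) C) (F k)).
Proof.
apply/matrixP => s t; apply/eqP; rewrite -subr_eq0; apply/eqP; apply: (slice_separation m0 kappa0) => Y Yk.
rewrite rmorphB /=; apply/eqP; rewrite subr_eq0; apply/eqP.
have mE (M : 'M[Sz]_n) : evz Y (M s t) = map_mx (evz Y) M s t by rewrite mxE.
have evC (A : 'M[C]_n) : map_mx (evz Y) (map_mx (@mpolyC (\dim zc) C) A) = A.
  by apply/matrixP => i j; rewrite !mxE [evz Y _]mevalC.
rewrite !mE (evz_slice_point m0 kappa0) //; congr (fun_of_matrix _ s t).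
rewrite !map_mxD /= evC -map_mx_comp; congr (_ + _).
have [a [v [c [aso YE]]]] := kerfP _ Yk; rewrite YE [map_mx _ head_point](evh_head_point v c aso).
rewrite /slice_elt [in RHS]big1 ?addr0 => [|k _]; last by rewrite mxE scale0r.
congr (_ + _); rewrite -/(slice_elt a v c) -YE.
have -> : map_mx (evz Y) (\sum_k fcoord k *: map_mx (@mpolyC (\dim zc) C) (F k)) =
    \sum_k map_mx (evz Y) (fcoord k *: map_mx (@mpolyC (\dim zc) C) (F k)) by apply: raddf_sum.
by apply: eq_bigr => k _; rewrite map_mxZ /= evC YE evz_fcoord.
Qed.

Lemma head_point_level s t : map_mx Th head_point s t != 0 -> (level t <= level s)%N.
Proof.
apply: contraNT => lst; rewrite mxE; apply/eqP; apply: (slice_separation m0 kappa0) => Y Yk.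
have [a [v [c [aso YE]]]] := kerfP _ Yk.
have := evh_head_point v c aso; move/matrixP/(_ s t); rewrite mxE -YE /evh => ->.
apply/eqP; apply: contraNT lst; exact: slice_elt_level.
Qed.

(** The triangular relation of [casimir_triangular], solved for the coordinates by descending k
    inside the image of Th. *)
Lemma fcoord_image : exists c : 'I_m -> Hcl, forall k, Th (c k) = fcoord k.
Proof.
suff H j : (j <= m)%N -> exists c : 'I_m -> Hcl, forall k : 'I_m, (m - j <= k)%N -> Th (c k) = fcoord k.
  by have [c cP] := H m (leqnn _); exists c => k; apply: cP; rewrite subnn.
elim: j => [_|j IHj jm]; first by exists (fun=> 0) => k; have := ltn_ord k; lia.
have [c cP] := IHj (ltnW jm).
have k0m : (m - j.+1 < m)%N by lia.
pose k0 := Ordinal k0m.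
pose M : 'M[Hcl]_n := map_mx (@mpolyC (\dim {: W}) C) e +
  (head_point + \sum_(l < m | (k0 < l)%N) c l *: map_mx (@mpolyC (\dim {: W}) C) (F l)).
(* Th maps the determinant coefficient minus the signed zeta to beta times [fcoord k0]: the sign
   squares to 1 against the one in [Th_Hzeta]. *)
pose c0 : Hcl := (beta C N m (top k0))^-1 *: ((det1X M)`_(2 * (m - k0)) - (-1) ^+ (m - k0) *: Hzeta C N k0).
exists (fun l => if l == k0 then c0 else c l) => k kk.
have [->|nk] := eqVneq k k0; last first.
  by apply: cP; move: nk kk; rewrite -val_eqE /=; clear; lia.
have ThC (A : 'M[C]_n) : map_mx Th (map_mx (@mpolyC (\dim {: W}) C) A) = map_mx (@mpolyC (\dim zc) C) A.
  by apply/matrixP => i l; rewrite !mxE; apply: comp_mpolyC.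
have ThM : map_mx Th M = map_mx (@mpolyC (\dim zc) C) e + (map_mx Th head_point +
    \sum_(l < m | (k0 < l)%N) fcoord l *: map_mx (@mpolyC (\dim zc) C) (F l)).
  rewrite /M !map_mxD /= ThC; congr (_ + (_ + _)).
  have -> : map_mx Th (\sum_(l < m | (k0 < l)%N) c l *: map_mx (@mpolyC (\dim {: W}) C) (F l)) =
    \sum_(l < m | (k0 < l)%N) map_mx Th (c l *: map_mx (@mpolyC (\dim {: W}) C) (F l)) by apply: raddf_sum.
  by apply: eq_bigr => l kl; rewrite map_mxZ /= ThC cP //; move: kl => /=; lia.
have tri : Theta N m r k0 = Th (det1X M)`_(2 * (m - k0)) - fcoord k0 * (beta C N m (top k0))%:MP.
  have -> : Th (det1X M)`_(2 * (m - k0)) = (det1X (map_mx Th M))`_(2 * (m - k0)) by apply: coef_det1X_map.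
  rewrite ThM /Theta slice_pointE.
  exact: (@casimir_triangular C N m m0 Sz (@mpolyC (\dim zc) C) (map_mx Th head_point) fcoord k0 head_point_level).
rewrite /c0 linearZ linearB /= linearZ /= Th_Hzeta // scalerA -expr2 sqrr_sign scale1r tri.
rewrite subKr mulrC mul_mpolyC scalerA mulVf ?scale1r //.
by apply: beta_neq0 => //; have := ltn_ord k0; lia.
Qed.

Lemma symv_image Z : Z \in zc -> exists p, Th p = symv zc Z.
Proof.
move=> /zcentP[[[A x] b] ->]; have [c cP] := fcoord_image.
exists (Hso m A + cV^-1 *: HV m x + \sum_k (b 0 k * (kappa * beta C N m (top k))) *: c k).
have ThD p1 p2 : Th (p1 + p2) = Th p1 + Th p2 by exact: linearD.
have ThS (h : 'I_m -> Hcl) : Th (\sum_k h k) = \sum_k Th (h k) by exact: linear_sum.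
have ThZ (k : C) p1 : Th (k *: p1) = k *: Th p1 by exact: linearZ.
rewrite 2!ThD ThS ThZ Th_Hso // Th_HV // scalerA mulVf // scale1r -linearD.
have headD : head_part m (vsval A) 0 + head_part m 0 x = head_part m (vsval A) x.
  by have := head_part_linear m 1 (vsval A) 0 0 x; rewrite !scale1r addr0 add0r => ->.
rewrite headD -/(iotabar ((A, x, b) : W)) (iotabarE (A, x, b)) linearD linear_sum /=; congr (_ + _).
apply: eq_bigr => k _; rewrite ThZ cP /fcoord scalerA mulfK ?linearZ //.
by rewrite mulf_neq0 //; apply: beta_neq0 => //; have := ltn_ord k; lia.
Qed.

Lemma Th_surj p : exists h, Th h = p.
Proof.
have im (i : 'I_(\dim zc)) : exists h, Th h == symv zc (vbasis zc)`_i.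
  have [|h hE] := @symv_image (vbasis zc)`_i; first by rewrite vbasis_mem // mem_nth // size_tuple.
  by exists h; apply/eqP.
pose h := [tuple xchoose (im i) | i < \dim zc]; exists (p \mPo h).
apply/eqP; rewrite -subr_eq0; apply/eqP; apply: (slice_separation m0 kappa0) => Y Yk.
rewrite rmorphB /=; apply/eqP; rewrite subr_eq0; apply/eqP.
rewrite /evz /symev /Th !comp_mpoly_meval; apply: meval_eq => i.
have /eqP := xchooseP (im i); rewrite -(tnth_mktuple (fun i => xchoose (im i)) i) -/h symv_vbasis => /(congr1 (evz Y)).
by rewrite /evz /symev /Th comp_mpoly_meval mevalXU.
Qed.

Lemma Th_bijective : bijective Th.
Proof.
have surj p : exists h, Th h == p by have [h <-] := Th_surj p; exists h.
exists (fun p => xchoose (surj p)) => [a|p]; last exact: (eqP (xchooseP (surj p))).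
by apply: Th_inj; apply: (eqP (xchooseP (surj (Th a)))).
Qed.

End Bijectivity.

(* The invariant form is r times the Killing form. For s = 1 the image of y is
   (-1)^(m/2)/2 times iotabar y; for r = 1 the form is the Killing form. *)
Theorem theorem5p2 (R : realType) (N m : nat) (r s : R[i]) :
  (3 <= N)%N -> (1 <= m)%N ->
  s ^+ 2 * (r * (N + 2 * m - 1)%:R) = 2 * (-1) ^+ m ->
  exists Th : {lrmorphism Hcl R[i] N m -> Sz R[i] N m},
    [/\ forall A : subvs_of (so R[i] N),
          Th (Hso m A) = symv (zcent R[i] N m) (iotabar (A, 0, 0)),
        forall y : 'cV[R[i]]_N,
          Th (HV m y) = (s * ('i ^+ m / 2)) *: symv (zcent R[i] N m) (iotabar (0, y, 0)),
        forall k : 'I_m,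
          Th (Hzeta R[i] N k) = (-1) ^+ (m - k) *: Theta N m r k,
        bijective Th
      & forall a b : Hcl R[i] N m,
          slice_bracket r (Th a) (Th b) (Th (bracket_H r a b))].
Proof.
move=> _ m0 sr; pose cV : R[i] := s * ('i ^+ m / 2).
have sk0 : s ^+ 2 * kappa N m r != 0 by rewrite sr mulf_neq0 ?signr_eq0 ?pnatr_eq0.
have kappa0 : kappa N m r != 0 by move: sk0; rewrite mulf_eq0 negb_or => /andP[].
have s0 : s != 0 by move: sk0; rewrite mulf_eq0 negb_or sqrf_eq0 => /andP[].
have cV0 : cV != 0 by rewrite !mulf_neq0 ?expf_neq0 ?neq0Ci ?invr_eq0 ?pnatr_eq0.
(* Since i^(2m) = (-1)^m, the left side is s^2 kappa (-1)^m / 2, and [sr] makes it 1. *)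
have normV : 2 * kappa N m r * cV ^+ 2 = 1.
  have -> : 2 * kappa N m r * cV ^+ 2 = s ^+ 2 * kappa N m r * ('i ^+ 2) ^+ m / 2.
    by rewrite -exprM mulnC exprM /cV; field.
  have -> : s ^+ 2 * kappa N m r = 2 * (-1) ^+ m by exact: sr.
  by rewrite sqrCi -(mulrA 2) -expr2 sqrr_sign mulr1 divff ?pnatr_eq0.
have iotabar0 (A : subvs_of (so R[i] N)) x : iotabar ((A, x, 0) : W R[i] N m) = head_part m (vsval A) x.
  by rewrite iotabarE /= big1 ?addr0 // => k _; rewrite mxE scale0r.
exists (Th r cV); split.
- by move=> A; rewrite iotabar0; apply: Th_Hso.
- by move=> y; rewrite iotabar0; apply: Th_HV.
- by move=> k; apply: Th_Hzeta.
- exact: Th_bijective.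
by move=> a b; apply: slice_bracket_Th.
Qed.
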